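(* Let $-\infty<\omega_*<\omega^*<+\infty$ and let $M_0\in H^1((\omega_*,\omega^* ),\mathbb{S}^2)$. There exist $(t_n)_{n\in\mathbb{N}}\in[0,+\infty)^{\mathbb{N}}$ and $(u_n)_{n\in\mathbb{N}},(v_n)_{n\in\mathbb{N}}\in D^{\mathbb{N}}$ such that $$U[t_n^+;u_n,v_n,M_0]\to e_3\quad\text{weakly in } H^1((\omega_*,\omega^* ),\mathbb{R}^3)\ \text{ as } n\to+\infty .$$
   Context: $\mathbb{S}^2$ is the unit sphere of $\mathbb{R}^3$, $e_3=(0,0,1)^t$ (also identified with a constant function), and $$\Omega_x=\begin{pmatrix}0&0&0\\0&0&-1\\0&1&0\end{pmatrix},\quad \Omega_y=\begin{pmatrix}0&0&1\\0&0&0\\-1&0&0\end{pmatrix},\quad \Omega_z=\begin{pmatrix}0&-1&0\\1&0&0\\0&0&0\end{pmatrix}.$$ $H^1((\omega_*,\omega^* ),\mathbb{S}^2):=\{M\in H^1((\omega_*,\omega^* ),\mathbb{R}^3):\ M(\omega)\in\mathbb{S}^2\ \forall\omega\}$. The control system is the Bloch equation $$\frac{\partial M}{\partial t}(t,\omega)=(\omega\Omega_z+u(t)\Omega_x+v(t)\Omega_y)M(t,\omega),\quad (t,\omega)\in[0,+\infty)\times(\omega_*,\omega^* ).$$ $D$ is the set of finite sums of (real-weighted) Dirac masses on $[0,+\infty)$. For controls $u=\sum_{j=1}^m\beta_j\delta_{b_j}$, $v=\sum_{j=1}^m\gamma_j\delta_{b_j}$ with $0\le b_1<\dots<b_m$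 and $\beta_j,\gamma_j\in\mathbb{R}$ (possibly zero), the solution with initial condition $M_0$ is defined as follows: it evolves by the free flow $M(t,\omega)=\exp(\omega\Omega_z(t-s))M(s,\omega)$ between the times $b_j$, and at each $b_j$ it jumps according to $M(b_j^+,\omega)=\exp(\beta_j\Omega_x+\gamma_j\Omega_y)M(b_j^-,\omega)$ (with $M(0^-,\omega)=M_0(\omega)$). $U[t;u,v,M_0]$ denotes the value at time $t$ of the solution with initial condition $M_0$ at time $0$, a function of $\omega\in(\omega_*,\omega^* )$, and $U[t^+;u,v,M_0]$ its right limit at $t$ (after the possible jump at time $t$). *)

(* Defs.v *)
From HB Require Import structures.
From mathcomp Require Import all_boot all_order all_algebra finmap.
From mathcomp Require Import all_classical all_reals all_analysis.

Set Implicit Arguments.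
Unset Strict Implicit.
Unset Printing Implicit Defensive.

Import Order.TTheory GRing.Theory Num.Theory.
Import numFieldNormedType.Exports.

Local Open Scope classical_set_scope.
Local Open Scope ring_scope.

(** * The Sobolev space H^1((a, b), R^k)

    A function on the open interval (a, b) is represented by a function on [R]
    whose values outside (a, b) are never used. *)

Definition L2 {R : realType} (a b : R) (f : R -> R) : Prop :=
  f \_ `]a, b[ \in Lfun (@lebesgue_measure R) 2%:E.

Definition test_function {R : realType} (a b : R) (phi : R -> R) : Prop :=
  [/\ forall x, derivable phi x 1,
      continuous (derive1 phi),
      compact (closure [set x | phi x != 0]) &
      closure [set x | phi x != 0] `<=` `]a, b[].

(** The usual one-dimensional definition, tested against C^1_c((a, b));
    testing against C^infty_c((a, b)) instead defines the same relation. *)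
Definition weak_derivative {R : realType} (a b : R) (f g : R -> R) : Prop :=
  forall phi, test_function a b phi ->
    \int[@lebesgue_measure R]_(x in `]a, b[) (f x * derive1 phi x) =
    - \int[@lebesgue_measure R]_(x in `]a, b[) (g x * phi x).

(** [H1_pair a b f g]: [f] is in H^1((a, b), R^k) and [g] is (a representative
    of) its weak derivative, which is unique almost everywhere. *)
Definition H1_pair {R : realType} {k : nat} (a b : R) (f g : R -> 'cV[R]_k) :
    Prop :=
  forall i : 'I_k, [/\ L2 a b (fun x => f x i 0), L2 a b (fun x => g x i 0) &
    weak_derivative a b (fun x => f x i 0) (fun x => g x i 0)].

Definition H1 {R : realType} {k : nat} (a b : R) : set (R -> 'cV[R]_k) :=
  [set f | exists g, H1_pair a b f g].

(** The library norm on matrices is the sup norm, not the Euclidean one. *)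
Definition eucl_norm {R : realType} {k : nat} (x : 'cV[R]_k) : R :=
  Num.sqrt (\sum_(i < k) x i 0 ^+ 2).

(** The H^1 norm of [f], given its weak derivative [g]. *)
Definition H1_norm {R : realType} {k : nat} (a b : R) (f g : R -> 'cV[R]_k) :
    R :=
  Num.sqrt (\int[@lebesgue_measure R]_(x in `]a, b[)
              (eucl_norm (f x) ^+ 2 + eucl_norm (g x) ^+ 2)).

(** Continuous linear forms on H^1((a, b), R^k). Boundedness makes them
    invariant under modification of the argument on a null set, so that they
    are forms on the space of classes. *)
Definition H1_dual {R : realType} {k : nat} (a b : R) :
    set ((R -> 'cV[R]_k) -> R) :=
  [set L | (forall c f g, H1 a b f -> H1 a b g ->
              L (fun x => c *: f x + g x) = c * L f + L g) /\
           (exists C : R, forall f g, H1_pair a b f g ->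
              `|L f| <= C * H1_norm a b f g)].

Definition H1_weak_cvg {R : realType} {k : nat} (a b : R)
    (f : nat -> R -> 'cV[R]_k) (l : R -> 'cV[R]_k) : Prop :=
  [/\ forall n, H1 a b (f n), H1 a b l &
      forall L, H1_dual a b L -> L (f n) @[n --> \oo] --> L l].

Definition sphere2 {R : realType} : set 'cV[R]_3 := [set x | eucl_norm x = 1].

(** H^1((a, b), S^2). The constraint is imposed on the given representative,
    hence also holds everywhere for the continuous one. *)
Definition H1_sphere {R : realType} (a b : R) : set (R -> 'cV[R]_3) :=
  [set M | H1 a b M /\ forall w, a < w < b -> sphere2 (M w)].

(** * The Bloch equation with impulsive controls *)

Definition mx3 {R : realType} (s : seq (seq R)) : 'M[R]_3 :=
  \matrix_(i < 3, j < 3) nth 0 (nth [::] s i) j.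

Definition Omega_x {R : realType} : 'M[R]_3 :=
  mx3 [:: [:: 0; 0;  0];
          [:: 0; 0; -1];
          [:: 0; 1;  0]].

Definition Omega_y {R : realType} : 'M[R]_3 :=
  mx3 [:: [::  0; 0; 1];
          [::  0; 0; 0];
          [:: -1; 0; 0]].

Definition Omega_z {R : realType} : 'M[R]_3 :=
  mx3 [:: [:: 0; -1; 0];
          [:: 1;  0; 0];
          [:: 0;  0; 0]].

Definition e3 {R : realType} : 'cV[R]_3 := \col_(i < 3) (i == 2%N :> nat)%:R.

Definition expmx {R : realType} {n : nat} (A : 'M[R]_n.+1) : 'M[R]_n.+1 :=
  limn (series (fun k => (k`!%:R)^-1 *: A ^+ k)).

(** A finite sum of weighted Dirac masses is encoded by its finitely supported
    weight function: [u] stands for [\sum_(b <- finsupp u) u b * delta_b]. *)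
Definition dirac_sum (R : realType) := {fsfun R -> R with 0}.

Definition D {R : realType} : set (dirac_sum R) :=
  [set u | forall b, b \in finsupp u -> 0 <= b].

(** The impulse times b_1 < ... < b_m of the pair of controls [(u, v)]; at such
    a time one of the two weights may vanish. *)
Definition impulse_times {R : realType} (u v : dirac_sum R) : seq R :=
  sort <=%O (enum_fset (finsupp u `|` finsupp v)%fset).

Definition free_flow {R : realType} (w t : R) (x : 'cV[R]_3) : 'cV[R]_3 :=
  expmx ((w * t) *: Omega_z) *m x.

Definition jump {R : realType} (u v : dirac_sum R) (b : R) (x : 'cV[R]_3) :
    'cV[R]_3 :=
  expmx (u b *: Omega_x + v b *: Omega_y) *m x.

(** State at time [t], starting from [x] at time [s] and undergoing the jumps
    at the successive times [bs] between [s] and [t]. *)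
Fixpoint evolve {R : realType} (u v : dirac_sum R) (w t s : R) (bs : seq R)
    (x : 'cV[R]_3) : 'cV[R]_3 :=
  if bs is b :: bs' then
    evolve u v w t b bs' (jump u v b (free_flow w (b - s) x))
  else free_flow w (t - s) x.

(** U[t^+; u, v, M0]: all jumps up to and including time [t] are performed. *)
Definition U_right {R : realType} (t : R) (u v : dirac_sum R)
    (M0 : R -> 'cV[R]_3) : R -> 'cV[R]_3 :=
  fun w => evolve u v w t 0 [seq b <- impulse_times u v | b <= t] (M0 w).

(* Main.v *)
From HB Require Import structures.
Require Import Defs.
From mathcomp Require Import all_boot all_order all_algebra finmap.
From mathcomp Require Import all_classical all_reals all_analysis.
From mathcomp Require Import measurable_realfun ring lra.

(** The controls even steer [M0] to [e3] strongly in [H^1]. The proof first makes the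
    derivative of the curve small in [L^2], and then turns the resulting, almost
    constant, curve towards [e3].

    A sequence of impulses multiplies the state at frequency [w] by a rotation
    [flow s w]. As a half-turn about the x axis reverses the free evolution, impulses
    approximate, in the [C^1] topology in [w] over a bounded interval, the flow of
    [w Omega_z] in both directions of time. Conjugating a small jump about the x or
    the y axis by this flow for the times [tau] and [- tau] and subtracting yields, to
    first order, a small rotation of angle proportional to [sin (w * tau)] about the
    other axis. Iterating, adding such first-order contributions and integrating them
    by Euler's scheme produces the rotations about the x and y axes whose angle is a
    polynomial in [sin (w * s) / s], hence in the limit any polynomial in [w]
    ([reach_poly]). Convergence in [C^1] is phrased with jets: a matrix function and
    its derivative form a block matrix, Leibniz's rule is the block product, and
    products, limits and one-parameter groups of jets are those of matrices.

    Let [N] be a curve on the sphere obtained in this way from [M0], and [H] its weak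
    derivative. As [N] is a unit vector, it is orthogonal to [H]
    ([sphere_orthogonal]), so that the three components [z_i] of the cross product of
    [N] and [H] satisfy [\sum_i z_i ^+ 2 = |H| ^+ 2]; one of them carries a third of
    the energy [\int |H| ^+ 2]. A rotation about the axis [i] by an angle [p w] adds
    [p' w] times a vector of norm at most one to [H], up to an isometry, and changes
    [|H| ^+ 2] into at most [|H| ^+ 2 - z_i ^+ 2 + (p' + z_i) ^+ 2]
    ([rotation_energy]). Since polynomials are dense in [L^2] ([poly_dense]), a suitable
    [p] makes the last term negligible: the energy decreases by a factor [2 / 3],
    up to an arbitrary error ([energy_step]), and is made as small as desired by
    iteration ([energy_small]).

    By the Poincare inequality ([poincare]) the curve is then close to a constant unit
    vector, which two constant rotations send to [e3] ([reach_e3], [steer]). A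
    continuous linear form is Lipschitz for the [H^1] norm, so weak convergence
    follows ([H1_strong_weak]). *)

Set Implicit Arguments.
Unset Strict Implicit.
Unset Printing Implicit Defensive.

Import Order.TTheory GRing.Theory Num.Theory.
Import numFieldNormedType.Exports.

Local Open Scope classical_set_scope.
Local Open Scope ring_scope.

(** * Integrals and square-integrable functions on an open interval *)

Section SquareIntegrable.
Context {R : realType} (a b : R) (ab : a < b).
Implicit Types (f g : R -> R).

Notation mu := (@lebesgue_measure R).
Notation Int f := (\int[mu]_(x in `]a, b[) f x).

Definition rint f := mu.-integrable `]a, b[ (EFin \o f).

(** Membership in [L2] (lemma [L2P]), in the form of an integrability condition:
    it reduces the stability of [L2] under the operations below to that of
    integrability. *)
Definition sqint f := measurable_fun (`]a, b[ : set (measurableTypeR R)) f /\ rint (fun x => f x ^+ 2).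

Let mI : measurable (`]a, b[ : set (measurableTypeR R)). Proof. exact: measurable_itv. Qed.

Lemma eq_rint f g : (forall x, a < x < b -> f x = g x) -> rint f -> rint g.
Proof.
by move=> fg; apply: eq_integrable => //= x; rewrite inE/= in_itv/= => /fg ->.
Qed.

Lemma eq_Int f g : (forall x, a < x < b -> f x = g x) -> Int f = Int g.
Proof. by move=> fg; apply: eq_Rintegral => x; rewrite inE/= in_itv/= => /fg. Qed.

Lemma rintD f g : rint f -> rint g -> rint (fun x => f x + g x).
Proof.
by move=> hf hg; exact: (integrableD mI hf hg).
Qed.

Lemma rintZ c f : rint f -> rint (fun x => c * f x).
Proof. by move=> hf; exact: (integrableZl mI c hf). Qed.

Lemma rintN f : rint f -> rint (fun x => - f x).
Proof. by move/(rintZ (-1)); apply: eq_rint => x _; rewrite mulN1r. Qed.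

Lemma rintB f g : rint f -> rint g -> rint (fun x => f x - g x).
Proof. by move=> hf hg; apply: rintD => //; exact: rintN. Qed.

Lemma rint_sum (I : finType) (F : I -> R -> R) :
  (forall i, rint (F i)) -> rint (fun x => \sum_i F i x).
Proof.
move=> hF; rewrite /rint.
have h := @integrable_sum _ _ _ mu _ mI I (index_enum I) xpredT
  (fun i x => (F i x)%:E) (fun i _ => hF i).
by apply: eq_integrable h => //= x _; rewrite sumEFin.
Qed.

Lemma le_rint f g : measurable_fun (`]a, b[ : set (measurableTypeR R)) f -> rint g ->
  (forall x, a < x < b -> `|f x| <= g x) -> rint f.
Proof.
move=> mf hg fg; apply: (le_integrable mI _ _ hg); first exact/measurable_EFinP.
move=> x /=; rewrite in_itv/= => xab; rewrite lee_fin.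
exact: le_trans (fg _ xab) (ler_norm _).
Qed.

Lemma rint_cst c : rint (cst c).
Proof.
apply: measurable_bounded_integrable => //.
- by rewrite [X in (X < _)%E]lebesgue_measure_itv/= lte_fin ab -EFinD ltry.
- by exists `|c|; split => // M cM x _ /=; apply: ltW.
Qed.

Lemma Int_cst c : Int (cst c) = c * (b - a).
Proof.
by rewrite Rintegral_cst// [X in fine X]lebesgue_measure_itv/= lte_fin ab -EFinD.
Qed.

Lemma IntD f g : rint f -> rint g -> Int (fun x => f x + g x) = Int f + Int g.
Proof. by move=> hf hg; rewrite RintegralD. Qed.

Lemma IntB f g : rint f -> rint g -> Int (fun x => f x - g x) = Int f - Int g.
Proof. by move=> hf hg; rewrite RintegralB. Qed.

Lemma IntZ c f : rint f -> Int (fun x => c * f x) = c * Int f.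
Proof. by move=> hf; rewrite RintegralZl. Qed.

Lemma Int_sum (I : finType) (F : I -> R -> R) : (forall i, rint (F i)) ->
  Int (fun x => \sum_i F i x) = \sum_i Int (F i).
Proof.
move=> hF.
have : forall s : seq I, rint (fun x => \sum_(i <- s) F i x) /\
   Int (fun x => \sum_(i <- s) F i x) = \sum_(i <- s) Int (F i).
  elim=> [|i s [ih1 ih2]].
    split; first by apply: eq_rint (rint_cst 0) => x _; rewrite big_nil.
    rewrite big_nil -[RHS](mul0r (b - a)) -Int_cst.
    by apply: eq_Int => x _; rewrite big_nil.
  split.
    by apply: eq_rint (rintD (hF i) ih1) => x _; rewrite big_cons.
  rewrite big_cons -ih2 -IntD//.
  by apply: eq_Int => x _; rewrite big_cons.
by move=> /(_ (index_enum I))[].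
Qed.

Lemma le_Int f g : rint f -> rint g -> (forall x, a < x < b -> f x <= g x) ->
  Int f <= Int g.
Proof. by move=> hf hg fg; apply: le_Rintegral => // x /=; rewrite in_itv/=; exact: fg. Qed.

Lemma Int_ge0 f : (forall x, a < x < b -> 0 <= f x) -> 0 <= Int f.
Proof. by move=> f0; apply: Rintegral_ge0 => x /=; rewrite in_itv/=; exact: f0. Qed.

Lemma rint_norm f : rint f -> rint (fun x => `|f x|).
Proof. by move=> hf; exact: integrable_norm. Qed.

Lemma rintM_sqint f g : sqint f -> sqint g -> rint (fun x => f x * g x).
Proof.
move=> [mf hf] [mg hg]; apply: (@le_rint _ (fun x => f x ^+ 2 + g x ^+ 2)).
- exact: measurable_funM.
- exact: rintD.
- move=> x _; rewrite normrM -(real_normK (num_real (f x))).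
  rewrite -(real_normK (num_real (g x))).
  have := sqr_ge0 (`|f x| - `|g x|); have := normr_ge0 (f x).
  have := normr_ge0 (g x); nra.
Qed.

Lemma eq_sqint f g : (forall x, a < x < b -> f x = g x) -> sqint f -> sqint g.
Proof.
move=> fg [mf hf]; split.
  by apply: eq_measurable_fun mf => x; rewrite inE/= in_itv/=; exact: fg.
by apply: eq_rint hf => x /fg ->.
Qed.

Lemma sqintD f g : sqint f -> sqint g -> sqint (fun x => f x + g x).
Proof.
move=> hf hg; split; first by apply: measurable_funD; [case: hf|case: hg].
have := rintD (rintD (rintM_sqint hf hf) (rintZ 2 (rintM_sqint hf hg)))
  (rintM_sqint hg hg).
by apply: eq_rint => x _; ring.
Qed.

Lemma sqintZ c f : sqint f -> sqint (fun x => c * f x).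
Proof.
move=> [mf hf]; split; first exact: measurable_funM.
by apply: eq_rint (rintZ (c ^+ 2) hf) => x _; rewrite exprMn.
Qed.

Lemma sqintN f : sqint f -> sqint (fun x => - f x).
Proof.
move=> hf; have [m1 h1] := sqintZ (-1) hf.
by rewrite (_ : (fun _ => _) = (fun x => -1 * f x)) //; apply/funext => x; rewrite mulN1r.
Qed.

Lemma sqintB f g : sqint f -> sqint g -> sqint (fun x => f x - g x).
Proof. by move=> hf hg; apply: sqintD => //; exact: sqintN. Qed.

Lemma sqint_sum (I : finType) (F : I -> R -> R) :
  (forall i, sqint (F i)) -> sqint (fun x => \sum_i F i x).
Proof.
move=> hF; elim: (index_enum I) => [|i s ih].
  rewrite (_ : (fun _ => _) = cst 0); last by apply/funext => x; rewrite big_nil.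
  split; first exact: measurable_cst.
  exact: (@eq_rint (cst (0 ^+ 2)) _ _ (rint_cst _)).
rewrite (_ : (fun _ => _) = (fun x => F i x + \sum_(i <- s) F i x)).
  exact: sqintD.
by apply/funext => x; rewrite big_cons.
Qed.

Lemma sqintM_bounded f g K : measurable_fun (`]a, b[ : set (measurableTypeR R)) f ->
  (forall x, a < x < b -> `|f x| <= K) -> sqint g -> sqint (fun x => f x * g x).
Proof.
move=> mf fK [mg hg]; split; first exact: measurable_funM.
apply: (@le_rint _ (fun x => K ^+ 2 * g x ^+ 2)).
- by apply: measurable_funX; exact: measurable_funM.
- exact: rintZ.
- move=> x /fK fxK; rewrite ger0_norm ?sqr_ge0// exprMn ler_wpM2r ?sqr_ge0//.
  by rewrite -(real_normK (num_real (f x))) lerXn2r ?nnegrE// (le_trans _ fxK).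
Qed.

Lemma sqint_cst c : sqint (cst c).
Proof.
split; first exact: measurable_cst.
exact: (@eq_rint (cst (c ^+ 2)) _ _ (rint_cst _)).
Qed.

Lemma sqint_bounded f K : measurable_fun (`]a, b[ : set (measurableTypeR R)) f ->
  (forall x, a < x < b -> `|f x| <= K) -> sqint f.
Proof.
move=> mf fK; have := sqintM_bounded mf fK (sqint_cst 1).
by congr sqint; apply/funext => x; rewrite mulr1.
Qed.

Lemma rint_sqint f : sqint f -> rint f.
Proof.
by move=> hf; apply: eq_rint (rintM_sqint hf (sqint_cst 1)) => x _; rewrite mulr1.
Qed.

Lemma Int_sqr_ge0 f : 0 <= Int (fun x => f x ^+ 2).
Proof. by apply: Int_ge0 => x _; exact: sqr_ge0. Qed.

(** Cauchy-Schwarz, from the nonnegative quadratic polynomial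
    [t |-> Int (t f + g)^2]. *)
Lemma Int_CS f g : sqint f -> sqint g ->
  Int (fun x => f x * g x) ^+ 2 <=
  Int (fun x => f x ^+ 2) * Int (fun x => g x ^+ 2).
Proof.
move=> hf hg.
set F := Int (fun x => f x ^+ 2); set G := Int (fun x => g x ^+ 2).
set P := Int _.
have q t : 0 <= t ^+ 2 * F + 2 * t * P + G.
  have -> : t ^+ 2 * F + 2 * t * P + G = Int (fun x => (t * f x + g x) ^+ 2).
    have [_ hf2] := hf; have [_ hg2] := hg; have hfg := rintM_sqint hf hg.
    have h1 := rintZ (t ^+ 2) hf2; have h2 := rintZ (2 * t) hfg.
    rewrite /F /G /P -IntZ// -IntZ// -(IntD h1 h2) -(IntD (rintD h1 h2) hg2).
    by apply: eq_Int => x _; ring.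
  exact: Int_sqr_ge0.
have F0 : 0 <= F by exact: Int_sqr_ge0.
have G0 : 0 <= G by exact: Int_sqr_ge0.
have [F00|Fn0] := eqVneq F 0.
  rewrite F00 mul0r.
  have [->|Pn0] := eqVneq P 0; first by rewrite expr0n.
  have := q (- (G + 1) / (2 * P)); rewrite F00 mulr0 add0r.
  rewrite mulrAC mulrCA mulfV ?mulf_neq0 ?pnatr_eq0// mulr1 => ?.
  lra.
have {}F0 : 0 < F by rewrite lt_neqAle eq_sym Fn0.
have := mulr_ge0 (q (- P / F)) (ltW F0).
have -> : ((- P / F) ^+ 2 * F + 2 * (- P / F) * P + G) * F = F * G - P ^+ 2.
  by field; exact: lt0r_neq0.
by rewrite subr_ge0.
Qed.

Lemma Int_sqr_eq0 f : sqint f -> Int (fun x => f x ^+ 2) = 0 ->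
  {ae mu, forall x, a < x < b -> f x = 0}.
Proof.
move=> [mf hf] f0.
have h1 : (\int[mu]_(x in `]a, b[) `|(f x ^+ 2)%:E| = 0)%E.
  move: f0; rewrite /Rintegral => f0.
  transitivity ((\int[mu]_(x in `]a, b[) (f x ^+ 2)%:E)%E).
    by apply: eq_integral => x _ /=; rewrite ger0_norm ?sqr_ge0.
  by rewrite -[LHS]fineK ?f0//; exact: integrable_fin_num.
have mf2 : measurable_fun (`]a, b[ : set (measurableTypeR R)) (EFin \o (fun x => f x ^+ 2)).
  by apply/measurable_EFinP; exact: measurable_funX.
have := (ae_eq_integral_abs mu mI mf2).1 h1.
apply: filterS => x /= h2 xab.
have /h2 : `]a, b[%classic x by rewrite /= in_itv.
by move=> [] /eqP; rewrite sqrf_eq0 => /eqP.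
Qed.

Lemma ae_Int_eq f g : measurable_fun (`]a, b[ : set (measurableTypeR R)) f -> measurable_fun (`]a, b[ : set (measurableTypeR R)) g ->
  {ae mu, forall x, a < x < b -> f x = g x} -> Int f = Int g.
Proof.
move=> mf mg fg; rewrite /Rintegral; congr fine; apply: ae_eq_integral => //.
- exact/measurable_EFinP.
- exact/measurable_EFinP.
case: fg => N [mN N0 sub]; exists N; split => // x /= h; apply: sub => /= fgx.
by apply: h; rewrite in_itv/= => /fgx ->.
Qed.

End SquareIntegrable.

(** [L2] extends [f] by zero, which changes neither its measurability on the
    interval nor the integrability of its square. *)
Lemma L2P {R : realType} (a b : R) (f : R -> R) : L2 a b f <-> sqint a b f.
Proof.
rewrite /L2.
have mI : measurable (`]a, b[ : set (measurableTypeR R)) by exact: measurable_itv.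
set g := f \_ `]a, b[.
have gsq : (EFin \o (fun x => g x ^+ 2)) =
    (EFin \o (fun x => f x ^+ 2)) \_ `]a, b[.
  by apply/funext => x; rewrite /= /g !patchE; case: ifP => // _; rewrite expr0n.
have mg : measurable_fun setT g <-> measurable_fun (`]a, b[ : set (measurableTypeR R)) f.
  exact: iff_sym (measurable_restrictT f mI).
have ig : (@lebesgue_measure R).-integrable setT (EFin \o (fun x => g x ^+ 2)) <->
    rint a b (fun x => f x ^+ 2).
  by rewrite gsq /rint; split => /(integrable_mkcond _ mI).
split.
  move=> h; split; last by apply/ig; exact: Lfun2_integrable_sqr.
  by apply/mg; move: h; rewrite inE => /andP[]; rewrite inE.
move=> [/mg mf /ig hf]; rewrite inE; apply/andP; split; rewrite inE//=.
rewrite /finite_norm unlock /Lnorm.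
apply: poweR_lty.
have := integrable_lty measurableT hf.
apply: le_lt_trans; rewrite le_eqVlt; apply/orP; left; apply/eqP.
by apply: eq_integral => x _ /=; rewrite powR_mulrn// real_normK ?num_real.
Qed.

(** * Density of polynomials *)

Lemma compact_uniform_continuity {R : realType} (a b : R) (f : R -> R) (e : R) :
  continuous f -> 0 < e -> exists2 d : R, 0 < d &
  forall x, a <= x <= b -> forall y, `|x - y| < d -> `|f x - f y| < e.
Proof.
move=> cf e0.
have /compact_near_coveringP h := @segment_compact R a b.
pose P (d x : R) := forall y : R, `|x - y| < d -> `|f x - f y| < e.
have hP : forall x : R, `[a, b]%classic x ->
    \forall x' \near x & i \near (0 : R)^'+, P i x'.
  move=> x _.
  have e2 : 0 < e / 2 by exact: divr_gt0.
  have /cvgrPdist_lt/(_ _ e2)/nbhs_ballP[r /= r0 hr] := cf x.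
  exists (ball x (r / 2), [set d | d <= r / 2]) => /=.
    split; first by apply: nbhsx_ballx; exact: divr_gt0.
    by apply: nbhs_right_le; exact: divr_gt0.
  move=> [x' d] /= [x'x dr] y xy; rewrite /ball/= in x'x.
  have hx' : ball x r x' by rewrite /ball/=; apply: lt_trans x'x _; lra.
  have hy : ball x r y by rewrite /ball/=; have := ler_distD x' x y; lra.
  move: hy hx' => /hr hy /hr hx'; have := ler_distD (f x) (f x') (f y).
  rewrite (distrC (f x') (f x)); lra.
have hd : \forall d \near (0 : R)^'+, `[a, b] `<=` P d by exact: h.
near (0 : R)^'+ => d.
exists d; first by near: d; exact: nbhs_right_gt.
have hPd : `[a, b] `<=` P d by near: d.
by move=> x xab; apply: hPd; rewrite /= in_itv.
Unshelve. all: by end_near. Qed.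

(** The Bernstein polynomial of degree [n] with coefficients [phi 0 ... phi n],
    defined by de Casteljau's recursion: [bern n phi t] is the mean of [phi] at
    a binomial random variable with parameters [n] and [t]. *)
Fixpoint bern {R : realType} (n : nat) (phi : nat -> R) : {poly R} :=
  if n is n'.+1 then 'X * bern n' (phi \o succn) + (1 - 'X) * bern n' phi
  else (phi 0)%:P.

Lemma bernS {R : realType} n (phi : nat -> R) t : (bern n.+1 phi).[t] =
  t * (bern n (phi \o succn)).[t] + (1 - t) * (bern n phi).[t].
Proof. by rewrite /= hornerD !hornerM hornerD hornerN hornerX hornerC. Qed.

(** Monotonicity, linearity and exactness on constants express that [bern n phi t] is a
    mean; with the variance, they give Chebyshev's inequality. *)
Lemma le_bern {R : realType} n (phi psi : nat -> R) t : 0 <= t <= 1 ->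
  (forall k, (k <= n)%N -> phi k <= psi k) -> (bern n phi).[t] <= (bern n psi).[t].
Proof.
move=> /andP[t0 t1]; elim: n phi psi => [|n ih] phi psi h.
  by rewrite /= !hornerC; exact: h.
rewrite !bernS; apply: lerD.
  by apply: ler_wpM2l => //; apply: ih => k kn; exact: h.
by apply: ler_wpM2l; [lra|apply: ih => k kn; apply: h; exact: leqW].
Qed.

Lemma bernD {R : realType} n (phi psi : nat -> R) t :
  (bern n (fun k => phi k + psi k)).[t] = (bern n phi).[t] + (bern n psi).[t].
Proof.
elim: n phi psi => [|n ih] phi psi; first by rewrite /= !hornerC.
by rewrite !bernS ih (ih (phi \o succn) (psi \o succn)); ring.
Qed.

Lemma bernZ {R : realType} n c (phi : nat -> R) t :
  (bern n (fun k => c * phi k)).[t] = c * (bern n phi).[t].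
Proof.
elim: n phi => [|n ih] phi; first by rewrite /= !hornerC.
by rewrite !bernS ih (ih (phi \o succn)); ring.
Qed.

Lemma bern_cst {R : realType} n (c : R) t : (bern n (fun=> c)).[t] = c.
Proof.
elim: n => [|n ih]; first by rewrite /= hornerC.
by rewrite bernS (_ : (fun=> c) \o succn = (fun=> c))// ih; ring.
Qed.

(** The variance of the binomial distribution, plus the square of the distance
    from [c] to its mean. *)
Lemma bern_sqr {R : realType} n (c t : R) :
  (bern n (fun k => (k%:R - c) ^+ 2)).[t] = n%:R * t * (1 - t) + (n%:R * t - c) ^+ 2.
Proof.
elim: n c => [|n ih] c; first by rewrite /= hornerC; ring.
have -> : (bern n.+1 (fun k => (k%:R - c) ^+ 2)).[t] =
  t * (bern n (fun k => (k%:R - (c - 1)) ^+ 2)).[t]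
  + (1 - t) * (bern n (fun k => (k%:R - c) ^+ 2)).[t].
  rewrite bernS; congr (_ * (bern n _).[t] + _).
  by apply/funext => k /=; rewrite -natr1; ring.
by rewrite !ih -natr1; ring.
Qed.

Lemma continuous_itv_bounded {R : realType} (a b : R) (f : R -> R) : a <= b ->
  continuous f -> exists2 K : R, 0 <= K & forall x, a <= x <= b -> `|f x| <= K.
Proof.
move=> ab cf.
have cf' : {within `[a, b], continuous f} by exact: continuous_subspaceT.
have [c1 _ hc1] := EVT_max ab cf'.
have [c2 _ hc2] := EVT_min ab cf'.
exists (`|f c1| + `|f c2|) => [|x xab]; first by rewrite addr_ge0.
have {}xab : x \in `[a, b] by rewrite in_itv.
have := hc1 _ xab; have := hc2 _ xab.
by case: (ger0P (f x)); case: (ger0P (f c1)); case: (ger0P (f c2)); lra.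
Qed.

(** Weierstrass's theorem: at [t], the deviation of [g] from its Bernstein
    polynomial is controlled by the oscillation of [g] at scale [d] plus, by
    Chebyshev's inequality, the variance [t (1 - t) / n] over [d ^+ 2]. *)
Lemma weierstrass01 {R : realType} (g : R -> R) (e : R) : continuous g -> 0 < e ->
  exists p : {poly R}, forall t, 0 <= t <= 1 -> `|g t - p.[t]| <= e.
Proof.
move=> cg e0.
have e2 : 0 < e / 2 by exact: divr_gt0.
have [d d0 hd] := compact_uniform_continuity 0 1 cg e2.
have [K K0 hK] := continuous_itv_bounded (@ler01 R) cg.
set C := 2 * K / d ^+ 2.
have C0 : 0 <= C by rewrite /C divr_ge0 ?sqr_ge0// mulr_ge0.
have key s t : 0 <= t <= 1 -> 0 <= s <= 1 -> `|g t - g s| <= e / 2 + C * (s - t) ^+ 2.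
  move=> t01 s01; have [td|td] := ltP `|t - s| d.
    apply: le_trans (ltW (hd _ t01 _ td)) _.
    by rewrite lerDl mulr_ge0// sqr_ge0.
  have : 1 <= (s - t) ^+ 2 / d ^+ 2.
    rewrite ler_pdivlMr ?exprn_gt0// mul1r -(real_normK (num_real (s - t))).
    by rewrite distrC lerXn2r// ?nnegrE// ltW.
  have := hK _ t01; have := hK _ s01; have := ler_normB (g t) (g s).
  rewrite /C [_ / d ^+ 2 * _]mulrAC -mulrA.
  set q := _ / _ => *; nra.
(* As [t (1 - t) <= 1], the variance term is at most [C / n]. *)
pose n := (Num.truncn (C / (e / 2))).+1.
have n0 : (0 : R) < n%:R by rewrite ltr0n.
have nC : C / n%:R <= e / 2.
  rewrite ler_pdivrMr// mulrC -ler_pdivrMr//.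
  apply/ltW; exact: truncnS_gt.
exists (bern n (fun k => g (k%:R / n%:R))) => t t01.
have vark : (bern n (fun k => e / 2 + C * (n%:R^-1 ^+ 2 * (k%:R - n%:R * t) ^+ 2))).[t]
    <= e.
  rewrite bernD bern_cst !bernZ bern_sqr subrr expr0n/= addr0.
  have -> : C * (n%:R^-1 ^+ 2 * (n%:R * t * (1 - t))) = C / n%:R * (t * (1 - t)).
    by field; exact: lt0r_neq0.
  have : 0 <= C / n%:R by rewrite divr_ge0.
  move/andP: t01 => [? ?]; nra.
have gk k : (k <= n)%N -> `|g t - g (k%:R / n%:R)| <=
    e / 2 + C * (n%:R^-1 ^+ 2 * (k%:R - n%:R * t) ^+ 2).
  move=> kn; have -> : n%:R^-1 ^+ 2 * (k%:R - n%:R * t) ^+ 2 = (k%:R / n%:R - t) ^+ 2.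
    by field; exact: lt0r_neq0.
  apply: key => //; rewrite divr_ge0//= ler_pdivrMr// mul1r ler_nat//.
have up : (bern n (fun k => g (k%:R / n%:R))).[t] <= g t + e.
  apply: (@le_trans _ _ (g t + (bern n (fun k =>
      e / 2 + C * (n%:R^-1 ^+ 2 * (k%:R - n%:R * t) ^+ 2))).[t])); last by rewrite lerD2l.
  rewrite -[X in _ <= X + _](bern_cst n (g t) t) -bernD.
  by apply: le_bern => // k /gk; rewrite ler_norml; lra.
have lo : g t <= (bern n (fun k => g (k%:R / n%:R))).[t] + e.
  apply: (@le_trans _ _ ((bern n (fun k => g (k%:R / n%:R))).[t] + (bern n (fun k =>
      e / 2 + C * (n%:R^-1 ^+ 2 * (k%:R - n%:R * t) ^+ 2))).[t])); last by rewrite lerD2l.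
  rewrite -[X in X <= _](bern_cst n (g t) t) -bernD.
  by apply: le_bern => // k /gk; rewrite ler_norml; lra.
by rewrite ler_norml; lra.
Qed.

Lemma weierstrass {R : realType} (a b : R) (f : R -> R) (e : R) : a < b ->
  continuous f -> 0 < e ->
  exists p : {poly R}, forall x, a <= x <= b -> `|f x - p.[x]| <= e.
Proof.
move=> ab cf e0.
have ba0 : 0 < b - a by rewrite subr_gt0.
have cg : continuous (fun t => f (a + (b - a) * t)).
  move=> t; apply: continuous_comp; last exact: cf.
  by apply: cvgD; [exact: cvg_cst|apply: cvgMr; exact: cvg_id].
have [p hp] := weierstrass01 cg e0.
exists (p \Po ((b - a)^-1 *: ('X - a%:P))) => x /andP[ax xb].
have := hp ((b - a)^-1 * (x - a)).
rewrite horner_comp hornerZ hornerXsubC mulVKf ?gt_eqF// (addrC a) subrK; apply.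
by rewrite mulrC ler_pdivrMr// mul1r lerD2r xb divr_ge0 ?subr_ge0// ltW.
Qed.

Section Clip.
Context {R : realType}.

Definition clip (K x : R) : R := Num.min K (Num.max (- K) x).

Lemma clip_le K x : 0 <= K -> `|clip K x| <= K.
Proof.
move=> K0; rewrite /clip ler_norml.
by case: (leP (- K) x) => ?; [case: (leP K x)|case: (leP K (- K))]; lra.
Qed.

Lemma clip_id K x : `|x| <= K -> clip K x = x.
Proof.
rewrite ler_norml /clip => /andP[? ?].
by case: (leP (- K) x) => ?; [case: (leP K x)|case: (leP K (- K))]; lra.
Qed.

Lemma norm_clip K x : 0 <= K -> `|x - clip K x| <= `|x|.
Proof.
move=> K0; rewrite /clip.
case: (leP (- K) x) => ?; [case: (leP K x) => ?|case: (leP K (- K)) => ?];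
  rewrite ?subrr ?normr0//; rewrite ler_norml; case: (ger0P x); lra.
Qed.

Lemma clip_dist K x y : `|x| <= K -> `|x - clip K y| <= `|x - y|.
Proof.
rewrite ler_norml /clip => /andP[? ?].
case: (leP (- K) y) => ?; [case: (leP K y) => ?|case: (leP K (- K)) => ?];
  rewrite ?subrr ?normr0//; rewrite ler_norml; case: (ger0P (x - y)); lra.
Qed.

Lemma continuous_clip K (f : R -> R) : continuous f ->
  continuous (fun x => clip K (f x)).
Proof.
move=> cf x; apply: (@continuous_min R R (cst K) (cst (- K) \max f) x).
  exact: cst_continuous.
by apply: continuous_max; [exact: cst_continuous|exact: cf].
Qed.

End Clip.

Section Density.
Context {R : realType} (a b : R) (ab : a < b).
Notation mu := (@lebesgue_measure R).
Notation Int f := (\int[mu]_(x in `]a, b[) f x).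
Let mI : measurable (`]a, b[ : set (measurableTypeR R)).
Proof. exact: measurable_itv. Qed.

Lemma Int_dominated (F : nat -> R -> R) (f g : R -> R) :
  (forall n, measurable_fun (`]a, b[ : set (measurableTypeR R)) (F n)) ->
  measurable_fun (`]a, b[ : set (measurableTypeR R)) f -> rint a b g ->
  (forall n x, a < x < b -> `|F n x| <= g x) ->
  (forall x, a < x < b -> F n x @[n --> \oo] --> f x) ->
  Int (F n) @[n --> \oo] --> Int f.
Proof.
move=> mF mf hg Fg Ff.
have [|||||i0 i1 i2] := @dominated_convergence _ _ _ mu _ mI (fun n => EFin \o F n) (EFin \o f) (EFin \o g).
- by move=> n; exact/measurable_EFinP.
- exact/measurable_EFinP.
- apply: aeW => x /=; rewrite in_itv/= => /Ff h.
  by apply/cvg_EFin => //; exact: nearW.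
- exact: hg.
- by apply: aeW => x n /=; rewrite in_itv/= => xab; rewrite lee_fin; exact: Fg.
- apply: fine_cvg; rewrite /Rintegral fineK; last exact: integrable_fin_num.
  exact: i2.
Qed.

Lemma sqint_continuous (f : R -> R) : continuous f -> sqint a b f.
Proof.
move=> cf.
have [K K0 hK] := continuous_itv_bounded (ltW ab) cf.
apply: (@sqint_bounded _ _ _ ab _ K).
  by apply: measurable_funTS; exact: continuous_measurable_fun.
by move=> x /andP[ax xb]; apply: hK; rewrite !ltW.
Qed.

Lemma sqint_poly (p : {poly R}) : sqint a b (horner p).
Proof. by apply: sqint_continuous; exact: continuous_horner. Qed.

(** Continuous functions are dense in [L^1], and for functions bounded by [K] the
    [L^2] distance is controlled by the [L^1] distance. Clipping the continuous
    approximation at [K] makes it bounded as well, without moving it away from [f]. *)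
Lemma bounded_poly_approx (f : R -> R) (K e : R) :
  measurable_fun (`]a, b[ : set (measurableTypeR R)) f -> 0 <= K ->
  (forall x, a < x < b -> `|f x| <= K) -> 0 < e ->
  exists p : {poly R}, Int (fun x => (f x - p.[x]) ^+ 2) < e.
Proof.
move=> mf K0 fK e0.
have sf : sqint a b f by exact: (sqint_bounded ab mf fK).
have muI : (mu `]a, b[ < +oo)%E.
  by rewrite [X in (X < _)%E]lebesgue_measure_itv/= lte_fin ab -EFinD ltry.
have [g_ [cg_ ig_ g_f]] := approximation_continuous_integrable mI muI (rint_sqint ab sf).
pose h := e / (8 * K + 8).
have h0 : 0 < h by rewrite /h divr_gt0//; lra.
have [n hn] : exists n, Int (fun x => `|f x - g_ n x|) < h.
  move/fine_cvg/cvgrPdist_lt/(_ _ h0) : g_f => [n _ hn].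
  exists n; have := hn n (leqnn n); rewrite /= sub0r normrN.
  by apply: le_lt_trans; exact: ler_norm.
pose g x := clip K (g_ n x).
have cg : continuous g by exact: continuous_clip.
have sg := sqint_continuous cg.
pose d := Num.min 1 (e / (8 * (b - a))).
have ba0 : 0 < b - a by rewrite subr_gt0.
have d0 : 0 < d by rewrite lt_min ltr01 divr_gt0// mulr_gt0.
have [p hp] := weierstrass ab cg d0.
exists p.
have r1 : rint a b (fun x => `|f x - g_ n x|).
  by apply: rint_norm; apply: rintB; [exact: (rint_sqint ab)|exact: ig_].
have sfp := sqintB sf (sqint_poly p).
apply: (@le_lt_trans _ _ (Int (fun x => 4 * K * `|f x - g_ n x| + 2 * d ^+ 2))).
  apply: le_Int; first by case: sfp.
    by apply: rintD => //; [exact: rintZ|exact: rint_cst].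
  move=> x xab.
  have : `|g x - p.[x]| <= d by apply: hp; case/andP: xab => *; rewrite !ltW.
  have := fK _ xab => fKx; have := clip_dist (g_ n x) fKx.
  have := clip_le (g_ n x) K0; rewrite -/(g x) => gK fg gp.
  have : (f x - p.[x]) ^+ 2 <= 2 * (f x - g x) ^+ 2 + 2 * (g x - p.[x]) ^+ 2.
    by have := sqr_ge0 (f x - g x - (g x - p.[x])); nra.
  have : (g x - p.[x]) ^+ 2 <= d ^+ 2.
    rewrite -(real_normK (num_real (g x - _))) lerXn2r// nnegrE; lra.
  have : (f x - g x) ^+ 2 <= 2 * K * `|f x - g_ n x|.
    rewrite -(real_normK (num_real (f x - g x))) expr2; apply: ler_pM => //.
    have := ler_normB (f x) (g x); lra.
  lra.
rewrite IntD//; [|exact: rintZ|exact: rint_cst].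
rewrite IntZ// [X in _ + X < _](Int_cst ab (2 * d ^+ 2)).
have : 4 * K * Int (fun x => `|f x - g_ n x|) <= 4 * K * h.
  by rewrite ler_wpM2l ?mulr_ge0// ltW.
have : 4 * K * h <= e / 2.
  have -> : 4 * K * h = (e / 2) * (8 * K / (8 * K + 8)) by rewrite /h; field; lra.
  have : 8 * K / (8 * K + 8) <= 1 by rewrite ler_pdivrMr; lra.
  nra.
have : 2 * d ^+ 2 * (b - a) <= e / 4.
  have : d ^+ 2 <= d by rewrite expr2 ger_pMr// ge_min lexx.
  have : d <= e / (8 * (b - a)) by rewrite ge_min lexx orbT.
  rewrite ler_pdivlMr ?mulr_gt0//; nra.
have aux (A B C : R) : C <= e / 4 -> B <= e / 2 -> A <= B -> A + C < e by lra.
exact: aux.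
Qed.

(** Dominated convergence reduces to the truncations of [f]. *)
Lemma poly_dense (f : R -> R) (e : R) : sqint a b f -> 0 < e ->
  exists p : {poly R}, Int (fun x => (f x - p.[x]) ^+ 2) < e.
Proof.
move=> sf e0; have [mf f2] := sf.
pose F n x := (f x - clip n%:R (f x)) ^+ 2.
have mc n : measurable_fun (`]a, b[ : set (measurableTypeR R)) (fun x => clip n%:R (f x)).
  apply: (measurableT_comp _ mf); apply: continuous_measurable_fun.
  by apply: (@continuous_clip _ _ id) => x; exact: cvg_id.
have cF : Int (F n) @[n --> \oo] --> Int (fun=> 0).
  apply: (Int_dominated _ _ f2) => //.
  - by move=> n; apply: measurable_funX; exact: measurable_funB.
  - move=> n x _; rewrite ger0_norm ?sqr_ge0// /F.
    rewrite -(real_normK (num_real (f x - _))) -(real_normK (num_real (f x))).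
    by rewrite lerXn2r ?nnegrE// norm_clip.
  - move=> x xab; apply/cvgrPdist_lt => d d0.
    exists (Num.truncn `|f x|).+1 => // n /= hn.
    rewrite /F clip_id; first by rewrite subrr expr0n/= subrr normr0.
    by apply: ltW; apply: lt_le_trans (truncnS_gt _) _; rewrite ler_nat.
rewrite (Int_cst ab 0) mul0r in cF.
have e4 : 0 < e / 4 by exact: divr_gt0.
have [n] : exists n, Int (F n) < e / 4.
  move/cvgrPdist_lt/(_ _ e4) : cF => [n _ hn].
  exists n; have := hn n (leqnn n); rewrite /= sub0r normrN.
  by apply: le_lt_trans; exact: ler_norm.
have sc : sqint a b (fun x => clip n%:R (f x)).
  by apply: (sqint_bounded ab (mc n)) => x _; exact: clip_le.
have [] := @bounded_poly_approx (fun x => clip n%:R (f x)) n%:R (e / 4) (mc n) => //.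
  by move=> x _; exact: clip_le.
move=> p hp hF; exists p.
have [_ s1] := sqintB sf sc; have [_ s2] := sqintB sc (sqint_poly p).
have [_ s3] := sqintB sf (sqint_poly p).
apply: (@le_lt_trans _ _ (Int (fun x => 2 * (f x - clip n%:R (f x)) ^+ 2
   + 2 * (clip n%:R (f x) - p.[x]) ^+ 2))).
  apply: le_Int => //; first by apply: rintD; exact: rintZ.
  move=> x _; have := sqr_ge0 (f x - clip n%:R (f x) - (clip n%:R (f x) - p.[x])); nra.
rewrite IntD ?IntZ//; try exact: rintZ.
rewrite /F in hF.
have aux (A B : R) : A < e / 4 -> B < e / 4 -> 2 * A + 2 * B < e by lra.
exact: aux.
Qed.

End Density.

(** * Cutoff functions and weak derivatives *)

Section Derivatives.
Context {R : realType}.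

Lemma is_derive_continuous (F F' : R -> R) :
  (forall x, is_derive x (1 : R) F (F' x)) -> continuous F.
Proof.
move=> dF x; apply: differentiable_continuous; apply/derivable1_diffP.
by have [] := dF x.
Qed.

Lemma Int_FTC (a b : R) (F F' : R -> R) : a < b ->
  (forall x, is_derive x (1 : R) F (F' x)) -> continuous F' ->
  \int[@lebesgue_measure R]_(x in `]a, b[) F' x = F b - F a.
Proof.
move=> ab dF cF'; have cF := is_derive_continuous dF.
have sF' := rint_sqint ab (sqint_continuous ab cF').
rewrite Rintegral_itv_bndo_bndc//.
have sF2 : (@lebesgue_measure R).-integrable `]a, b] (EFin \o F').
  have hcc : (@lebesgue_measure R).-integrable `[a, b] (EFin \o F').
    apply: continuous_compact_integrable; first exact: segment_compact.
    exact: continuous_subspaceT.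
  apply: (integrableS _ _ _ hcc) => //.
  by apply: subset_itvr; rewrite bnd_simp.
rewrite Rintegral_itv_obnd_cbnd// /Rintegral (@continuous_FTC2 _ _ F)//.
- exact: continuous_subspaceT.
- split => [x _||]; first by have [] := dF x.
  + by apply: cvg_at_right_filter; exact: cF.
  + by apply: cvg_at_left_filter; exact: cF.
- by move=> x _; rewrite derive1E; have [_ ->] := dF x.
Qed.

(** The criterion for the derivative of a spline, whose formula changes at the knots. *)
Lemma is_derive_quadratic (f : R -> R) (x d C : R) :
  (forall h, `|f (x + h) - f x - h * d| <= C * h ^+ 2) -> is_derive x (1 : R) f d.
Proof.
move=> hf.
have C0 : 0 <= C by have := hf 1; have := normr_ge0 (f (x + 1) - f x - 1 * d); lra.
have h : h^-1 *: ((f \o shift x) (h *: (1 : R)) - f x) @[h --> (0 : R)^'] --> d.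
  apply/cvgrPdist_le => e e0.
  have eC : 0 < e / (C + 1) by rewrite divr_gt0//; lra.
  near=> h.
  have h0 : h != 0 by near: h; exact: nbhs_dnbhs_neq.
  have he : `|h| < e / (C + 1).
    near: h; apply: dnbhs0_lt; exact: eC.
  have hn : 0 < `|h| by rewrite normr_gt0.
  rewrite /= /shift/= scaler1 -(ler_pM2l hn) -normrM.
  have -> : h * (d - h^-1 *: (f (h + x) - f x)) = - (f (x + h) - f x - h * d).
    by rewrite addrC [X in _ *: (f X - _)]addrC /GRing.scale/=; field.
  rewrite normrN; apply: le_trans (hf h) _.
  rewrite -(real_normK (num_real h)) expr2 mulrCA ler_wpM2l//.
  move: he; rewrite ltr_pdivlMr; last lra.
  lra.
split; first by apply/cvg_ex; exists d.
exact: cvg_lim.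
Unshelve. all: by end_near. Qed.

Lemma poly_primitive (p : {poly R}) (c : R) :
  exists P : {poly R}, P^`() = p /\ P.[c] = 0.
Proof.
pose P := \poly_(i < (size p).+1) (if i is j.+1 then p`_j / j.+1%:R else 0).
exists (P - P.[c]%:P); split; last by rewrite hornerD hornerN hornerC subrr.
rewrite derivB derivC subr0; apply/polyP => i.
rewrite coef_deriv coef_poly ltnS; case: ltnP => ip; last by rewrite mul0rn nth_default.
by rewrite -[LHS]mulr_natr divfK// pnatr_eq0.
Qed.

Definition ramp (x : R) := Num.max x 0.

Lemma continuous_ramp : continuous ramp.
Proof.
move=> x; apply: (@continuous_max R R id (cst 0) x); first exact: cvg_id.
exact: cst_continuous.
Qed.

Lemma is_derive_ramp2 x : is_derive x (1 : R) (fun y => ramp y ^+ 2) (2 * ramp x).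
Proof.
apply: (@is_derive_quadratic _ _ _ 1) => h; rewrite /ramp.
by case: (leP (x + h) 0); case: (leP x 0) => *; rewrite ler_norml; nra.
Qed.

(** A [C^1] transition from [0] on the negative half-line to [1] beyond [1]: a
    quadratic spline. *)
Definition step (y : R) :=
  2 * ramp y ^+ 2 - 4 * ramp (y - 2^-1) ^+ 2 + 2 * ramp (y - 1) ^+ 2.
Definition dstep (y : R) :=
  4 * ramp y - 8 * ramp (y - 2^-1) + 4 * ramp (y - 1).

Lemma step_le0 y : y <= 0 -> step y = 0 /\ dstep y = 0.
Proof.
move=> y0; by rewrite /step /dstep /ramp !max_r//; try lra; rewrite expr0n/=; split; lra.
Qed.

Lemma step_ge1 y : 1 <= y -> step y = 1 /\ dstep y = 0.
Proof. by move=> y0; rewrite /step /dstep /ramp !max_l; try lra; split; field. Qed.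

Lemma step_bound y : `|step y| <= 1 /\ `|dstep y| <= 2.
Proof.
have [y0|y0] := leP y 0.
  by have [-> ->] := step_le0 y0; rewrite !normr0; split; lra.
have [y1|y1] := leP 1 y.
  by have [-> ->] := step_ge1 y1; rewrite normr1 normr0; split; lra.
rewrite /step /dstep /ramp (max_l (ltW y0)) (@max_r _ _ (y - 1)); last lra.
case: (leP (y - 2^-1) 0) => ?; rewrite !ler_norml; split; nra.
Qed.

(** [dstep (y - 1)] is zero unless [1 <= y <= 2]. With [y = n (x - a)] this is the
    estimate, uniform in [n], of [x - a] times the derivative of a cutoff at
    distance [1 / n] from [a]. *)
Lemma dstep_bound y : 0 <= y -> y * `|dstep (y - 1)| <= 4.
Proof.
move=> y0; have [y2|y2] := leP 2 y.
  have [|_ ->] := @step_ge1 (y - 1); first lra.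
  by rewrite normr0 mulr0; lra.
have [_] := step_bound (y - 1); have := normr_ge0 (dstep (y - 1)); nra.
Qed.

Lemma is_derive_affine c d x : is_derive x (1 : R) (fun y => c * y + d) c.
Proof. by apply: is_derive_eq; rewrite /GRing.scale/=; ring. Qed.

Lemma is_derive_step c d x :
  is_derive x (1 : R) (fun y => step (c * y + d)) (c * dstep (c * x + d)).
Proof.
have h e : is_derive x (1 : R) (fun y => ramp (c * y + d - e) ^+ 2)
   (2 * ramp (c * x + d - e) * c).
  have := @is_derive1_comp R (fun y => ramp y ^+ 2) (fun y => c * y + (d - e)) x
    _ _ (is_derive_ramp2 _) (is_derive_affine c (d - e) x).
  by rewrite (_ : _ \o _ = (fun y => ramp (c * y + d - e) ^+ 2)) ?addrA//;
    apply/funext => y /=; rewrite addrA.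
have := h 0; rewrite subr0 (_ : (fun y => _) = (fun y => ramp (c * y + d) ^+ 2)); last first.
  by apply/funext => y; rewrite subr0.
move=> h0; have h1 := h 2^-1; have h2 := h 1.
rewrite /step /dstep; apply: is_derive_eq; rewrite /GRing.scale/=; ring.
Qed.

Lemma continuous_dstep : continuous dstep.
Proof.
have h (e : R) : continuous (fun y : R => ramp (y - e)).
  move=> y; apply: (@continuous_comp _ _ _ (fun y : R => y - e) ramp);
    last exact: continuous_ramp.
  by apply: cvgB; [exact: cvg_id|exact: cvg_cst].
have h0 : continuous (fun y => ramp y) by exact: continuous_ramp.
move=> y; apply: cvgD; first apply: cvgB.
- by apply: cvgMr; exact: h0.
- by apply: cvgMr; exact: h.
- by apply: cvgMr; exact: h.
Qed.

End Derivatives.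

Section WeakDerivative.
Context {R : realType} (a b : R) (ab : a < b).
Notation mu := (@lebesgue_measure R).
Notation Int f := (\int[mu]_(x in `]a, b[) f x).

Lemma test_functionP (phi : R -> R) : test_function a b phi ->
  [/\ forall x, is_derive x (1 : R) phi (derive1 phi x),
      continuous phi, continuous (derive1 phi), phi a = 0 & phi b = 0].
Proof.
move=> [dphi cphi _ sphi].
have d x : is_derive x (1 : R) phi (derive1 phi x).
  by rewrite derive1E; apply: DeriveDef.
have out x : ~ (`]a, b[%classic x) -> phi x = 0.
  move=> nx; apply: contrapT => px; apply: nx; apply: sphi.
  by apply: subset_closure; exact/eqP.
split => //; first exact: is_derive_continuous d.
  by apply: out; rewrite /= in_itv/= ltxx.
by apply: out; rewrite /= in_itv/= ltxx andbF.
Qed.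

Lemma test_function_intro (phi dphi : R -> R) (c d : R) : a < c -> d < b ->
  (forall x, is_derive x (1 : R) phi (dphi x)) -> continuous dphi ->
  (forall x, phi x != 0 -> c <= x <= d) ->
  test_function a b phi /\ derive1 phi = dphi.
Proof.
move=> ac db dp cd supp.
have e : derive1 phi = dphi.
  by apply/funext => x; rewrite derive1E; have [_ ->] := dp x.
have clo : closure [set x | phi x != 0] `<=` `[c, d].
  rewrite ((closure_id `[c, d]%classic).1 _); last exact: itv_closed.
  by apply: closureS => x /= /supp; rewrite in_itv.
split => //; split.
- by move=> x; have [] := dp x.
- by rewrite e.
- by apply: (subclosed_compact _ (@segment_compact R c d) clo); exact: closed_closure.
- apply: subset_trans clo _ => x /=; rewrite !in_itv/= => /andP[cx xd].
  by rewrite (lt_le_trans ac cx) (le_lt_trans xd db).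
Qed.

Lemma test_functionM (phi alpha dalpha : R -> R) : test_function a b phi ->
  (forall x, is_derive x (1 : R) alpha (dalpha x)) -> continuous dalpha ->
  test_function a b (fun x => alpha x * phi x) /\
  derive1 (fun x => alpha x * phi x) = (fun x => dalpha x * phi x + alpha x * derive1 phi x).
Proof.
move=> tphi da ca; have [dphi cphi cdphi _ _] := test_functionP tphi.
have calpha := is_derive_continuous da.
have d x : is_derive x (1 : R) (fun x => alpha x * phi x)
    (dalpha x * phi x + alpha x * derive1 phi x).
  have := da x; have := dphi x => h1 h2.
  by apply: is_derive_eq; rewrite /GRing.scale/=; ring.
have e : derive1 (fun x => alpha x * phi x) =
    (fun x => dalpha x * phi x + alpha x * derive1 phi x).
  by apply/funext => x; rewrite derive1E; have [_ ->] := d x.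
split; last exact: e.
have [_ _ cK sub] := tphi.
have clo : closure [set x | alpha x * phi x != 0] `<=` closure [set x | phi x != 0].
  by apply: closureS => x /=; rewrite mulf_eq0 negb_or => /andP[].
split.
- by move=> x; have [] := d x.
- rewrite e => x; apply: cvgD; apply: cvgM; [exact: ca|exact: cphi|exact: calpha|exact: cdphi].
- by apply: subclosed_compact cK clo; exact: closed_closure.
- exact: subset_trans clo sub.
Qed.

(** [cutoff n] vanishes at distance less than [1 / n] from [a] and [b], and equals
    [1] at distance more than [2 / n]. *)
Definition cutoff (n : R) (x : R) : R :=
  step (n * x + (- n * a - 1)) * step (- n * x + (n * b - 1)).
Definition dcutoff (n : R) (x : R) : R :=
  n * dstep (n * x + (- n * a - 1)) * step (- n * x + (n * b - 1))
  - n * step (n * x + (- n * a - 1)) * dstep (- n * x + (n * b - 1)).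

Lemma is_derive_cutoff n x : is_derive x (1 : R) (cutoff n) (dcutoff n x).
Proof.
rewrite /cutoff /dcutoff.
have := is_derive_step n (- n * a - 1) x => h1.
have := is_derive_step (- n) (n * b - 1) x => h2.
by apply: is_derive_eq; rewrite /GRing.scale/=; ring.
Qed.

Lemma continuous_dcutoff n : continuous (dcutoff n).
Proof.
have ca (c d : R) : continuous (fun y : R => c * y + d).
  by apply: (is_derive_continuous (fun x => is_derive_affine c d x)).
have c1 (c d : R) : continuous (fun y : R => step (c * y + d)).
  exact: (is_derive_continuous (fun x => is_derive_step c d x)).
have c2 (c d : R) : continuous (fun y : R => dstep (c * y + d)).
  move=> y; apply: (@continuous_comp _ _ _ (fun y : R => c * y + d) dstep).
    exact: ca.
  exact: continuous_dstep.
move=> x; apply: cvgB; apply: cvgM.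
- by apply: cvgMr; exact: c2.
- exact: c1.
- by apply: cvgMr; exact: c1.
- exact: c2.
Qed.

Lemma cutoff_neq0 n x : 0 < n -> cutoff n x != 0 -> a + n^-1 <= x <= b - n^-1.
Proof.
move=> n0; rewrite /cutoff mulf_eq0 negb_or => /andP[h1 h2].
have nV : n * n^-1 = 1 by rewrite mulfV// gt_eqF.
apply/andP; split.
- rewrite leNgt; apply/negP => h; move/negP: h1; apply; apply/eqP.
  by apply: (step_le0 _).1; nra.
- rewrite leNgt; apply/negP => h; move/negP: h2; apply; apply/eqP.
  by apply: (step_le0 _).1; nra.
Qed.

Lemma cutoff_bound n x : `|cutoff n x| <= 1.
Proof.
rewrite /cutoff normrM.
have [h1 _] := step_bound (n * x + (- n * a - 1)).
have [h2 _] := step_bound (- n * x + (n * b - 1)).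
by rewrite -[leRHS]mulr1; apply: ler_pM.
Qed.

Lemma dcutoff_bound n x : 0 < n -> a < x < b ->
  `|(x - a) * (b - x) * dcutoff n x| <= 8 * (b - a).
Proof.
move=> n0 /andP[ax xb].
set u := n * (x - a); set v := n * (b - x).
have -> : (x - a) * (b - x) * dcutoff n x =
   (b - x) * (u * dstep (u - 1)) * step (v - 1)
    - (x - a) * (v * dstep (v - 1)) * step (u - 1).
  rewrite /dcutoff /u /v.
  have -> : n * x + (- n * a - 1) = n * (x - a) - 1 by ring.
  have -> : - n * x + (n * b - 1) = n * (b - x) - 1 by ring.
  by ring.
have u0 : 0 <= u by rewrite mulr_ge0 ?subr_ge0 // ltW.
have v0 : 0 <= v by rewrite mulr_ge0 ?subr_ge0 // ltW.
have key c y z : 0 <= c <= b - a -> 0 <= y ->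
    `|c * (y * dstep (y - 1)) * step z| <= 4 * (b - a).
  move=> /andP[c0 c1] y0; rewrite !normrM (ger0_norm c0) (ger0_norm y0).
  have [sz _] := step_bound z; have dy := dstep_bound y0.
  have h : c * (y * `|dstep (y - 1)|) <= (b - a) * 4.
    by apply: ler_pM => //; rewrite mulr_ge0.
  have h0 : 0 <= c * (y * `|dstep (y - 1)|) by rewrite !mulr_ge0.
  have := normr_ge0 (step z); nra.
apply: le_trans (ler_normB _ _) _.
have -> : 8 * (b - a) = 4 * (b - a) + 4 * (b - a) by ring.
by apply: lerD; apply: key => //; lra.
Qed.

Lemma cutoff_eventually x : a < x < b ->
  \forall n \near \oo, cutoff n%:R x = 1 /\ dcutoff n%:R x = 0.
Proof.
move=> /andP[ax xb].
have [xa0 bx0] : 0 < x - a /\ 0 < b - x by split; lra.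
pose N := (Num.truncn (2 / (x - a)) + Num.truncn (2 / (b - x))).+2.
exists N => // n /= Nn.
have hN : N%:R <= n%:R :> R by rewrite ler_nat.
have h1 : 2 / (x - a) < n%:R.
  apply: lt_le_trans (truncnS_gt _) _; rewrite ler_nat.
  by apply: leq_trans Nn; rewrite /N !ltnS leqW// leq_addr.
have h2 : 2 / (b - x) < n%:R.
  apply: lt_le_trans (truncnS_gt _) _; rewrite ler_nat.
  by apply: leq_trans Nn; rewrite /N !ltnS leqW// leq_addl.
rewrite ltr_pdivrMr// in h1; rewrite ltr_pdivrMr// in h2.
have [|s1 d1] := @step_ge1 R (n%:R * x + (- n%:R * a - 1)); first nra.
have [|s2 d2] := @step_ge1 R (- n%:R * x + (n%:R * b - 1)); first nra.
by rewrite /cutoff /dcutoff s1 s2 d1 d2; split; ring.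
Qed.

(** The test functions can be taken polynomial, with zeros at [a] and [b]: a
    zero of order one suffices to absorb the derivative, of size [n] at distance
    [1 / n] of the end points, of the cutoff function. *)
Lemma weak_derivative_poly (f g : R -> R) (q : {poly R}) :
  sqint a b f -> sqint a b g -> weak_derivative a b f g ->
  let P := ('X - a%:P) * (b%:P - 'X) * q in
  Int (fun x => f x * P^`().[x]) = - Int (fun x => g x * P.[x]).
Proof.
move=> sf sg w P.
have PE x : P.[x] = (x - a) * (b - x) * q.[x].
  by rewrite /P !hornerM hornerXsubC hornerD hornerN hornerX hornerC.
have [K1 K10 hK1] := continuous_itv_bounded (ltW ab) (@continuous_horner R P^`()).
have [K2 K20 hK2] := continuous_itv_bounded (ltW ab) (@continuous_horner R P).
have [Q Q0 hQ] := continuous_itv_bounded (ltW ab) (@continuous_horner R q).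
have mp (p : {poly R}) : measurable_fun (`]a, b[ : set (measurableTypeR R)) (horner p).
  by apply: measurable_funTS; apply: continuous_measurable_fun; exact: continuous_horner.
have [mf _] := sf; have [mg _] := sg.
have mc n : measurable_fun (`]a, b[ : set (measurableTypeR R)) (cutoff n).
  apply: measurable_funTS; apply: continuous_measurable_fun.
  exact: (is_derive_continuous (fun x => is_derive_cutoff n x)).
have mdc n : measurable_fun (`]a, b[ : set (measurableTypeR R)) (dcutoff n).
  by apply: measurable_funTS; apply: continuous_measurable_fun; exact: continuous_dcutoff.
pose phi n x := cutoff n%:R x * P.[x].
pose dphi n x := dcutoff n%:R x * P.[x] + cutoff n%:R x * P^`().[x].
have test n : (0 < n)%N -> test_function a b (phi n) /\ derive1 (phi n) = dphi n.
  move=> n0; have n0' : (0 : R) < n%:R by rewrite ltr0n.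
  apply: (@test_function_intro _ _ (a + n%:R^-1) (b - n%:R^-1)).
  - by rewrite ltrDl invr_gt0.
  - by rewrite gtrBl invr_gt0.
  - move=> x; have h1 := is_derive_cutoff n%:R x; have h2 := is_derive_poly P x.
    by apply: is_derive_eq; rewrite /dphi /GRing.scale/=; ring.
  - move=> x; apply: cvgD; apply: cvgM.
    + exact: continuous_dcutoff.
    + exact: continuous_horner.
    + exact: (is_derive_continuous (fun x => is_derive_cutoff n%:R x)).
    + exact: continuous_horner.
  - by move=> x; rewrite mulf_eq0 negb_or => /andP[/cutoff_neq0 + _]; apply.
have c1 : Int (fun x => f x * dphi n.+1 x) @[n --> \oo] --> Int (fun x => f x * P^`().[x]).
  apply: (@Int_dominated _ _ _ (fun n x => f x * dphi n.+1 x) _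
    (fun x => (8 * (b - a) * Q + K1) * `|f x|)).
  - move=> n; apply: measurable_funM => //; apply: measurable_funD;
      exact: measurable_funM.
  - exact: measurable_funM.
  - by apply: rintZ; apply: rint_norm; exact: rint_sqint.
  - move=> n x xab; rewrite normrM mulrC ler_wpM2r//.
    have xab' : a <= x <= b by case/andP: xab => *; rewrite !ltW.
    apply: le_trans (ler_normD _ _) _; apply: lerD; last first.
      rewrite normrM -[leRHS]mul1r; apply: ler_pM => //; first exact: cutoff_bound.
      exact: hK1.
    rewrite PE mulrA [dcutoff _ _ * _]mulrC normrM; apply: ler_pM => //.
      by apply: dcutoff_bound; rewrite ?ltr0n.
    exact: hQ.
  - move=> x /cutoff_eventually[N _ hN].
    apply: cvg_near_cst; exists N => // n /= Nn.
    have /hN[h1 h2] : (N <= n.+1)%N by exact: leqW.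
    by rewrite /dphi h1 h2 mul0r add0r mul1r.
have c2 : Int (fun x => g x * phi n.+1 x) @[n --> \oo] --> Int (fun x => g x * P.[x]).
  apply: (@Int_dominated _ _ _ (fun n x => g x * phi n.+1 x) _ (fun x => K2 * `|g x|)).
  - by move=> n; apply: measurable_funM => //; exact: measurable_funM.
  - exact: measurable_funM.
  - by apply: rintZ; apply: rint_norm; exact: rint_sqint.
  - move=> n x xab; rewrite normrM mulrC ler_wpM2r//.
    have xab' : a <= x <= b by case/andP: xab => *; rewrite !ltW.
    rewrite normrM -[leRHS]mul1r; apply: ler_pM => //; first exact: cutoff_bound.
    exact: hK2.
  - move=> x /cutoff_eventually[N _ hN].
    apply: cvg_near_cst; exists N => // n /= Nn.
    have /hN[h1 h2] : (N <= n.+1)%N by exact: leqW.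
    by rewrite /phi h1 mul1r.
have e n : Int (fun x => f x * dphi n.+1 x) = - Int (fun x => g x * phi n.+1 x).
  by have [t d] := test n.+1 isT; rewrite -(w _ t) d.
rewrite (funext e) in c1; exact: (cvg_unique (@norm_hausdorff _ _) c1 (cvgN c2)).
Qed.

End WeakDerivative.

(** * Calculus in H^1 and the Poincare inequality *)

Section WeakCalculus.
Context {R : realType} (a b : R) (ab : a < b).
Notation mu := (@lebesgue_measure R).
Notation Int f := (\int[mu]_(x in `]a, b[) f x).

Lemma continuous_bounded_fun (f : R -> R) : continuous f ->
  measurable_fun (`]a, b[ : set (measurableTypeR R)) f /\
  exists2 K : R, 0 <= K & forall x, a < x < b -> `|f x| <= K.
Proof.
move=> cf; split.
  by apply: measurable_funTS; exact: continuous_measurable_fun.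
have [K K0 hK] := continuous_itv_bounded (ltW ab) cf.
by exists K => // x /andP[? ?]; apply: hK; rewrite !ltW.
Qed.

Lemma sqintM_continuous (f g : R -> R) : continuous f -> sqint a b g ->
  sqint a b (fun x => f x * g x).
Proof.
by move=> /continuous_bounded_fun[mf [K _ hK]] sg; exact: (sqintM_bounded mf hK).
Qed.

Lemma rintM_continuous (f g : R -> R) : continuous f -> sqint a b g ->
  rint a b (fun x => f x * g x).
Proof. by move=> cf sg; apply: (rint_sqint ab); exact: sqintM_continuous. Qed.

Lemma weak_derivativeD (f1 g1 f2 g2 : R -> R) :
  sqint a b f1 -> sqint a b g1 -> sqint a b f2 -> sqint a b g2 ->
  weak_derivative a b f1 g1 -> weak_derivative a b f2 g2 ->
  weak_derivative a b (fun x => f1 x + f2 x) (fun x => g1 x + g2 x).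
Proof.
move=> sf1 sg1 sf2 sg2 w1 w2 phi tphi.
have [_ cphi cdphi _ _] := test_functionP tphi.
have e (u v w : R -> R) : continuous w -> sqint a b u -> sqint a b v ->
    Int (fun x => (u x + v x) * w x) = Int (fun x => u x * w x) + Int (fun x => v x * w x).
  move=> cw su sv; rewrite -IntD; last first.
    - by apply: eq_rint (rintM_continuous cw sv) => x _; rewrite mulrC.
    - by apply: eq_rint (rintM_continuous cw su) => x _; rewrite mulrC.
  by apply: eq_Int => x _; rewrite mulrDl.
by rewrite !e// w1// w2// opprD.
Qed.

(** If [phi] is a test function then so is [alpha * phi]. *)
Lemma weak_derivative_smoothM (f g alpha dalpha : R -> R) :
  (forall x, is_derive x (1 : R) alpha (dalpha x)) -> continuous dalpha ->
  sqint a b f -> sqint a b g -> weak_derivative a b f g ->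
  weak_derivative a b (fun x => alpha x * f x) (fun x => dalpha x * f x + alpha x * g x).
Proof.
move=> da cda sf sg w phi tphi; have ca := is_derive_continuous da.
have [_ cphi cdphi _ _] := test_functionP tphi.
have [t dt] := test_functionM tphi da cda.
have := w _ t; rewrite dt => e.
have h1 : rint a b (fun x => f x * (dalpha x * phi x)).
  apply: (@eq_rint _ _ _ (fun x => (dalpha x * phi x) * f x)); first by move=> x _; ring.
  by apply: rintM_continuous => // x; apply: cvgM; [exact: cda|exact: cphi].
have h2 : rint a b (fun x => f x * (alpha x * derive1 phi x)).
  apply: (@eq_rint _ _ _ (fun x => (alpha x * derive1 phi x) * f x)); first by move=> x _; ring.
  by apply: rintM_continuous => // x; apply: cvgM; [exact: ca|exact: cdphi].
have h3 : rint a b (fun x => g x * (alpha x * phi x)).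
  apply: (@eq_rint _ _ _ (fun x => (alpha x * phi x) * g x)); first by move=> x _; ring.
  by apply: rintM_continuous => // x; apply: cvgM; [exact: ca|exact: cphi].
have e1 : Int (fun x => f x * (dalpha x * phi x + alpha x * derive1 phi x)) =
    Int (fun x => f x * (dalpha x * phi x)) + Int (fun x => f x * (alpha x * derive1 phi x)).
  by rewrite -IntD//; apply: eq_Int => x _; ring.
have e2 : Int (fun x => (dalpha x * f x + alpha x * g x) * phi x) =
    Int (fun x => f x * (dalpha x * phi x)) + Int (fun x => g x * (alpha x * phi x)).
  by rewrite -IntD//; apply: eq_Int => x _; ring.
rewrite e2; rewrite e1 in e.
rewrite [LHS](_ : _ = Int (fun x => f x * (alpha x * derive1 phi x))).
  have aux (x y z : R) : x + y = - z -> y = - (x + z) by lra.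
  exact: aux.
by apply: eq_Int => x _; ring.
Qed.

Lemma weak_derivative_cst (c : R) : weak_derivative a b (fun=> c) (fun=> 0).
Proof.
move=> phi /test_functionP[dphi cphi cdphi pa pb].
have sphi := sqint_continuous ab cdphi.
rewrite IntZ; last exact: (rint_sqint ab).
rewrite (Int_FTC ab dphi cdphi) pa pb subrr mulr0.
rewrite (@eq_Int _ _ _ _ (cst 0)); last by move=> x _; rewrite mul0r.
by rewrite Int_cst// mul0r oppr0.
Qed.

Lemma weak_derivative_horner (p : {poly R}) :
  weak_derivative a b (horner p) (horner p^`()).
Proof.
have c1 : continuous (horner p^`()) by exact: continuous_horner.
have := @weak_derivative_smoothM (fun=> 1) (fun=> 0) _ _
  (fun x => is_derive_poly p x) c1 (sqint_cst ab 1) (sqint_cst ab 0) (weak_derivative_cst 1).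
congr weak_derivative; apply/funext => x; ring.
Qed.

Lemma weak_derivative_sum (I : finType) (f g : I -> R -> R) :
  (forall i, sqint a b (f i)) -> (forall i, sqint a b (g i)) ->
  (forall i, weak_derivative a b (f i) (g i)) ->
  weak_derivative a b (fun x => \sum_i f i x) (fun x => \sum_i g i x).
Proof.
move=> sf sg w.
have h (F : I -> R -> R) : (forall i, sqint a b (F i)) -> forall s,
    sqint a b (fun x => \sum_(i <- s) F i x).
  move=> sF; elim=> [|i s ih].
    rewrite (_ : (fun _ => _) = cst 0); last by apply/funext => x; rewrite big_nil.
    exact: sqint_cst.
  rewrite (_ : (fun _ => _) = (fun x => F i x + \sum_(i <- s) F i x)).
    exact: sqintD.
  by apply/funext => x; rewrite big_cons.
elim: (index_enum I) => [|i s ih].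
  have := weak_derivative_cst 0.
  by congr weak_derivative; apply/funext => x; rewrite big_nil.
have := weak_derivativeD (sf i) (sg i) (h _ sf s) (h _ sg s) (w i) ih.
by congr weak_derivative; apply/funext => x; rewrite big_cons.
Qed.

Lemma two_le_of_sqr_le (x y z : R) : 0 <= y -> 0 <= z -> x ^+ 2 <= y * z -> 2 * x <= y + z.
Proof.
move=> y0 z0 h; have [x0|x0] := leP x 0; first by lra.
rewrite -(@ler_pXn2r _ 2)// ?nnegrE; try lra.
by have := sqr_ge0 (y - z); nra.
Qed.

(** Cauchy-Schwarz applied to [H.[x] = \int_a^x H^`()]. The square of [H^`()] is again a
    polynomial, so that its partial integrals are values of a primitive [Q]. *)
Lemma primitive_bound (H : {poly R}) x : H.[a] = 0 -> a < x < b ->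
  H.[x] ^+ 2 <= (b - a) * Int (fun x => H^`().[x] ^+ 2).
Proof.
move=> Ha /andP[ax xb].
have cH' : continuous (horner H^`()) by exact: continuous_horner.
have FTC c d (p : {poly R}) : c < d ->
    \int[mu]_(x in `]c, d[) p^`().[x] = p.[d] - p.[c].
  move=> cd; apply: (Int_FTC cd (fun x => is_derive_poly p x)).
  exact: continuous_horner.
have [Q [Q' Qa]] := poly_primitive (H^`() ^+ 2) a.
have sq c d : \int[mu]_(x in `]c, d[) (H^`().[x] ^+ 2) = \int[mu]_(x in `]c, d[) Q^`().[x].
  by rewrite Q'; apply: eq_Int => y _; rewrite horner_exp.
rewrite sq FTC// Qa subr0.
have h1 : H.[x] ^+ 2 <= Q.[x] * (x - a).
  have := Int_CS (sqint_poly ax H^`()) (sqint_cst ax 1).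
  rewrite sq FTC// Qa subr0 (@eq_Int _ _ _ (fun x => H^`().[x] * cst 1 x) (horner H^`())); last first.
    by move=> y _; rewrite mulr1.
  rewrite FTC// Ha subr0 (@eq_Int _ _ _ (fun x => cst 1 x ^+ 2) (cst 1)); last first.
    by move=> y _; rewrite expr1n.
  by rewrite Int_cst// mul1r.
have h2 : 0 <= Q.[b] - Q.[x].
  by rewrite -FTC// -sq; exact: Int_sqr_ge0.
have h3 : 0 <= Q.[x].
  by have := FTC a x Q ax; rewrite Qa subr0 => <-; rewrite -sq; exact: Int_sqr_ge0.
have : 0 <= x - a <= b - a by lra.
move=> /andP[? ?]; nra.
Qed.

(** Duality: the mean-free part of [f] is tested against derivatives of
    polynomials vanishing at both ends, which are dense among mean-free
    functions and have primitives controlled by [primitive_bound]. *)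
Lemma poincare (f g : R -> R) : sqint a b f -> sqint a b g ->
  weak_derivative a b f g ->
  Int (fun x => (f x - Int f / (b - a)) ^+ 2) <=
  4 * (b - a) ^+ 2 * Int (fun x => g x ^+ 2).
Proof.
move=> sf sg w; set l := b - a; have l0 : 0 < l by rewrite subr_gt0.
set m := Int f / l; set u := fun x => f x - m; set G := Int (fun x => g x ^+ 2).
have su : sqint a b u by apply: sqintB => //; exact: (sqint_cst ab m).
have iu : Int u = 0.
  rewrite IntB; [|exact: (rint_sqint ab)|exact: (rint_cst ab)].
  by rewrite [X in _ - X](Int_cst ab m) /m divfK ?subrr// gt_eqF.
set U := Int (fun x => u x ^+ 2).
have U0 : 0 <= U by exact: Int_sqr_ge0.
have G0 : 0 <= G by exact: Int_sqr_ge0.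
suff key (e : R) : 0 < e -> U <= 4 * l ^+ 2 * G + e.
  by apply/ler_addgt0Pr => e /key.
move=> e0.
have [p hp] := poly_dense ab su (divr_gt0 e0 (ltr0n R 3)).
have sp := sqint_poly ab p; have ip := rint_sqint ab sp.
set mp := Int (horner p) / l; pose h := p - mp%:P.
have hE x : h.[x] = p.[x] - mp by rewrite hornerD hornerN hornerC.
have sh := sqint_poly ab h.
have ih : Int (horner h) = 0.
  rewrite (eq_Int (fun x _ => hE x)) IntB//; last exact: (rint_cst ab).
  by rewrite [X in _ - X](Int_cst ab mp) /mp divfK ?subrr// gt_eqF.
have [H [H' Ha]] := poly_primitive h a.
have Hb : H.[b] = 0.
  have := Int_FTC ab (fun x => is_derive_poly H x) (@continuous_horner _ H^`()).
  by rewrite H' ih Ha subr0.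
(* [H] vanishes at [a] and, as [h] has mean zero, at [b]: it is a test function in
   the sense of [weak_derivative_poly]. *)
have [q Hq] : exists q, H = ('X - a%:P) * (b%:P - 'X) * q.
  have /factor_theorem[q1 Hq1] : root H a by apply/eqP.
  have : root q1 b.
    move: Hb; rewrite Hq1 hornerM hornerXsubC => /eqP.
    by rewrite mulf_eq0 subr_eq0 (gt_eqF ab) orbF.
  move=> /factor_theorem[q2 Hq2]; exists (- q2); rewrite Hq1 Hq2; ring.
have sH := sqint_poly ab H.
have ifh : Int (fun x => f x * h.[x]) = - Int (fun x => g x * H.[x]).
  by have := weak_derivative_poly ab q sf sg w; rewrite /= -Hq H'.
set S := Int (fun x => h.[x] ^+ 2).
have S0 : 0 <= S by exact: Int_sqr_ge0.
have c1 : Int (fun x => g x * H.[x]) ^+ 2 <= G * (l ^+ 2 * S).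
  apply: le_trans (Int_CS sg sH) _; apply: ler_wpM2l => //.
  apply: (@le_trans _ _ (Int (cst (l * S)))).
    apply: le_Int; [by case: sH|exact: (rint_cst ab)|move=> x xab].
    by have := primitive_bound Ha xab; rewrite H'.
  by rewrite Int_cst// -/l; nra.
have sup := sqintB su sp; have suh := sqintB su sh.
set T := Int (fun x => (u x - h.[x]) ^+ 2).
have T1 : T <= e / 3.
  apply/ltW; apply: le_lt_trans hp.
  have -> : T = Int (fun x => (u x - p.[x]) ^+ 2 + (2 * mp * (u x - p.[x]) + mp ^+ 2)).
    by apply: eq_Int => x _; rewrite hE; ring.
  have i1 : rint a b (fun x => u x - p.[x]) by exact: (rint_sqint ab).
  have i2 : rint a b (fun x => 2 * mp * (u x - p.[x]) + mp ^+ 2).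
    by apply: rintD; [exact: rintZ|exact: (rint_cst ab)].
  rewrite IntD//; last by case: sup.
  rewrite -[leRHS]addr0 lerD2l IntD; [|exact: rintZ|exact: (rint_cst ab)].
  rewrite IntZ// IntB//; last exact: (rint_sqint ab).
  rewrite iu sub0r [X in _ + X <= _](Int_cst ab (mp ^+ 2)) -/l.
  have -> : Int (horner p) = mp * l by rewrite /mp divfK// gt_eqF.
  by have := sqr_ge0 mp; nra.
have SU : S <= 2 * U + 2 * T.
  rewrite /U /T /S -!IntZ; [|by case: suh|by case: su].
  rewrite -IntD; [|by apply: rintZ; case: su|by apply: rintZ; case: suh].
  apply: le_Int; first by case: sh.
    by apply: rintD; apply: rintZ; [case: su|case: suh].
  by move=> x _; have := sqr_ge0 (2 * u x - h.[x]); nra.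
have iuh : Int (fun x => u x * h.[x]) = - Int (fun x => g x * H.[x]).
  rewrite -ifh -[RHS]subr0 -(mulr0 m) -ih -IntZ; last exact: (rint_sqint ab).
  rewrite -IntB; [|exact: rintM_sqint|by apply: rintZ; exact: (rint_sqint ab)].
  by apply: eq_Int => x _; rewrite /u; ring.
(* The first term is small with [T]; the second is [- \int g * H]. *)
have UE : U = Int (fun x => u x * (u x - h.[x])) + Int (fun x => u x * h.[x]).
  rewrite -IntD; [|exact: rintM_sqint|exact: rintM_sqint].
  by apply: eq_Int => x _; ring.
have a1 : 2 * Int (fun x => u x * (u x - h.[x])) <= U / 2 + 2 * T.
  apply: two_le_of_sqr_le; [lra|by rewrite mulr_ge0// Int_sqr_ge0|].
  apply: le_trans (Int_CS su suh) _; rewrite -/U -/T.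
  by rewrite le_eqVlt; apply/orP; left; apply/eqP; field.
have LG0 : 0 <= l ^+ 2 * G by rewrite mulr_ge0 ?sqr_ge0.
have a2 : 2 * (- Int (fun x => g x * H.[x])) <= 4 * l ^+ 2 * G + S / 4.
  apply: two_le_of_sqr_le; [by rewrite -mulrA mulr_ge0|by lra|].
  rewrite sqrrN; apply: le_trans c1 _.
  by rewrite le_eqVlt; apply/orP; left; apply/eqP; field.
rewrite iuh in UE.
move: UE a1 a2 SU T1 LG0.
set A := Int (fun x => u x * (u x - h.[x])); set B := Int (fun x => g x * H.[x]).
move: (U) (T) (S) A B => U' T' S' A B; rewrite -mulrA.
by move: (l ^+ 2 * G) => LG; clear -e0; lra.
Qed.

(** Polynomials are dense in [H^1(a, b)]: integrate a polynomial approximation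
    of the derivative and adjust the mean. *)
Lemma meyers_serrin_poly (f g : R -> R) (e : R) : sqint a b f -> sqint a b g ->
  weak_derivative a b f g -> 0 < e ->
  exists P : {poly R}, Int (fun x => (f x - P.[x]) ^+ 2) <= e /\
    Int (fun x => (g x - P^`().[x]) ^+ 2) <= e.
Proof.
move=> sf sg w e0; set l := b - a; have l0 : 0 < l by rewrite subr_gt0.
pose d := Num.min e (e / (4 * l ^+ 2)).
have L0 : 0 < 4 * l ^+ 2 by rewrite mulr_gt0// exprn_gt0.
have d0 : 0 < d by rewrite lt_min e0 divr_gt0.
have [p hp] := poly_dense ab sg d0.
have [Q [Q' _]] := poly_primitive p a.
pose m := Int (fun x => f x - Q.[x]) / l.
exists (Q + m%:P); split; last first.
  rewrite derivD derivC addr0 Q'; apply: ltW; apply: lt_le_trans hp _.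
  by rewrite ge_min lexx.
have sQ := sqint_poly ab Q; have sQ' := sqint_poly ab Q^`().
have sQN := sqintN sQ; have sQN' := sqintN sQ'.
have wQ : weak_derivative a b (fun x => - Q.[x]) (fun x => - Q^`().[x]).
  have := weak_derivative_horner (- Q); rewrite derivN.
  by congr weak_derivative; apply/funext => x; rewrite hornerN.
have := poincare (sqintB sf sQ) (sqintB sg sQ') (weak_derivativeD sf sg sQN sQN' w wQ).
rewrite -/l -/m => h.
apply: (@le_trans _ _ (Int (fun x => (f x - Q.[x] - m) ^+ 2))).
  by rewrite le_eqVlt; apply/orP; left; apply/eqP; apply: eq_Int => x _;
    rewrite hornerD hornerC opprD addrA.
apply: le_trans h _; rewrite Q'; apply: (@le_trans _ _ (4 * l ^+ 2 * d)).
  by apply: ler_wpM2l; apply: ltW.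
by rewrite -ler_pdivlMl// mulrC ge_min lexx orbT.
Qed.

(** Against a polynomial [P] in place of one factor [f] this is the definition, as
    [P * phi] is a test function; all terms are continuous in [P] for the [H^1] norm. *)
Lemma weak_derivative_sqr (f g phi : R -> R) : sqint a b f -> sqint a b g ->
  weak_derivative a b f g -> test_function a b phi ->
  Int (fun x => f x ^+ 2 * derive1 phi x) = - (2 * Int (fun x => f x * g x * phi x)).
Proof.
move=> sf sg w tphi; have [dphi cphi cdphi _ _] := test_functionP tphi.
have sfd := sqintM_continuous cdphi sf; have sfp := sqintM_continuous cphi sf.
have sgp := sqintM_continuous cphi sg.
set A := Int (fun x => f x ^+ 2 * derive1 phi x).
set B := Int (fun x => f x * g x * phi x).
have iA : rint a b (fun x => f x ^+ 2 * derive1 phi x).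
  by apply: eq_rint (rintM_sqint sf sfd) => x _; ring.
have iB : rint a b (fun x => f x * g x * phi x).
  by apply: eq_rint (rintM_sqint sf sgp) => x _; ring.
pose C := Int (fun x => (derive1 phi x * f x) ^+ 2) + Int (fun x => (phi x * f x) ^+ 2)
  + Int (fun x => (phi x * g x) ^+ 2).
have c1_0 := Int_sqr_ge0 a b (fun x => derive1 phi x * f x).
have c2_0 := Int_sqr_ge0 a b (fun x => phi x * f x).
have c3_0 := Int_sqr_ge0 a b (fun x => phi x * g x).
have C0 : 0 <= C by rewrite !addr_ge0.
suff key (e : R) : 0 < e -> (A + 2 * B) ^+ 2 <= 0 + e.
  have : (A + 2 * B) ^+ 2 <= 0 by apply/ler_addgt0Pr => e /key.
  have := sqr_ge0 (A + 2 * B) => h1 h2.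
  have /eqP : (A + 2 * B) ^+ 2 = 0 by apply/eqP; rewrite eq_le h1 h2.
  by rewrite sqrf_eq0 addr_eq0 => /eqP.
move=> e0.
have d0 : 0 < e / (3 * C + 1) by rewrite divr_gt0//; lra.
have [P [hP1 hP2]] := meyers_serrin_poly sf sg w d0.
set d := e / (3 * C + 1) in d0 hP1 hP2.
have sP := sqint_poly ab P; have sP' := sqint_poly ab P^`().
have sfP := sqintB sf sP; have sgP := sqintB sg sP'.
have [t dt] := test_functionM tphi (fun x => is_derive_poly P x)
   (@continuous_horner R P^`()).
have := w _ t; rewrite dt => e1.
have sPphi : sqint a b (fun x => P.[x] * phi x).
  by apply: eq_sqint (sqintM_continuous cphi sP) => x _; rewrite mulrC.
have sPdphi : sqint a b (fun x => P^`().[x] * phi x + P.[x] * derive1 phi x).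
  have h1 := sqintM_continuous cphi sP'; have h2 := sqintM_continuous cdphi sP.
  by apply: eq_sqint (sqintD h1 h2) => x _; ring.
have E : A + 2 * B = Int (fun x => (derive1 phi x * f x) * (f x - P.[x]))
   + Int (fun x => (phi x * f x) * (g x - P^`().[x]))
   + Int (fun x => (phi x * g x) * (f x - P.[x])).
  have i1 := rintM_sqint sf sPdphi; have i2 := rintM_sqint sg sPphi.
  have i3 := rintM_sqint sfd sfP; have i4 := rintM_sqint sfp sgP.
  have i5 := rintM_sqint sgp sfP.
  have i6 := rintD i3 i4; have i7 := rintZ 2 iB.
  transitivity (A + 2 * B - (Int (fun x => f x * (P^`().[x] * phi x + P.[x] * derive1 phi x))
     + Int (fun x => g x * (P.[x] * phi x)))); first by rewrite e1 addNr subr0.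
  have i8 := rintD iA i7; have i9 := rintD i1 i2.
  rewrite /A /B -(IntZ _ iB) -(IntD iA i7) -(IntD i1 i2) -(IntB i8 i9).
  rewrite -(IntD i3 i4) -(IntD i6 i5).
  by apply: eq_Int => x _; ring.
have k1 := le_trans (Int_CS sfd sfP) (ler_wpM2l c1_0 hP1).
have k2 := le_trans (Int_CS sfp sgP) (ler_wpM2l c2_0 hP2).
have k3 := le_trans (Int_CS sgp sfP) (ler_wpM2l c3_0 hP1).
have dE : d * (3 * C + 1) = e by rewrite /d divfK// gt_eqF//; lra.
rewrite E add0r.
have aux (x1 x2 x3 y1 y2 y3 : R) : x1 ^+ 2 <= y1 * d -> x2 ^+ 2 <= y2 * d ->
    x3 ^+ 2 <= y3 * d -> d * (3 * (y1 + y2 + y3) + 1) = e -> (x1 + x2 + x3) ^+ 2 <= e.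
  move=> z1 z2 z3 <-; have := sqr_ge0 (x1 - x2); have := sqr_ge0 (x1 - x3).
  have := sqr_ge0 (x2 - x3); move: d0; clear -z1 z2 z3; nra.
exact: aux k1 k2 k3 dE.
Qed.

(** The weak derivative pairs to zero with all [(x - a) (b - x) q.[x]]: by density
    of the polynomials [q], the function [(x - a) (b - x) k x] is zero in [L^2]. *)
Lemma weak_derivative0_eq0 (k : R -> R) : sqint a b k ->
  weak_derivative a b (fun=> 0) k -> Int (fun x => k x ^+ 2) = 0.
Proof.
move=> sk w.
pose chi : {poly R} := ('X - a%:P) * (b%:P - 'X).
have chiE x : chi.[x] = (x - a) * (b - x).
  by rewrite hornerM hornerXsubC hornerD hornerN hornerX hornerC.
pose v x := chi.[x] * k x.
have sv : sqint a b v by apply: sqintM_continuous => //; exact: continuous_horner.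
have orth q : Int (fun x => v x * q.[x]) = 0.
  have h := weak_derivative_poly ab q (sqint_cst ab 0) sk w.
  apply: oppr_inj; rewrite oppr0.
  transitivity (Int (fun x => cst 0 x * (chi * q)^`().[x])).
    by rewrite h; congr (- _); apply: eq_Int => x _; rewrite /v (hornerM chi) mulrA [k x * _]mulrC.
  rewrite (@eq_Int _ _ _ _ (cst 0)); last by move=> x _; rewrite mul0r.
  by rewrite Int_cst// mul0r.
have v0 : Int (fun x => v x ^+ 2) = 0.
  set V := Int (fun x => v x ^+ 2).
  have V0 : 0 <= V by exact: Int_sqr_ge0.
  apply/eqP; rewrite eq_le V0 andbT leNgt; apply/negP => Vp.
  have [q hq] := poly_dense ab sv Vp.
  have sq := sqint_poly ab q; have svq := sqintB sv sq.
  have VE : V = Int (fun x => v x * (v x - q.[x])).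
    rewrite -[LHS]subr0 -(orth q) -IntB; [|by case: sv|exact: rintM_sqint].
    by apply: eq_Int => x _; ring.
  have := Int_CS sv svq; rewrite -VE -/V => h.
  have : V * Int (fun x => (v x - q.[x]) ^+ 2) < V * V by rewrite ltr_pM2l.
  by rewrite -expr2 => /(le_lt_trans h); rewrite ltxx.
have [mk _] := sk.
rewrite -[RHS](mul0r (b - a)) -(Int_cst ab 0).
apply: ae_Int_eq; [by apply: measurable_funX|exact: measurable_cst|].
have [N [mN N0 sub]] := Int_sqr_eq0 sv v0.
exists N; split => // x /= h; apply: sub => /= hx; apply: h => xab.
move: (hx xab) => /eqP; rewrite /v chiE !mulf_eq0 !subr_eq0.
case/andP: xab => ax xb; rewrite (gt_eqF ax) (gt_eqF xb)/= => /eqP ->.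
by rewrite expr0n.
Qed.

(** Half the weak derivative of [\sum_i M i x ^+ 2], which is the constant [1]. *)
Lemma sphere_orthogonal (I : finType) (M G : I -> R -> R) :
  (forall i, sqint a b (M i)) -> (forall i, sqint a b (G i)) ->
  (forall i, weak_derivative a b (M i) (G i)) ->
  (forall x, a < x < b -> \sum_i M i x ^+ 2 = 1) ->
  Int (fun x => (\sum_i M i x * G i x) ^+ 2) = 0.
Proof.
move=> sM sG w M1.
have Mb i x : a < x < b -> `|M i x| <= 1.
  move=> /M1 h; rewrite -(@ler_pXn2r _ 2)// ?nnegrE// expr1n (real_normK (num_real _)) -h.
  by rewrite (bigD1 i)//= lerDl sumr_ge0// => j _; exact: sqr_ge0.
have sMG i : sqint a b (fun x => M i x * G i x).
  by apply: (sqintM_bounded _ (Mb i)) => //; case: (sM i).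
apply: (weak_derivative0_eq0 (sqint_sum ab sMG)) => phi tphi.
have [dphi cphi cdphi pa pb] := test_functionP tphi.
have sdphi := sqint_continuous ab cdphi.
rewrite (@eq_Int _ _ _ (fun x => 0 * derive1 phi x) (cst 0)); last by move=> x _; rewrite mul0r.
rewrite Int_cst// mul0r.
have sp i : rint a b (fun x => M i x * G i x * phi x).
  by apply: eq_rint (rintM_continuous cphi (sMG i)) => x _; rewrite mulrC.
have sq i : rint a b (fun x => M i x ^+ 2 * derive1 phi x).
  apply: eq_rint (rintM_sqint (sM i) (sqintM_continuous cdphi (sM i))) => x _; ring.
have e1 : Int (fun x => (\sum_i M i x * G i x) * phi x) =
    \sum_i Int (fun x => M i x * G i x * phi x).
  by rewrite -Int_sum//; apply: eq_Int => x _; rewrite mulr_suml.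
have e2 : \sum_i Int (fun x => M i x ^+ 2 * derive1 phi x) = 0.
  rewrite -Int_sum//; transitivity (Int (derive1 phi)).
    by apply: eq_Int => x /M1 h; rewrite -mulr_suml h mul1r.
  by rewrite (Int_FTC ab dphi cdphi) pa pb subrr.
rewrite e1.
have : 2 * \sum_i Int (fun x => M i x * G i x * phi x) = 0.
  apply: oppr_inj; rewrite oppr0 -[RHS]e2 mulr_sumr -sumrN.
  by apply: eq_bigr => i _; rewrite (weak_derivative_sqr (sM i) (sG i) (w i) tphi).
by lra.
Qed.
End WeakCalculus.

(** * Exponentials of infinitesimal rotations *)

Section Rotation.
Context {R : realType} {n : nat}.
Implicit Types (A : 'M[R]_n) (t : R).

(** Rodrigues's formula for [exp (t A)], valid when [A ^+ 3 = - A]. *)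
Definition rot A t : 'M[R]_n := 1%:M + sin t *: A + (1 - cos t) *: (A *m A).

Lemma rot0 A : rot A 0 = 1%:M.
Proof. by rewrite /rot sin0 cos0 subrr !scale0r !addr0. Qed.

Lemma rotD A s t : A *m A *m A = - A -> rot A (s + t) = rot A s *m rot A t.
Proof.
move=> A3; have A4 : A *m A *m (A *m A) = - (A *m A) by rewrite mulmxA A3 mulNmx.
have A3' : A *m (A *m A) = - A by rewrite mulmxA.
rewrite /rot !(mulmxDl, mulmxDr, mul1mx, mulmx1) -!(scalemxAl, scalemxAr) A4 A3 A3'.
rewrite sinD cosD; apply/matrixP => i j; rewrite !mxE.
set B := (A *m A) i j.
ring.
Qed.

Lemma mulmx_rotC A t : A *m rot A t = rot A t *m A.
Proof.
by rewrite /rot !(mulmxDl, mulmxDr, mul1mx, mulmx1) -!(scalemxAl, scalemxAr) mulmxA.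
Qed.

End Rotation.

Section Exponential.
Context {R : realType}.

(** The powers of [A] are [1], [A], [A ^+ 2], [- A], [- A ^+ 2] and so on, so that the
    exponential series splits into those of sine and cosine. *)
Lemma expmx_rot n (A : 'M[R]_n.+1) t : A *m A *m A = - A -> expmx (t *: A) = rot A t.
Proof.
move=> A3.
have pw k : A ^+ k.*2.+1 = (-1) ^+ k *: A /\ A ^+ k.*2.+2 = (-1) ^+ k *: (A *m A).
  elim: k => [|k [ih1 ih2]]; first by rewrite !expr0 expr1 !scale1r expr2.
  have h1 : A ^+ k.+1.*2.+1 = (-1) ^+ k.+1 *: A.
    rewrite doubleS exprS ih2 -[_ * _]/(A *m _) -scalemxAr mulmxA A3 scalerN.
    by rewrite exprS mulN1r scaleNr.
  split => //; rewrite exprS h1 -[_ * _]/(A *m _) -scalemxAr//.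
have coef k : (k`!%:R)^-1 *: (t *: A) ^+ k =
    sin_coeff t k *: A - cos_coeff t k *: (A *m A) + (k == 0%N)%:R *: (1%:M + A *m A).
  rewrite exprZn scalerA.
  have [->|[j ->]|[j ->]] : [\/ k = 0%N, exists j, k = j.*2.+1 | exists j, k = j.+1.*2].
  - have := odd_double_half k; case: (odd k) => /=; first by move=> <-; constructor 2; exists k./2.
    by case: (k./2) => [|j] <-; [constructor 1|constructor 3; exists j].
  - have -> : sin_coeff t 0 = 0 by exact: (sin_coeff_even 0).
    have -> : cos_coeff t 0 = 1 by rewrite -(cos_coeff'E t 0) /cos_coeff' expr0z expr0 fact0 divr1 mulr1.
    by rewrite expr0 fact0 invr1 mulr1 scale0r !scale1r expr0 sub0r addrC addrK.
  - rewrite (pw j).1 cos_coeff_odd -sin_coeff'E /sin_coeff' !scale0r subr0 addr0 scalerA.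
    by congr (_ *: _); rewrite -exprnP; ring.
  - rewrite doubleS (pw j).2 -doubleS sin_coeff_even -cos_coeff'E /cos_coeff'.
    rewrite !scale0r add0r addr0 scalerA -scaleNr.
    by congr (_ *: _); rewrite -exprnP exprS; ring.
rewrite /expmx.
have -> : series (fun k => (k`!%:R)^-1 *: (t *: A) ^+ k) =
   (fun k => series (sin_coeff t) k *: A - series (cos_coeff t) k *: (A *m A)
     + (k != 0%N)%:R *: (1%:M + A *m A)).
  apply/funext => k; rewrite /series /=; elim: k => [|k ih].
    by rewrite !big_geq// !scale0r subrr addr0.
  rewrite !big_nat_recr//= ih coef addrACA [X in X + _]addrACA -opprD -!scalerDl.
  by congr (_ + _ *: _); rewrite -natrD; case: k {ih}.
have cA (c : nat -> R) (l : R) (B : 'M[R]_n.+1) : c k @[k --> \oo] --> l ->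
   c k *: B @[k --> \oo] --> l *: B.
  by move=> h; apply: cvgZr_tmp.
rewrite /rot; apply: cvg_lim => //.
have -> : 1%:M + sin t *: A + (1 - cos t) *: (A *m A) =
   sin t *: A - cos t *: (A *m A) + 1 *: (1%:M + A *m A).
  by apply/matrixP => i j; rewrite !mxE; set B := \sum_i0 _; ring.
apply: cvgD; first apply: cvgB.
- by apply: cA; rewrite [in X in _ --> X]unlock; exact: is_cvg_series_sin_coeff.
- by apply: cA; rewrite [in X in _ --> X]unlock; exact: is_cvg_series_cos_coeff.
- apply: cA; apply: cvg_near_cst; exists 1%N => // k /=.
  by case: k.
Qed.

End Exponential.

Section Omega.
Context {R : realType}.

Lemma sum3 (V : nmodType) (F : 'I_3 -> V) :
  \sum_i F i = F ord0 + F (lift ord0 ord0) + F (lift ord0 (lift ord0 ord0)).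
Proof. by rewrite !big_ord_recl big_ord0 addr0 addrA. Qed.

Lemma mulmx3E m n (A : 'M[R]_(m, 3)) (B : 'M[R]_(3, n)) i j : (A *m B) i j =
  A i ord0 * B ord0 j + A i (lift ord0 ord0) * B (lift ord0 ord0) j
  + A i (lift ord0 (lift ord0 ord0)) * B (lift ord0 (lift ord0 ord0)) j.
Proof. by rewrite mxE sum3. Qed.

Lemma Omega_x3 : Omega_x *m Omega_x *m Omega_x = - Omega_x :> 'M[R]_3.
Proof.
apply/matrixP => i j; rewrite !mulmx3E !mxE.
by case: i => [[|[|[|//]]] ?]; case: j => [[|[|[|//]]] ?] /=; ring.
Qed.

Lemma Omega_y3 : Omega_y *m Omega_y *m Omega_y = - Omega_y :> 'M[R]_3.
Proof.
apply/matrixP => i j; rewrite !mulmx3E !mxE.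
by case: i => [[|[|[|//]]] ?]; case: j => [[|[|[|//]]] ?] /=; ring.
Qed.

Lemma Omega_z3 : Omega_z *m Omega_z *m Omega_z = - Omega_z :> 'M[R]_3.
Proof.
apply/matrixP => i j; rewrite !mulmx3E !mxE.
by case: i => [[|[|[|//]]] ?]; case: j => [[|[|[|//]]] ?] /=; ring.
Qed.

End Omega.

(** * Impulsive controls *)

Section Words.
Context {R : realType}.

(** A pulse [(tau, (k, beta))] is a free evolution during [tau] followed by a
    jump of angle [beta] about the axis [pulse_axis k]. *)
Definition pulse := (R * (bool * R))%type.
Definition pulse_axis (k : bool) : 'M[R]_3 := if k then Omega_x else Omega_y.

Lemma pulse_axis3 k : pulse_axis k *m pulse_axis k *m pulse_axis k = - pulse_axis k.
Proof. by case: k; [exact: Omega_x3|exact: Omega_y3]. Qed.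

(** The resolvent of a sequence of pulses, the most recent one first. *)
Fixpoint flow (s : seq pulse) (w : R) : 'M[R]_3 :=
  if s is p :: s' then
    rot (pulse_axis p.2.1) p.2.2 *m (rot Omega_z (w * p.1) *m flow s' w)
  else 1%:M.

Lemma free_flowE w t (x : 'cV[R]_3) : free_flow w t x = rot Omega_z (w * t) *m x.
Proof. by rewrite /free_flow expmx_rot//; exact: Omega_z3. Qed.

Lemma free_flowD w s t (x : 'cV[R]_3) :
  free_flow w (s + t) x = free_flow w s (free_flow w t x).
Proof. by rewrite !free_flowE mulrDr rotD ?mulmxA//; exact: Omega_z3. Qed.

(** The time [t] after the last impulse is only used by the last free evolution. *)
Lemma evolve_later u v w t tau s bs (x : 'cV[R]_3) :
  evolve u v w (t + tau) s bs x = free_flow w tau (evolve u v w t s bs x).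
Proof.
elim: bs s x => [|b bs ih] s x /=; last exact: ih.
by rewrite -free_flowD; congr (free_flow w _ x); ring.
Qed.

Lemma evolve_rcons u v w t s bs b (x : 'cV[R]_3) :
  evolve u v w t s (rcons bs b) x =
  free_flow w (t - b) (jump u v b (evolve u v w b s bs x)).
Proof. by elim: bs s x => [|b' bs ih] s x /=. Qed.

Lemma eq_evolve (u v u' v' : dirac_sum R) w t s (bs : seq R) (x : 'cV[R]_3) :
  (forall b, b \in bs -> u b = u' b /\ v b = v' b) ->
  evolve u v w t s bs x = evolve u' v' w t s bs x.
Proof.
elim: bs s x => [//|b bs ih] s x h /=; rewrite /jump.
have [-> ->] := h b (mem_head _ _); apply: ih => b' b'bs.
by apply: h; rewrite in_cons b'bs orbT.
Qed.

Lemma impulse_times_rcons (u v u' v' : dirac_sum R) b :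
  (finsupp u' `|` finsupp v' = b |` (finsupp u `|` finsupp v))%fset ->
  (forall c, c \in impulse_times u v -> c < b) ->
  impulse_times u' v' = rcons (impulse_times u v) b.
Proof.
move=> e lt; rewrite /impulse_times e.
set A := (finsupp u `|` finsupp v)%fset in lt *.
have bA : b \notin A.
  by apply/negP => bA; have := lt b; rewrite mem_sort ltxx => /(_ bA).
apply: (sorted_eq (@le_trans _ R) (@le_anti _ R)).
- exact: sort_le_sorted.
- have : sorted <=%O (sort <=%O A) by exact: sort_le_sorted.
  rewrite /impulse_times -/A in lt.
  case: (sort <=%O A) lt => [|x l] //= lt xl.
  by rewrite rcons_path xl ltW// lt// mem_last.
- apply: uniq_perm.
  + by rewrite sort_uniq fset_uniq.
  + by rewrite rcons_uniq mem_sort bA sort_uniq fset_uniq.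
  + by move=> c; rewrite mem_rcons mem_sort in_fset1U in_cons mem_sort.
Qed.

Lemma mem_impulse_times (u v : dirac_sum R) c :
  (c \in impulse_times u v) = (c \in finsupp u) || (c \in finsupp v).
Proof. by rewrite mem_sort in_fsetU. Qed.

(** By induction: as its delay is positive, each pulse becomes an impulse strictly
    later than those of the pulses before it, whose jumps are unaffected. A pulse of
    angle zero leaves the controls unchanged, as a zero weight is not an impulse.
    The bound on the impulse times serves the induction. *)
Lemma flow_reachable (s : seq pulse) : all (fun p => 0 < p.1) s ->
  exists (t : R) (u v : dirac_sum R), [/\ 0 <= t, D u, D v,
    forall c, c \in impulse_times u v -> c <= t &
    forall M0, U_right t u v M0 = (fun w => flow s w *m M0 w)].
Proof.
elim: s => [_|[tau [k beta]] s ih /= /andP[tau0 /ih[t [u [v [t0 Du Dv tmax ut]]]]]].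
  exists 0, [fsfun for fun=> 0], [fsfun for fun=> 0].
  have e c : c \in impulse_times [fsfun for fun=> 0 : R] [fsfun for fun=> 0 : R] = false.
    by rewrite mem_impulse_times !in_finsupp0.
  split => //.
  - by move=> b; rewrite in_finsupp0.
  - by move=> b; rewrite in_finsupp0.
  - by move=> c; rewrite e.
  - move=> M0; apply/funext => w; rewrite /U_right.
    have -> : impulse_times [fsfun for fun=> 0 : R] [fsfun for fun=> 0 : R] = [::].
      by case E : impulse_times => [//|c l]; have := e c; rewrite E mem_head.
    by rewrite /= free_flowE subrr mulr0 rot0.
pose b := t + tau.
have b0 : 0 <= b by rewrite /b addr_ge0// ltW.
have tb : t < b by rewrite /b ltrDl.
have ltb c : c \in impulse_times u v -> c < b by move=> /tmax ct; exact: le_lt_trans ct tb.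
have ev w (x : 'cV[R]_3) : evolve u v w t 0 (impulse_times u v) x = flow s w *m x.
  have := congr1 (fun f => f w) (ut (fun=> x)); rewrite /U_right.
  by rewrite (all_filterP (introT allP tmax)).
have [->|beta0] := eqVneq beta 0.
  exists b, u, v; split => //; first by move=> c /ltb /ltW.
  move=> M0; apply/funext => w; rewrite /U_right.
  rewrite (all_filterP (introT allP (fun c h => ltW (ltb c h)))).
  by rewrite /b evolve_later ev free_flowE rot0 mul1mx mulmxA.
pose u' : dirac_sum R := if k then [fsfun u with b |-> beta] else u.
pose v' : dirac_sum R := if k then v else [fsfun v with b |-> beta].
have nb : (b \notin finsupp u) && (b \notin finsupp v).
  rewrite -negb_or -mem_impulse_times; apply/negP => /ltb.
  by rewrite ltxx.
have [ub vb] : u b = 0 /\ v b = 0.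
  by case/andP: nb => nu nv; rewrite !fsfun_dflt.
have supp (f : dirac_sum R) : finsupp [fsfun f with b |-> beta] = (b |` finsupp f)%fset.
  by rewrite finsupp_with (negbTE beta0).
have e : (finsupp u' `|` finsupp v' = b |` (finsupp u `|` finsupp v))%fset.
  rewrite /u' /v'; case: (k); rewrite supp; first by rewrite fsetUA.
  by rewrite fsetUCA.
have it := impulse_times_rcons e ltb.
have le c : c \in impulse_times u' v' -> c <= b.
  by rewrite it mem_rcons in_cons => /predU1P[->//|/ltb /ltW].
have Df (f : dirac_sum R) : D f -> D [fsfun f with b |-> beta].
  by move=> Dff c; rewrite supp in_fset1U => /predU1P[->//|]; exact: Dff.
exists b, u', v'; split => //.
- by rewrite /u'; case: (k) => //; exact: Df.
- by rewrite /v'; case: (k) => //; exact: Df.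
move=> M0; apply/funext => w; rewrite /U_right.
rewrite (all_filterP (introT allP le)) it evolve_rcons subrr.
rewrite free_flowE mulr0 rot0 mul1mx.
rewrite -(@eq_evolve u v); last first.
  move=> c /ltb cb; have nc : (c == b) = false by rewrite lt_eqF.
  by rewrite /u' /v'; case: (k); rewrite fsfun_withE nc.
rewrite /b evolve_later -/b ev free_flowE /jump.
have -> : u' b *: Omega_x + v' b *: Omega_y = beta *: pulse_axis k.
  rewrite /u' /v' /pulse_axis; case: (k); rewrite fsfun_with ?ub ?vb scale0r.
    by rewrite addr0.
  by rewrite add0r.
by rewrite expmx_rot ?pulse_axis3// !mulmxA.
Qed.

End Words.

(** * Jets of rotations *)

Section TrigBounds.
Context {R : realType}.

Lemma mvt0 (f f' : R -> R) (x y : R) : (forall z, is_derive z (1 : R) f (f' z)) ->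
  exists2 c, `|c - x| <= `|y - x| & f y - f x = f' c * (y - x).
Proof.
move=> df; have cf := is_derive_continuous df.
have [xy|yx|->] := ltgtP x y; last by exists y; rewrite ?subrr ?mulr0.
- have [c] := @MVT _ f f' x y xy (fun z _ => df z) (continuous_subspaceT cf).
  rewrite in_itv/= => /andP[xc cy] e; exists c => //.
  by rewrite !ger0_norm; lra.
- have [c] := @MVT _ f f' y x yx (fun z _ => df z) (continuous_subspaceT cf).
  rewrite in_itv/= => /andP[xc cy] e; exists c.
    by rewrite !ler0_norm; lra.
  by lra.
Qed.

Lemma sin_lip (x y : R) : `|sin y - sin x| <= `|y - x|.
Proof.
have [c _ ->] := mvt0 x y (fun z => is_derive_sin z).
by rewrite normrM -[leRHS]mul1r ler_wpM2r// ler_norml cos_geN1 cos_le1.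
Qed.

Lemma cos_lip (x y : R) : `|cos y - cos x| <= `|y - x|.
Proof.
have [c _ ->] := mvt0 x y (fun z => is_derive_cos z).
by rewrite normrM normrN -[leRHS]mul1r ler_wpM2r// ler_norml sin_geN1 sin_le1.
Qed.

Lemma sin_bound (x : R) : `|sin x| <= `|x|.
Proof. by have := sin_lip 0 x; rewrite sin0 !subr0. Qed.

Lemma cos_bound1 (x : R) : `|1 - cos x| <= `|x|.
Proof. by have := cos_lip 0 x; rewrite cos0 subr0 distrC. Qed.

Lemma cos_bound2 (x : R) : `|1 - cos x| <= x ^+ 2.
Proof.
have [c] := mvt0 0 x (fun z => is_derive_cos z).
rewrite cos0 !subr0 distrC => cx ->.
rewrite normrM normrN -(real_normK (num_real x)) expr2 ler_wpM2r//.
exact: le_trans (sin_bound c) cx.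
Qed.

Lemma sin_bound2 (x : R) : `|sin x - x| <= x ^+ 2.
Proof.
have d z : is_derive z (1 : R) (fun y => sin y - y) (cos z - 1).
  by apply: is_derive_eq.
have [c] := mvt0 0 x d; rewrite sin0 !subr0 => cx ->.
rewrite normrM -(real_normK (num_real x)) expr2 ler_wpM2r// distrC.
exact: le_trans (cos_bound1 c) cx.
Qed.

End TrigBounds.

Section RowBound.
Context {R : realType}.

(** [rb A c]: the operator norm of [A] for the sup norm is at most [c]. *)
Definition rb m n (A : 'M[R]_(m, n)) (c : R) := forall i, \sum_j `|A i j| <= c.

Lemma rbW m n (A : 'M[R]_(m, n)) c d : c <= d -> rb A c -> rb A d.
Proof. by move=> cd h i; exact: le_trans (h i) cd. Qed.

Lemma rbD m n (A B : 'M[R]_(m, n)) c d : rb A c -> rb B d -> rb (A + B) (c + d).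
Proof.
move=> hA hB i; apply: le_trans (lerD (hA i) (hB i)).
by rewrite -big_split; apply: ler_sum => j _; rewrite mxE ler_normD.
Qed.

Lemma rbN m n (A : 'M[R]_(m, n)) c : rb A c -> rb (- A) c.
Proof.
by move=> hA i; apply: le_trans (hA i); apply: ler_sum => j _; rewrite mxE normrN.
Qed.

Lemma rbB m n (A B : 'M[R]_(m, n)) c d : rb A c -> rb B d -> rb (A - B) (c + d).
Proof. by move=> hA hB; apply: rbD => //; exact: rbN. Qed.

Lemma rbZ m n (A : 'M[R]_(m, n)) k c : rb A c -> rb (k *: A) (`|k| * c).
Proof.
move=> hA i; apply: le_trans (ler_wpM2l (normr_ge0 k) (hA i)).
by rewrite mulr_sumr; apply: ler_sum => j _; rewrite mxE normrM.
Qed.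

Lemma rb_ge0 m n (A : 'M[R]_(m, n)) c (i : 'I_m) : rb A c -> 0 <= c.
Proof. by move=> /(_ i); apply: le_trans; apply: sumr_ge0. Qed.

Lemma rbM m n p (A : 'M[R]_(m, n)) (B : 'M[R]_(n, p)) c d : 0 <= d ->
  rb A c -> rb B d -> rb (A *m B) (c * d).
Proof.
move=> d0 hA hB i; apply: le_trans (ler_wpM2r d0 (hA i)).
apply: (@le_trans _ _ (\sum_j \sum_k `|A i k| * `|B k j|)).
  apply: ler_sum => j _; rewrite mxE; apply: le_trans (ler_norm_sum _ _ _) _.
  by apply: ler_sum => k _; rewrite normrM.
rewrite exchange_big mulr_suml; apply: ler_sum => k _.
by rewrite -mulr_sumr ler_wpM2l.
Qed.

Lemma rb_scalar n (c : R) : rb (c%:M : 'M[R]_n) `|c|.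
Proof.
move=> i; rewrite (bigD1 i)//= big1 ?addr0 ?mxE ?eqxx// => j ji.
by rewrite mxE eq_sym (negbTE ji) mulr0n normr0.
Qed.

Lemma rb1 n : rb (1%:M : 'M[R]_n) 1.
Proof. by have := @rb_scalar n 1; rewrite normr1. Qed.

Lemma rb0 m n : rb (0 : 'M[R]_(m, n)) 0.
Proof. by move=> i; rewrite big1// => j _; rewrite mxE normr0. Qed.

Lemma rb_entry m n (A : 'M[R]_(m, n)) c i j : rb A c -> `|A i j| <= c.
Proof.
by move=> /(_ i); apply: le_trans; rewrite (bigD1 j)//= lerDl sumr_ge0.
Qed.

(** [A ^+ k] for a size that is not syntactically a successor, such as [3 + 3]. *)
Fixpoint mxpow n (A : 'M[R]_n) k := if k is k'.+1 then A *m mxpow A k' else 1%:M.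

Lemma rb_mxpow n (A : 'M[R]_n) c k : 1 <= c -> rb A c -> rb (mxpow A k) (c ^+ k).
Proof.
move=> c1 hA; elim: k => [|k ih] /=; first exact: rb1.
by rewrite exprS; apply: rbM => //; rewrite exprn_ge0//; lra.
Qed.

(** The telescoping estimate behind the convergence of a one-step scheme: a local
    error [e], repeated [k] times and amplified by [c ^+ k]. *)
Lemma rb_mxpowB n (P Q : 'M[R]_n) c e k : 1 <= c -> 0 <= e -> rb P c -> rb Q c ->
  rb (P - Q) e -> rb (mxpow P k - mxpow Q k) (k%:R * e * c ^+ k).
Proof.
move=> c1 e0 hP hQ hPQ; elim: k => [|k ih] /=.
  by rewrite subrr !mul0r; exact: rb0.
have -> : P *m mxpow P k - Q *m mxpow Q k =
    (P - Q) *m mxpow P k + Q *m (mxpow P k - mxpow Q k).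
  by rewrite mulmxBl mulmxBr addrA subrK.
have ck0 : 0 <= c ^+ k by rewrite exprn_ge0//; lra.
apply: rbW (rbD (rbM ck0 hPQ (rb_mxpow _ c1 hP)) (rbM _ hQ ih)); last first.
  by rewrite !mulr_ge0.
rewrite exprS -natr1; have : 0 <= e * c ^+ k by rewrite mulr_ge0.
set X := e * _; have : 0 <= k%:R :> R by [].
rewrite -!mulrA; rewrite [e * (c * _)]mulrCA -/X; nra.
Qed.

End RowBound.

Section Jets.
Context {R : realType}.

(** The value [A] and the derivative [A'] at a point of a matrix-valued
    function; the block product is Leibniz's rule. *)
Definition jet (A A' : 'M[R]_3) : 'M[R]_(3 + 3) := block_mx A A' 0 A.

Lemma jetM A A' B B' : jet A A' *m jet B B' = jet (A *m B) (A *m B' + A' *m B).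
Proof. by rewrite /jet mulmx_block !mulmx0 !mul0mx !addr0 !add0r. Qed.

Lemma jet1 : jet 1%:M 0 = 1%:M.
Proof. by rewrite /jet -scalar_mx_block. Qed.

Lemma jetD A A' B B' : jet A A' + jet B B' = jet (A + B) (A' + B').
Proof. by rewrite /jet add_block_mx addr0. Qed.

Lemma jetZ k A A' : k *: jet A A' = jet (k *: A) (k *: A').
Proof. by rewrite /jet scale_block_mx scaler0. Qed.

Lemma jetN A A' : - jet A A' = jet (- A) (- A').
Proof. by rewrite /jet opp_block_mx oppr0. Qed.

Lemma rb_jet A A' c d : rb A c -> rb A' d -> rb (jet A A') (c + d).
Proof.
move=> hA hA' i; rewrite big_split_ord/=.
have c0 : 0 <= c by exact: (rb_ge0 ord0 hA).
have d0 : 0 <= d by exact: (rb_ge0 ord0 hA').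
rewrite -(splitK i); case: (fintype.split i) => k /=.
  apply: lerD; [move: (hA k)|move: (hA' k)]; apply: le_trans.
    by apply: ler_sum => j _; rewrite block_mxEul.
  by apply: ler_sum => j _; rewrite block_mxEur.
rewrite addrC; apply: lerD; [move: (hA k)|]; last first.
  by rewrite big1// => j _; rewrite block_mxEdl mxE normr0.
by apply: le_trans; apply: ler_sum => j _; rewrite block_mxEdr.
Qed.

Lemma rb_jet_inv A A' c i j : rb (jet A A') c -> `|A i j| <= c /\ `|A' i j| <= c.
Proof.
move=> h; have := rb_entry (lshift 3 i) (lshift 3 j) h.
have := rb_entry (lshift 3 i) (rshift 3 j) h.
by rewrite block_mxEul block_mxEur.
Qed.

(** The jet of [w |-> rot A (h w)] at a point where [h] and its derivative have the
    values [h] and [h']. *)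
Definition jrot (A : 'M[R]_3) (h h' : R) := jet (rot A h) (h' *: (A *m rot A h)).

Lemma jrot0 A : jrot A 0 0 = 1%:M.
Proof. by rewrite /jrot scale0r rot0 jet1. Qed.

Lemma jrotD A h h' k k' : A *m A *m A = - A ->
  jrot A (h + k) (h' + k') = jrot A h h' *m jrot A k k'.
Proof.
move=> A3; rewrite /jrot jetM -!(scalemxAl, scalemxAr) rotD//.
by rewrite !mulmxA -mulmx_rotC scalerDl addrC.
Qed.

Section UnitAxis.
Variables (A : 'M[R]_3) (A1 : rb A 1).

Lemma rb_sqr1 : rb (A *m A) 1.
Proof. by rewrite -[X in rb _ X]mul1r; exact: rbM. Qed.

Lemma rb_rot t : rb (rot A t) 4.
Proof.
have s := sin_bound t.
have h1 : rb (sin t *: A) 1.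
  by apply: rbW (rbZ _ A1); rewrite mulr1 ler_norml sin_geN1 sin_le1.
have h2 : rb ((1 - cos t) *: (A *m A)) 2.
  apply: rbW (rbZ _ rb_sqr1); rewrite mulr1 ler_norml.
  by have := cos_geN1 t; have := cos_le1 t; lra.
apply: rbW (rbD (rbD (@rb1 R 3) h1) h2); lra.
Qed.

Lemma rb_rotB s t : rb (rot A s - rot A t) (2 * `|s - t|).
Proof.
have -> : rot A s - rot A t = (sin s - sin t) *: A - (cos s - cos t) *: (A *m A).
  by apply/matrixP => i j; rewrite !mxE; set B := \sum_i0 _; ring.
apply: rbW (rbB (rbZ _ A1) (rbZ _ rb_sqr1)).
by have := sin_lip t s; have := cos_lip t s; lra.
Qed.

Lemma rb_rotB1 t : rb (rot A t - 1%:M) (2 * `|t|).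
Proof. by have := rb_rotB t 0; rewrite rot0 subr0. Qed.

Lemma rb_rotB2 t : rb (rot A t - 1%:M - t *: A) (2 * t ^+ 2).
Proof.
have -> : rot A t - 1%:M - t *: A = (sin t - t) *: A + (1 - cos t) *: (A *m A).
  by apply/matrixP => i j; rewrite !mxE; set B := \sum_i0 _; ring.
apply: rbW (rbD (rbZ _ A1) (rbZ _ rb_sqr1)).
by have := sin_bound2 t; have := cos_bound2 t; lra.
Qed.

Lemma rb_jrot h h' : rb (jrot A h h') (4 + `|h'| * 4).
Proof.
apply: rb_jet; first exact: rb_rot.
by apply: rbZ; rewrite -[X in rb _ X]mul1r; apply: rbM => //; exact: rb_rot.
Qed.

Lemma rb_jrotB h h' k k' :
  rb (jrot A h h' - jrot A k k') (2 * `|h - k| + (`|h' - k'| * 4 + `|k'| * (2 * `|h - k|))).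
Proof.
rewrite /jrot jetN jetD; apply: rb_jet; first exact: rb_rotB.
have -> : h' *: (A *m rot A h) + - (k' *: (A *m rot A k)) =
   (h' - k') *: (A *m rot A h) + k' *: (A *m (rot A h - rot A k)).
  by rewrite scalerBl mulmxBr scalerBr addrA subrK.
apply: rbD; apply: rbZ; rewrite -[X in rb _ X]mul1r; apply: rbM => //.
  exact: rb_rot.
by apply: rb_rotB.
Qed.

(** The derivative at [t = 0] of the jet of [w |-> rot A (t * h w)]. *)
Definition hat (A : 'M[R]_3) (h h' : R) := jet (h *: A) (h' *: A).

Lemma rb_jrot_tangent (t h h' H : R) : `|h| <= H -> `|h'| <= H ->
  rb (jrot A (t * h) (t * h') - 1%:M) (6 * H * `|t|) /\
  rb (jrot A (t * h) (t * h') - 1%:M - t *: hat A h h') (4 * H ^+ 2 * t ^+ 2).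
Proof.
move=> hH h'H; have H0 : 0 <= H by exact: le_trans hH.
have t0 := normr_ge0 t.
have th : `|t * h| <= H * `|t| by rewrite normrM mulrC ler_wpM2r.
have th' : `|t * h'| <= H * `|t| by rewrite normrM mulrC ler_wpM2r.
split.
  rewrite -jet1 jetN jetD oppr0 addr0.
  have -> : 6 * H * `|t| = 2 * H * `|t| + H * `|t| * 4 by ring.
  apply: rb_jet; first by apply: rbW (rb_rotB1 _); rewrite -mulrA ler_wpM2l.
  apply: (@rbW _ _ _ _ (`|t * h'| * 4)); first by rewrite ler_wpM2r.
  by apply: rbZ; rewrite -[X in rb _ X]mul1r; apply: rbM => //; exact: rb_rot.
rewrite -jet1 jetN jetD /hat jetZ jetN jetD oppr0 addr0 !scalerA.
have tH : (H * `|t|) ^+ 2 = H ^+ 2 * t ^+ 2 by rewrite exprMn real_normK ?num_real.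
have -> : 4 * H ^+ 2 * t ^+ 2 = 2 * (H ^+ 2 * t ^+ 2) + 2 * (H ^+ 2 * t ^+ 2) by ring.
rewrite -tH; apply: rb_jet.
  apply: rbW (rb_rotB2 _); rewrite ler_wpM2l// -(real_normK (num_real (t * h))).
  by rewrite lerXn2r ?nnegrE// (le_trans _ th).
have -> : (t * h') *: (A *m rot A (t * h)) - (t * h') *: A =
    (t * h') *: (A *m (rot A (t * h) - 1%:M)) by rewrite mulmxBr mulmx1 scalerBr.
apply: (@rbW _ _ _ _ (`|t * h'| * (2 * `|t * h|))).
  rewrite mulrCA ler_wpM2l// expr2; exact: ler_pM.
apply: rbZ; rewrite -[X in rb _ X]mul1r; apply: rbM => //.
exact: rb_rotB1.
Qed.

End UnitAxis.

Lemma rb_Omega_x : rb (Omega_x : 'M[R]_3) 1.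
Proof.
by case=> [[|[|[|//]]] ?]; rewrite sum3 !mxE /= ?normr0 ?normrN ?normr1; lra.
Qed.

Lemma rb_Omega_y : rb (Omega_y : 'M[R]_3) 1.
Proof.
by case=> [[|[|[|//]]] ?]; rewrite sum3 !mxE /= ?normr0 ?normrN ?normr1; lra.
Qed.

Lemma rb_Omega_z : rb (Omega_z : 'M[R]_3) 1.
Proof.
by case=> [[|[|[|//]]] ?]; rewrite sum3 !mxE /= ?normr0 ?normrN ?normr1; lra.
Qed.

Lemma rb_pulse_axis k : rb (pulse_axis k : 'M[R]_3) 1.
Proof. by case: k; [exact: rb_Omega_x|exact: rb_Omega_y]. Qed.

(** The derivative of [flow s], see [smooth_flow]. *)
Fixpoint dflow (s : seq (@pulse R)) (w : R) : 'M[R]_3 :=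
  if s is p :: s' then
    rot (pulse_axis p.2.1) p.2.2 *m (rot Omega_z (w * p.1) *m dflow s' w
      + p.1 *: (Omega_z *m rot Omega_z (w * p.1)) *m flow s' w)
  else 0.

Definition jflow s w := jet (flow s w) (dflow s w).

Lemma jflow_nil w : jflow [::] w = 1%:M. Proof. exact: jet1. Qed.

Lemma jflow_cons p s w : jflow (p :: s) w =
  jrot (pulse_axis p.2.1) p.2.2 0 *m (jrot Omega_z (w * p.1) p.1 *m jflow s w).
Proof. by rewrite /jflow /jrot !jetM scale0r mul0mx addr0. Qed.

Lemma jflow_cat s1 s2 w : jflow (s1 ++ s2) w = jflow s1 w *m jflow s2 w.
Proof.
elim: s1 => [|p s1 ih]; first by rewrite jflow_nil mul1mx.
by rewrite cat_cons !jflow_cons ih !mulmxA.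
Qed.

End Jets.

(** * Jets approximated by impulsive controls *)

Section Reach.
Context {R : realType} (K : R).

Definition close (J J' : R -> 'M[R]_(3 + 3)) e := forall w, `|w| <= K -> rb (J w - J' w) e.

(** Approximation in the [C^1] topology on [[- K, K]], as jets record the derivative. *)
Definition reach (J : R -> 'M[R]_(3 + 3)) := forall e : R, 0 < e ->
  exists s, all (fun p => 0 < p.1) s /\ close (jflow s) J e.

Lemma jflow_bounded s : exists2 C : R, 0 <= C & forall w, `|w| <= K -> rb (jflow s w) C.
Proof.
elim: s => [|p s [C C0 hC]].
  by exists 1 => // w _; rewrite jflow_nil; exact: rb1.
exists ((4 + `|(0 : R)| * 4) * ((4 + `|p.1| * 4) * C)) => [|w wK].
  by rewrite mulr_ge0 ?mulr_ge0 ?addr_ge0 ?mulr_ge0.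
rewrite jflow_cons; apply: rbM; first by rewrite mulr_ge0 ?addr_ge0 ?mulr_ge0.
  exact: rb_jrot (rb_pulse_axis _) _ _.
by apply: rbM => //; [exact: rb_jrot rb_Omega_z _ _|exact: hC].
Qed.

Lemma reach_bounded J : reach J ->
  exists2 C : R, 0 <= C & forall w, `|w| <= K -> rb (J w) C.
Proof.
move=> /(_ 1 ltr01)[s [_ hs]]; have [C C0 hC] := jflow_bounded s.
exists (C + 1) => [|w wK]; first by rewrite addr_ge0.
have -> : J w = jflow s w - (jflow s w - J w) by rewrite opprB addrC subrK.
by apply: rbB; [exact: hC|exact: hs].
Qed.

Lemma reach_closed J : (forall e : R, 0 < e -> exists2 J', reach J' & close J' J e) -> reach J.
Proof.
move=> h e e0; have e2 : 0 < e / 2 by exact: divr_gt0.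
have [J' rJ' cJ'] := h _ e2; have [s [ps hs]] := rJ' _ e2.
exists s; split => // w wK; rewrite [e]splitr.
have -> : jflow s w - J w = (jflow s w - J' w) + (J' w - J w) by rewrite addrA subrK.
by apply: rbD; [exact: hs|exact: cJ'].
Qed.

Lemma eq_reach J J' : (forall w, J w = J' w) -> reach J -> reach J'.
Proof. by move=> /funext ->. Qed.

Lemma reach_jflow s : all (fun p => 0 < p.1) s -> reach (jflow s).
Proof.
move=> ps e e0; exists s; split => // w _; rewrite subrr.
by apply: rbW (@rb0 _ _ _); exact: ltW.
Qed.

Lemma reach1 : reach (fun=> 1%:M).
Proof. by apply: eq_reach (@reach_jflow [::] isT) => w; exact: jflow_nil. Qed.

(** Concatenation of pulse sequences: [reach] is stable under products because
    [jflow] is a morphism and reachable jets are bounded. *)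
Lemma reachM J1 J2 : reach J1 -> reach J2 -> reach (fun w => J1 w *m J2 w).
Proof.
move=> r1 r2 e e0.
have [C1 C10 h1] := reach_bounded r1; have [C2 C20 h2] := reach_bounded r2.
pose e1 := Num.min 1 (e / (2 * (C2 + 1))).
pose e2 := e / (2 * (C1 + 1)).
have e10 : 0 < e1 by rewrite lt_min ltr01/= divr_gt0// mulr_gt0//; lra.
have e20 : 0 < e2 by rewrite divr_gt0// mulr_gt0//; lra.
have [s1 [p1 c1]] := r1 _ e10; have [s2 [p2 c2]] := r2 _ e20.
exists (s1 ++ s2); split; first by rewrite all_cat p1.
move=> w wK; rewrite jflow_cat.
have -> : jflow s1 w *m jflow s2 w - J1 w *m J2 w =
   (jflow s1 w - J1 w) *m J2 w + jflow s1 w *m (jflow s2 w - J2 w).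
  by rewrite mulmxBl mulmxBr [RHS]addrC addrA subrK.
have b1 : rb (jflow s1 w) (C1 + 1).
  have -> : jflow s1 w = J1 w + (jflow s1 w - J1 w) by rewrite addrC subrK.
  apply: rbD; first exact: h1.
  by apply: rbW (c1 _ wK); rewrite ge_min lexx.
apply: rbW (rbD (rbM C20 (c1 _ wK) (h2 _ wK)) (rbM (ltW e20) b1 (c2 _ wK))).
have : e1 * C2 <= e / 2.
  have : e1 <= e / (2 * (C2 + 1)) by rewrite ge_min lexx orbT.
  by rewrite ler_pdivlMr ?mulr_gt0//; nra.
have -> : (C1 + 1) * e2 = e / 2 by rewrite /e2; field; lra.
lra.
Qed.

Lemma reach_mxpow J k : reach J -> reach (fun w => mxpow (J w) k).
Proof.
by move=> rJ; elim: k => [|k ih] /=; [exact: reach1|exact: reachM].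
Qed.

End Reach.

Section ReachCone.
Context {R : realType} (K : R).

Lemma rot_conj (A C C' : 'M[R]_3) t : C *m C' = 1%:M -> C' *m C = 1%:M ->
  C *m rot A t *m C' = rot (C *m A *m C') t.
Proof.
move=> CC' C'C; rewrite /rot !(mulmxDl, mulmxDr, mulmx1) -!(scalemxAl, scalemxAr) CC'.
by congr (_ + _ *: _); rewrite !mulmxA -[_ *m C' *m C]mulmxA C'C mulmx1.
Qed.

Lemma rotK (A : 'M[R]_3) t : A *m A *m A = - A -> rot A t *m rot A (- t) = 1%:M.
Proof. by move=> A3; rewrite -rotD// subrr rot0. Qed.

Lemma rotN (A : 'M[R]_3) t : rot (- A) t = rot A (- t).
Proof. by rewrite /rot sinN cosN mulmxN mulNmx opprK scalerN scaleNr. Qed.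

Lemma jrotN (A : 'M[R]_3) h h' : jrot (- A) h h' = jrot A (- h) (- h').
Proof. by rewrite /jrot rotN mulNmx scalerN scaleNr. Qed.

Lemma jrot_conj (A B : 'M[R]_3) s h h' : B *m B *m B = - B ->
  jrot B s 0 *m jrot A h h' *m jrot B (- s) 0 =
  jrot (rot B s *m A *m rot B (- s)) h h'.
Proof.
move=> B3; have i1 := rotK s B3; have i2 : rot B (- s) *m rot B s = 1%:M.
  by have := rotK (- s) B3; rewrite opprK.
rewrite /jrot !scale0r !jetM !mul0mx !mulmx0 !addr0 add0r; congr jet.
  exact: rot_conj.
rewrite -scalemxAr -scalemxAl -(rot_conj _ _ i1 i2) !mulmxA.
by rewrite -[_ *m rot B (- s) *m rot B s]mulmxA i2 mulmx1.
Qed.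

Lemma reach_conj (A B : 'M[R]_3) s (h h' : R -> R) : B *m B *m B = - B ->
  (forall t, reach K (fun=> jrot B t 0)) ->
  reach K (fun w => jrot A (h w) (h' w)) ->
  reach K (fun w => jrot (rot B s *m A *m rot B (- s)) (h w) (h' w)).
Proof.
move=> B3 rB rA; have := reachM (reachM (rB s) rA) (rB (- s)).
by apply: eq_reach => w; rewrite jrot_conj.
Qed.

(** A jump without free evolution: a limit of pulses whose delay tends to zero. *)
Lemma reach_pulse k beta : reach K (fun=> jrot (pulse_axis k) beta 0).
Proof.
apply: reach_closed => e e0.
pose H := `|K| + 1; have H0 : 0 < H by rewrite ltr_pwDr.
pose tau := e / (24 * H).
have tau0 : 0 < tau by rewrite divr_gt0// mulr_gt0.
exists (jflow [:: (tau, (k, beta))]).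
  by apply: reach_jflow; rewrite /= tau0.
move=> w wK; rewrite jflow_cons jflow_nil mulmx1 /=.
rewrite -[X in _ - X]mulmx1 -mulmxBr.
have [||+ _] := @rb_jrot_tangent _ _ rb_Omega_z tau w 1 H.
- by apply: le_trans wK _; rewrite /H; have := ler_norm K; lra.
- by rewrite normr1 /H; have := normr_ge0 K; lra.
rewrite [tau * w]mulrC mulr1 => h.
have := rbM _ (rb_jrot (rb_pulse_axis k) beta 0) h; rewrite normr0 mul0r addr0.
have -> : 4 * (6 * H * `|tau|) = e.
  by rewrite gtr0_norm// /tau; field; exact: lt0r_neq0.
by apply; rewrite !mulr_ge0// ltW.
Qed.

Lemma Omega_z_flip : rot Omega_x pi *m Omega_z *m rot Omega_x (- pi) = - Omega_z :> 'M[R]_3.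
Proof.
rewrite /rot sinN cosN sinpi cospi oppr0 !scale0r addr0.
apply/matrixP => i j; rewrite !(mulmx3E, mxE).
by case: i => [[|[|[|//]]] ?]; case: j => [[|[|[|//]]] ?] /=; ring.
Qed.

(** A half-turn about the x axis reverses the free evolution. *)
Lemma reach_z tau : reach K (fun w => jrot Omega_z (w * tau) tau).
Proof.
have pos t : 0 < t -> reach K (fun w => jrot Omega_z (w * t) t).
  move=> t0; apply: eq_reach (@reach_jflow _ K [:: (t, (true, 0))] _) => [w|].
    by rewrite jflow_cons jflow_nil mulmx1 jrot0 mul1mx.
  by rewrite /= t0.
have [tau0|tau0|->] := ltgtP tau 0; last 1 first.
- by apply: eq_reach (@reach1 _ K) => w; rewrite mulr0 jrot0.
- have nt0 : 0 < - tau by rewrite oppr_gt0.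
  have := reach_conj pi Omega_x3 (reach_pulse true) (pos _ nt0).
  rewrite Omega_z_flip; apply: eq_reach => w.
  by rewrite jrotN mulrN !opprK.
- exact: pos.
Qed.

(** [tangent X]: up to second order in [t], [1 + t X] is reachable. *)
Definition tangent (X : R -> 'M[R]_(3 + 3)) := exists C d : R,
  [/\ 0 <= C, 0 < d & forall t : R, `|t| <= d -> exists2 J, reach K J &
    forall w, `|w| <= K -> rb (J w - 1%:M) (C * `|t|) /\
      rb (J w - 1%:M - t *: X w) (C * t ^+ 2)].

Lemma eq_tangent X Y : (forall w, X w = Y w) -> tangent X -> tangent Y.
Proof. by move=> /funext ->. Qed.

(** Products of approximations add up their tangents to first order. *)
Lemma tangentD X Y : tangent X -> tangent Y -> tangent (fun w => X w + Y w).
Proof.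
move=> [C1 [d1 [C10 d10 h1]]] [C2 [d2 [C20 d20 h2]]].
exists (C1 * C2 + C1 + C2), (Num.min 1 (Num.min d1 d2)); split.
- by rewrite !addr_ge0// mulr_ge0.
- by rewrite !lt_min ltr01 d10 d20.
move=> t; rewrite !le_min => /and3P[t1 td1 td2].
have [J1 r1 k1] := h1 _ td1; have [J2 r2 k2] := h2 _ td2.
exists (fun w => J1 w *m J2 w); first exact: reachM.
move=> w wK; have [a1 b1] := k1 _ wK; have [a2 b2] := k2 _ wK.
have t0 := normr_ge0 t.
have tt : t ^+ 2 = `|t| * `|t| by rewrite -expr2 real_normK ?num_real.
have C2t : 0 <= C2 * `|t| by rewrite mulr_ge0.
have C12 : 0 <= C1 * C2 by rewrite mulr_ge0.
split.
  have -> : J1 w *m J2 w - 1%:M = (J1 w - 1%:M) *m (J2 w - 1%:M) + (J1 w - 1%:M) + (J2 w - 1%:M).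
    by rewrite mulmxBl !mulmxBr !mul1mx !mulmx1; apply/matrixP => i j; rewrite !mxE; ring.
  apply: rbW (rbD (rbD (rbM C2t a1 a2) a1) a2).
  have : C1 * `|t| * (C2 * `|t|) <= C1 * C2 * `|t|.
    have -> : C1 * `|t| * (C2 * `|t|) = C1 * C2 * (`|t| * `|t|) by ring.
    by rewrite ler_wpM2l// -[leRHS]mulr1 ler_wpM2l.
  by rewrite !mulrDl; lra.
have -> : J1 w *m J2 w - 1%:M - t *: (X w + Y w) = (J1 w - 1%:M) *m (J2 w - 1%:M)
   + (J1 w - 1%:M - t *: X w) + (J2 w - 1%:M - t *: Y w).
  rewrite mulmxBl !mulmxBr !mul1mx !mulmx1; apply/matrixP => i j; rewrite !mxE.
  by set Z := \sum_j0 _; ring.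
apply: rbW (rbD (rbD (rbM C2t a1 a2) b1) b2).
by rewrite tt; lra.
Qed.

Lemma tangentZ c X : tangent X -> tangent (fun w => c *: X w).
Proof.
move=> [C [d [C0 d0 h]]].
have c0 := normr_ge0 c.
have cc : c ^+ 2 = `|c| * `|c| by rewrite -expr2 real_normK ?num_real.
exists (C * (`|c| + c ^+ 2)), (d / (`|c| + 1)); split.
- by rewrite mulr_ge0// addr_ge0// sqr_ge0.
- by rewrite divr_gt0// ltr_wpDl.
move=> t; rewrite ler_pdivlMr ?ltr_wpDl// => td.
have t0 := normr_ge0 t.
have [|J rJ hJ] := h (c * t).
  by rewrite normrM; apply: le_trans td; rewrite mulrC ler_wpM2l// lerDl.
exists J => // w /hJ[a b]; split.
  apply: rbW a; rewrite normrM -mulrA ler_wpM2l// mulrDl lerDl.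
  by rewrite mulr_ge0// sqr_ge0.
rewrite scalerA [t * c]mulrC; apply: rbW b.
rewrite exprMn -mulrA ler_wpM2l// mulrDl lerDr.
by rewrite mulr_ge0// sqr_ge0.
Qed.

Lemma tangent_conj A B X : reach K A -> reach K B ->
  (forall w, A w *m B w = 1%:M) -> tangent X ->
  tangent (fun w => A w *m X w *m B w).
Proof.
move=> rA rB AB [C [d [C0 d0 h]]].
have [a a0 ha] := reach_bounded rA; have [b b0 hb] := reach_bounded rB.
exists (a * C * b), d; split => //; first by rewrite !mulr_ge0.
move=> t /h[J rJ hJ]; exists (fun w => A w *m J w *m B w).
  by apply: reachM => //; exact: reachM.
move=> w wK; have [h1 h2] := hJ _ wK; have {}ha := ha _ wK; have {}hb := hb _ wK.
have t0 : 0 <= C * `|t| by rewrite mulr_ge0.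
have t2 : 0 <= C * t ^+ 2 by rewrite mulr_ge0// sqr_ge0.
split.
  have -> : A w *m J w *m B w - 1%:M = A w *m (J w - 1%:M) *m B w.
    by rewrite mulmxBr mulmxBl mulmx1 AB.
  by apply: rbW (rbM b0 (rbM t0 ha h1) hb); rewrite le_eqVlt; apply/orP; left; apply/eqP; ring.
have -> : A w *m J w *m B w - 1%:M - t *: (A w *m X w *m B w)
    = A w *m (J w - 1%:M - t *: X w) *m B w.
  by rewrite !mulmxBr !mulmxBl mulmx1 AB -scalemxAr -scalemxAl.
by apply: rbW (rbM b0 (rbM t2 ha h2) hb); rewrite le_eqVlt; apply/orP; left; apply/eqP; ring.
Qed.

(** Euler's scheme: the one-parameter group [Q] generated by a tangent field is
    the limit of the [n]-th powers of reachable approximations of [Q (1 / n)]. *)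
Lemma tangent_exp X (Q : R -> R -> 'M[R]_(3 + 3)) (C : R) : tangent X -> 0 <= C ->
  (forall w, Q 0 w = 1%:M) ->
  (forall s t w, Q (s + t) w = Q s w *m Q t w) ->
  (forall t w, `|w| <= K -> rb (Q t w - 1%:M) (C * `|t|) /\
      rb (Q t w - 1%:M - t *: X w) (C * t ^+ 2)) ->
  reach K (Q 1).
Proof.
move=> [C1 [d [C10 d0 h]]] C0 Q0 QD hQ; apply: reach_closed => e e0.
pose C2 := C1 + C; have C20 : 0 <= C2 by rewrite addr_ge0.
(* The step [1 / n] must be at most [d], and the global error at most
   [C2 * expR C2 / n]. *)
pose n := (Num.truncn (d^-1 + C2 * expR C2 / e)).+1.
have n0 : (0 : R) < n%:R by rewrite ltr0n.
have nn : d^-1 + C2 * expR C2 / e < n%:R by exact: truncnS_gt.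
have X0 : 0 <= C2 * expR C2 / e by rewrite divr_ge0 ?mulr_ge0 ?expR_ge0// ltW.
have dV : 0 < d^-1 by rewrite invr_gt0.
have td : `|n%:R^-1| <= d.
  rewrite ger0_norm ?invr_ge0// -[d]invrK lef_pV2 ?posrE//; lra.
have [J rJ hJ] := h _ td.
exists (fun w => mxpow (J w) n); first exact: reach_mxpow.
move=> w wK; have [a1 b1] := hJ _ wK; have [a2 b2] := hQ n%:R^-1 _ wK.
have QE k : mxpow (Q n%:R^-1 w) k = Q (k%:R / n%:R) w.
  elim: k => [|k ih] /=; first by rewrite mul0r Q0.
  by rewrite ih -QD -natr1; congr (Q _ w); field; exact: lt0r_neq0.
have -> : Q 1 w = mxpow (Q n%:R^-1 w) n by rewrite QE divff// gt_eqF.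
pose r := 1 + C2 / n%:R.
have Cn : 0 <= C2 / n%:R by rewrite divr_ge0// ltW.
have r1 : 1 <= r by rewrite /r lerDl.
have nV : `|n%:R^-1 : R| = n%:R^-1 by rewrite ger0_norm ?invr_ge0// ltW.
have bnd (M : 'M[R]_(3 + 3)) c : c <= C2 -> rb (M - 1%:M) (c * `|n%:R^-1|) -> rb M r.
  move=> cC hM; have -> : M = 1%:M + (M - 1%:M) by rewrite addrC subrK.
  apply: rbD; first exact: rb1.
  by apply: rbW hM; rewrite nV ler_wpM2r// invr_ge0 ltW.
have diff : rb (J w - Q n%:R^-1 w) (C2 * n%:R^-1 ^+ 2).
  have -> : J w - Q n%:R^-1 w = (J w - 1%:M - n%:R^-1 *: X w) - (Q n%:R^-1 w - 1%:M - n%:R^-1 *: X w).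
    by apply/matrixP => i j; rewrite !mxE; ring.
  by rewrite /C2 mulrDl; exact: rbB.
have e1 : 0 <= C2 * n%:R^-1 ^+ 2 by rewrite mulr_ge0// sqr_ge0.
apply: rbW (rb_mxpowB n r1 e1 (bnd _ _ _ a1) (bnd _ _ _ a2) diff); last 2 first.
- by rewrite lerDl.
- by rewrite lerDr.
have rn : r ^+ n <= expR C2.
  have -> : expR C2 = expR (C2 / n%:R) ^+ n.
    by rewrite -expRM_natl mulrCA divff ?mulr1// gt_eqF.
  by rewrite lerXn2r ?nnegrE ?expR_ge0 ?expR_ge1Dx//; lra.
have -> : n%:R * (C2 * n%:R^-1 ^+ 2) = C2 / n%:R by field; exact: lt0r_neq0.
apply: le_trans (ler_wpM2l Cn rn) _.
rewrite mulrAC ler_pdivrMr//.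
have : C2 * expR C2 / e <= n%:R by lra.
by rewrite ler_pdivrMr// [n%:R * e]mulrC.
Qed.

End ReachCone.

(** * Rotations by polynomial angles *)

Section Axes.
Context {R : realType}.

Lemma rot_zE (t : R) : rot Omega_z t =
  mx3 [:: [:: cos t; - sin t; 0]; [:: sin t; cos t; 0]; [:: 0; 0; 1]].
Proof.
rewrite /rot; apply/matrixP => i j; rewrite !(mulmx3E, mxE).
by case: i => [[|[|[|//]]] ?]; case: j => [[|[|[|//]]] ?] /=; ring.
Qed.

Lemma rot_xE (t : R) : rot Omega_x t =
  mx3 [:: [:: 1; 0; 0]; [:: 0; cos t; - sin t]; [:: 0; sin t; cos t]].
Proof.
rewrite /rot; apply/matrixP => i j; rewrite !(mulmx3E, mxE).
by case: i => [[|[|[|//]]] ?]; case: j => [[|[|[|//]]] ?] /=; ring.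
Qed.

Lemma rot_yE (t : R) : rot Omega_y t =
  mx3 [:: [:: cos t; 0; sin t]; [:: 0; 1; 0]; [:: - sin t; 0; cos t]].
Proof.
rewrite /rot; apply/matrixP => i j; rewrite !(mulmx3E, mxE).
by case: i => [[|[|[|//]]] ?]; case: j => [[|[|[|//]]] ?] /=; ring.
Qed.

Lemma conj_z_x (t : R) : rot Omega_z t *m Omega_x *m rot Omega_z (- t) =
  cos t *: Omega_x + sin t *: Omega_y.
Proof.
rewrite ?rot_zE ?rot_xE sinN cosN; have := cos2Dsin2 t; move: (cos t) (sin t) => c s cs.
apply/matrixP => i j; rewrite !(mulmx3E, mxE).
by case: i => [[|[|[|//]]] ?]; case: j => [[|[|[|//]]] ?] /=; nra.
Qed.

Lemma conj_z_y (t : R) : rot Omega_z t *m Omega_y *m rot Omega_z (- t) =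
  cos t *: Omega_y + (- sin t) *: Omega_x.
Proof.
rewrite ?rot_zE ?rot_xE sinN cosN; have := cos2Dsin2 t; move: (cos t) (sin t) => c s cs.
apply/matrixP => i j; rewrite !(mulmx3E, mxE).
by case: i => [[|[|[|//]]] ?]; case: j => [[|[|[|//]]] ?] /=; nra.
Qed.

Lemma conj_x_y (t : R) : rot Omega_x t *m Omega_y *m rot Omega_x (- t) =
  cos t *: Omega_y + sin t *: Omega_z.
Proof.
rewrite ?rot_zE ?rot_xE sinN cosN; have := cos2Dsin2 t; move: (cos t) (sin t) => c s cs.
apply/matrixP => i j; rewrite !(mulmx3E, mxE).
by case: i => [[|[|[|//]]] ?]; case: j => [[|[|[|//]]] ?] /=; nra.
Qed.

Lemma bracket_z_x : Omega_z *m Omega_x - Omega_x *m Omega_z = Omega_y :> 'M[R]_3.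
Proof.
apply/matrixP => i j; rewrite !(mulmx3E, mxE).
by case: i => [[|[|[|//]]] ?]; case: j => [[|[|[|//]]] ?] /=; ring.
Qed.

Lemma bracket_z_y : Omega_z *m Omega_y - Omega_y *m Omega_z = - Omega_x :> 'M[R]_3.
Proof.
apply/matrixP => i j; rewrite !(mulmx3E, mxE).
by case: i => [[|[|[|//]]] ?]; case: j => [[|[|[|//]]] ?] /=; ring.
Qed.

Lemma bracket_linear (A B Z : 'M[R]_3) (c s : R) :
  Z *m (c *: A + s *: B) - (c *: A + s *: B) *m Z =
  c *: (Z *m A - A *m Z) + s *: (Z *m B - B *m Z).
Proof.
rewrite mulmxDr mulmxDl -!(scalemxAl, scalemxAr) !scalerBr.
by rewrite opprD addrACA.
Qed.

(** Conjugation by the free evolution turns the axis by an angle proportional to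
    [w]; the commutator is the derivative of the turning axis. *)
Lemma jet_conj_z (A : 'M[R]_3) (t tau h h' : R) :
  let W := rot Omega_z t *m A *m rot Omega_z (- t) in
  jrot Omega_z t tau *m hat A h h' *m jrot Omega_z (- t) (- tau) =
  jet (h *: W) (h' *: W + (h * tau) *: (Omega_z *m W - W *m Omega_z)).
Proof.
rewrite /jrot /hat.
have hZ := mulmx_rotC (Omega_z : 'M[R]_3) t.
have hZ' := mulmx_rotC (Omega_z : 'M[R]_3) (- t).
move: (rot Omega_z t) (rot Omega_z (- t)) hZ hZ' => Z Z' hZ hZ'.
rewrite !jetM; congr jet; first by rewrite -scalemxAr -scalemxAl.
rewrite hZ' !mulmxDl -!(scalemxAl, scalemxAr) !mulmxA !scalerA scalerBr.
by rewrite mulNr scaleNr [h * tau]mulrC addrC addrA.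
Qed.

End Axes.

Section Trig.
Context {R : realType} (K : R).

(** The trigonometric coefficients: [h] such that [h Omega_x] and [h Omega_y]
    are both tangent; conjugation by the free evolution during [tau]
    rotates one into the other, so they are stable under multiplication by
    [sin (tau w)]. *)
Definition coef (h h' : R -> R) := forall k : bool,
  tangent K (fun w => hat (pulse_axis k) (h w) (h' w)).

Lemma eq_coef h h' k k' : (forall w, h w = k w) -> (forall w, h' w = k' w) ->
  coef h h' -> coef k k'.
Proof. by move=> /funext -> /funext ->. Qed.

Lemma coef1 : coef (fun=> 1) (fun=> 0).
Proof.
move=> k; exists 6, 1; split => // t _.
exists (fun=> jrot (pulse_axis k) t 0); first exact: reach_pulse.
move=> w _; have [||a b] := @rb_jrot_tangent _ _ (rb_pulse_axis k) t 1 0 1.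
- by rewrite normr1.
- by rewrite normr0.
rewrite mulr1 mulr0 mulr1 expr1n mulr1 in a b; split => //.
by apply: rbW b; have := sqr_ge0 t; lra.
Qed.

Lemma coefD h h' k k' : coef h h' -> coef k k' ->
  coef (fun w => h w + k w) (fun w => h' w + k' w).
Proof.
move=> ch ck b; apply: eq_tangent (tangentD (ch b) (ck b)) => w.
by rewrite /hat jetD !scalerDl.
Qed.

Lemma coefZ c h h' : coef h h' -> coef (fun w => c * h w) (fun w => c * h' w).
Proof.
move=> ch b; apply: eq_tangent (tangentZ c (ch b)) => w.
by rewrite /hat jetZ !scalerA.
Qed.

(** With [F tau] the conjugate by the free evolution during [tau], the difference
    [F tau - F (- tau)] keeps only the part of the turned axis that is odd in [tau],
    the one with the factor [sin (w * tau)]; it points along the other axis. *)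
Lemma coefM_sin tau h h' : coef h h' ->
  coef (fun w => h w * sin (w * tau)) (fun w => h' w * sin (w * tau) + h w * (tau * cos (w * tau))).
Proof.
move=> ch.
pose F (b : bool) tau' (w : R) := jrot Omega_z (w * tau') tau' *m
  hat (pulse_axis b) (h w) (h' w) *m jrot Omega_z (w * - tau') (- tau').
have tF b tau' : tangent K (F b tau').
  apply: tangent_conj (ch b); [exact: reach_z|exact: reach_z|].
  by move=> w; rewrite mulrN -jrotD ?Omega_z3// !subrr jrot0.
have FE b tau' w (c := cos (w * tau')) (s := sin (w * tau')) : F b tau' w =
  if b then jet (h w *: (c *: Omega_x + s *: Omega_y))
      (h' w *: (c *: Omega_x + s *: Omega_y)
       + (h w * tau') *: (c *: Omega_y + s *: (- Omega_x)))
  else jet (h w *: (c *: Omega_y + (- s) *: Omega_x))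
      (h' w *: (c *: Omega_y + (- s) *: Omega_x)
       + (h w * tau') *: (c *: (- Omega_x) + (- s) *: Omega_y)).
  rewrite /F mulrN jet_conj_z -/c -/s; case: b; rewrite /pulse_axis ?conj_z_x ?conj_z_y.
    by rewrite bracket_linear bracket_z_x bracket_z_y.
  by rewrite bracket_linear bracket_z_x bracket_z_y.
(* Half the difference [F b tau - F b (- tau)]. *)
have tG b := tangentZ 2^-1 (tangentD (tF b tau) (tangentZ (-1) (tF b (- tau)))).
case.
- apply: eq_tangent (tangentZ (-1) (tG false)) => w; rewrite !FE /= mulrN sinN cosN.
  rewrite /hat !(jetZ, jetD) /=; move: (Omega_x : 'M[R]_3) (Omega_y : 'M[R]_3) => X Y.
  by congr jet; apply/matrixP => i j; rewrite !mxE; field.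
- apply: eq_tangent (tG true) => w; rewrite !FE /= mulrN sinN cosN.
  rewrite /hat !(jetZ, jetD) /=; move: (Omega_x : 'M[R]_3) (Omega_y : 'M[R]_3) => X Y.
  by congr jet; apply/matrixP => i j; rewrite !mxE; field.
Qed.

(** Polynomials in [sin (s w) / s], which tends to [w] as [s] tends to [0]. *)
Lemma coef_poly (s : R) (p : {poly R}) : s != 0 ->
  coef (fun w => p.[sin (w * s) / s]) (fun w => p^`().[sin (w * s) / s] * cos (w * s)).
Proof.
move=> s0; elim/poly_ind: p => [|p c ih].
  apply: eq_coef (coefZ 0 coef1) => w; first by rewrite horner0 mul0r.
  by rewrite deriv0 horner0 !mul0r.
have := coefD (coefZ s^-1 (coefM_sin s ih)) (coefZ c coef1).
apply: eq_coef => w; first by rewrite hornerD hornerM hornerX hornerC; ring.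
by rewrite derivD derivM derivX derivC hornerD hornerD !hornerM hornerX !hornerC; field.
Qed.

Lemma reach_exp (h h' : R -> R) (H : R) k : coef h h' ->
  (forall w, `|w| <= K -> `|h w| <= H /\ `|h' w| <= H) ->
  reach K (fun w => jrot (pulse_axis k) (h w) (h' w)).
Proof.
move=> ch hH.
apply: eq_reach (@tangent_exp _ K _ (fun t w => jrot (pulse_axis k) (t * h w) (t * h' w))
  (6 * `|H| + 4 * `|H| ^+ 2) (ch k) _ _ _ _) => [w||w|s t w|t w wK].
- by rewrite !mul1r.
- by rewrite addr_ge0// mulr_ge0// sqr_ge0.
- by rewrite !mul0r jrot0.
- by rewrite !mulrDl jrotD// pulse_axis3.
have [h1 h2] := hH _ wK.
have hA (x : R) : `|x| <= H -> `|x| <= `|H| by move=> /le_trans; apply; exact: ler_norm.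
have [a b] := rb_jrot_tangent (rb_pulse_axis k) t (hA _ h1) (hA _ h2).
split; [apply: rbW a|apply: rbW b].
  by rewrite ler_wpM2r// lerDl mulr_ge0// sqr_ge0.
by rewrite ler_wpM2r ?sqr_ge0// lerDr mulr_ge0.
Qed.

(** The angles [p.[sin (w * s) / s]] are reachable by exponentiation and converge to
    [p.[w]], with their derivatives, as [s] tends to zero. *)
Lemma reach_poly_xy (p : {poly R}) k :
  reach K (fun w => jrot (pulse_axis k) p.[w] p^`().[w]).
Proof.
apply: reach_closed => e e0.
pose M : R := `|K| + 1; have M0 : 0 < M by rewrite ltr_pwDr.
have NM : - M <= M by lra.
have [P P0 hP] := continuous_itv_bounded NM (@continuous_horner R p).
have [Q Q0 hQ] := continuous_itv_bounded NM (@continuous_horner R p^`()).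
pose d : R := e / (8 + 6 * Q).
have d0 : 0 < d by rewrite divr_gt0//; lra.
have [d1 d10 h1] := compact_uniform_continuity (- M) M (@continuous_horner R p) d0.
have [d2 d20 h2] := compact_uniform_continuity (- M) M (@continuous_horner R p^`()) d0.
(* [|w - sin (w * s) / s| <= s * w ^+ 2] must be below [d] and below both moduli of
   continuity, and [s] itself makes [1 - cos (w * s)] small. *)
pose s : R := Num.min (Num.min 1 d) (Num.min d1 d2) / (2 * M ^+ 2).
have M2 : 1 <= M ^+ 2 by rewrite /M; have := normr_ge0 K; nra.
have s0 : 0 < s by rewrite divr_gt0 ?mulr_gt0 ?exprn_gt0// !lt_min ltr01 d0 d10 d20.
have sM : s * M ^+ 2 < Num.min (Num.min 1 d) (Num.min d1 d2).
  have -> : s * M ^+ 2 = Num.min (Num.min 1 d) (Num.min d1 d2) / 2.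
    by rewrite /s; field; rewrite ?expf_neq0// gt_eqF.
  rewrite ltr_pdivrMr// ltr_pMr ?ltr1n//.
  by rewrite !lt_min ltr01 d0 d10 d20.
move: sM; rewrite !lt_min => /andP[/andP[sM1 sMd] /andP[sMd1 sMd2]].
pose sg (w : R) : R := sin (w * s) / s.
have nearw (w : R) : `|w| <= K -> [/\ - M <= w <= M, `|w| <= M, `|w - sg w| <= s * M ^+ 2
    & - M <= sg w <= M].
  move=> wK; have KM : `|w| + 1 <= M by rewrite /M lerD2r; apply: le_trans wK (ler_norm _).
  have wM : `|w| <= M by lra.
  have c : `|w - sg w| <= s * w ^+ 2.
    have -> : w - sg w = - (sin (w * s) - w * s) / s.
      by rewrite /sg; field; exact: lt0r_neq0.
    rewrite normrM normrN [ `|s^-1| ]gtr0_norm ?invr_gt0// ler_pdivrMr//.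
    have -> : s * w ^+ 2 * s = (w * s) ^+ 2 by ring.
    exact: sin_bound2.
  have w2 : w ^+ 2 <= M ^+ 2 by rewrite -(real_normK (num_real w)) lerXn2r ?nnegrE// ltW.
  have c2 : `|w - sg w| <= s * M ^+ 2.
    by apply: le_trans c _; rewrite ler_wpM2l// ltW.
  split => //; first by rewrite -ler_norml.
  have : `|sg w| <= M.
    have -> : sg w = w - (w - sg w) by rewrite opprB addrC subrK.
    apply: le_trans (ler_normB _ _) _; lra.
  by rewrite ler_norml.
exists (fun w => jrot (pulse_axis k) p.[sg w] (p^`().[sg w] * cos (w * s))).
  apply: (@reach_exp _ _ (P + Q) k (coef_poly p (lt0r_neq0 s0))) => w /nearw[_ _ _ sgM].
  split; first by apply: le_trans (hP _ sgM) _; rewrite lerDl.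
  rewrite normrM; apply: (@le_trans _ _ (Q * 1)); last by rewrite mulr1 lerDr.
  by apply: ler_pM => //; [exact: hQ|rewrite ler_norml cos_geN1 cos_le1].
move=> w /nearw[wM wM' ws sgM].
have a1 : `|p.[sg w] - p.[w]| <= d.
  by rewrite distrC; apply/ltW/h1 => //; apply: le_lt_trans ws _.
have a2 : `|p^`().[sg w] - p^`().[w]| <= d.
  by rewrite distrC; apply/ltW/h2 => //; apply: le_lt_trans ws _.
have a3 : `|p^`().[sg w] * cos (w * s) - p^`().[w]| <= (1 + Q) * d.
  have -> : p^`().[sg w] * cos (w * s) - p^`().[w] =
    (p^`().[sg w] - p^`().[w]) * cos (w * s) - p^`().[w] * (1 - cos (w * s)) by ring.
  have -> : (1 + Q) * d = d + Q * d by ring.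
  apply: le_trans (ler_normB _ _) _; rewrite !normrM; apply: lerD.
    rewrite -[leRHS]mulr1; apply: ler_pM => //.
    by rewrite ler_norml cos_geN1 cos_le1.
  apply: ler_pM => //; first exact: hQ.
  apply: le_trans (cos_bound1 _) _; rewrite normrM [ `|s| ]gtr0_norm//.
  apply: le_trans (ltW sMd); rewrite mulrC ler_wpM2l ?(ltW s0)//.
  have M1 : 1 <= M by rewrite /M lerDr.
  by apply: le_trans wM' _; rewrite expr2 ler_peMr// ltW.
apply: rbW (rb_jrotB (rb_pulse_axis k) _ _ _ _).
have b2 : `|p^`().[w]| <= Q by exact: hQ.
have dE : d * (8 + 6 * Q) = e by rewrite /d divfK// gt_eqF//; lra.
have b3 : `|p^`().[w]| * (2 * `|p.[sg w] - p.[w]|) <= Q * (2 * d).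
  by apply: ler_pM => //; rewrite ?mulr_ge0// ler_wpM2l.
move: a1 a3 b3 dE d0; clear; nra.
Qed.

End Trig.

(** * The flow as an isometry, and its derivative *)

Section Isometry.
Context {R : realType}.
Implicit Types (x y : 'cV[R]_3) (A : 'M[R]_3).

Definition dot x y : R := \sum_i x i 0 * y i 0.

Lemma dotE x y : dot x y = (x^T *m y) 0 0.
Proof. by rewrite mxE; apply: eq_bigr => i _; rewrite mxE. Qed.

Lemma dotC x y : dot x y = dot y x.
Proof. by apply: eq_bigr => i _; rewrite mulrC. Qed.

Lemma dotDr x y z : dot x (y + z) = dot x y + dot x z.
Proof. by rewrite /dot -big_split; apply: eq_bigr => i _; rewrite mxE mulrDr. Qed.

Lemma dotDl x y z : dot (x + y) z = dot x z + dot y z.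
Proof. by rewrite dotC dotDr dotC [dot z y]dotC. Qed.

Lemma dotZr k x y : dot x (k *: y) = k * dot x y.
Proof. by rewrite /dot mulr_sumr; apply: eq_bigr => i _; rewrite mxE mulrCA. Qed.

Lemma dotZl k x y : dot (k *: x) y = k * dot x y.
Proof. by rewrite dotC dotZr dotC. Qed.

Lemma dot_ge0 x : 0 <= dot x x.
Proof. by apply: sumr_ge0 => i _; rewrite -expr2 sqr_ge0. Qed.

Lemma dot_le_sum x y : dot (x + y) (x + y) <= 2 * dot x x + 2 * dot y y.
Proof.
rewrite /dot !mulr_sumr -big_split/=; apply: ler_sum => i _.
by rewrite !mxE; have := sqr_ge0 (x i 0 - y i 0); nra.
Qed.

Lemma eucl_normE x : eucl_norm x ^+ 2 = dot x x.
Proof. by rewrite /eucl_norm sqr_sqrtr// sumr_ge0// => i _; exact: sqr_ge0. Qed.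

Section Skew.
Variables (A : 'M[R]_3) (A3 : A *m A *m A = - A) (AT : A^T = - A).

Lemma dot_skewl x y : dot (A *m x) y = - dot x (A *m y).
Proof. by rewrite !dotE trmx_mul AT mulmxN mulNmx mxE mulmxA. Qed.

Lemma dot_skew x : dot x (A *m x) = 0.
Proof. by have := dot_skewl x x; rewrite dotC; lra. Qed.

Lemma tr_rot t : (rot A t)^T = rot A (- t).
Proof.
rewrite /rot sinN cosN; do 2 rewrite linearD /=; rewrite trmx1 !linearZ /= trmx_mul AT.
by rewrite mulNmx mulmxN opprK scalerN scaleNr.
Qed.

Lemma dot_rot t x y : dot (rot A t *m x) (rot A t *m y) = dot x y.
Proof.
rewrite !dotE trmx_mul tr_rot !mulmxA -[_ *m rot A (- t) *m rot A t]mulmxA.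
by have := rotK (- t) A3; rewrite opprK => ->; rewrite mulmx1.
Qed.

End Skew.

Definition axis (i : 'I_3) : 'M[R]_3 :=
  if i == 0 :> nat then Omega_x else if i == 1%N :> nat then Omega_y else Omega_z.

Lemma axis3 i : axis i *m axis i *m axis i = - axis i.
Proof.
by rewrite /axis; case: ifP => _; [exact: Omega_x3|case: ifP => _; [exact: Omega_y3|exact: Omega_z3]].
Qed.

Lemma tr_axis i : (axis i)^T = - axis i.
Proof.
apply/matrixP => j k; rewrite /axis.
by case: ifP => _; last (case: ifP => _); rewrite !mxE;
  case: j => [[|[|[|//]]] ?]; case: k => [[|[|[|//]]] ?] /=; ring.
Qed.

Lemma dot_axis_le i x : dot (axis i *m x) (axis i *m x) <= dot x x.
Proof.
rewrite /dot !sum3 !mulmx3E /axis; set y := x ord0 0; set z := x (lift ord0 ord0) 0.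
set t := x (lift _ (lift _ _)) 0.
case: i => [[|[|[|//]]] ?]; rewrite !mxE /=;
  have := sqr_ge0 y; have := sqr_ge0 z; have := sqr_ge0 t; nra.
Qed.

(** Lagrange's identity: [axis i *m x] is the cross product of the [i]-th basis
    vector with [x]. *)
Lemma lagrange x y :
  \sum_i dot (axis i *m x) y ^+ 2 = dot x x * dot y y - dot x y ^+ 2.
Proof.
rewrite sum3 /dot !sum3 !mulmx3E /axis !mxE /=.
set x0 := x ord0 0; set x1 := x (lift ord0 ord0) 0; set x2 := x (lift _ (lift _ _)) 0.
set y0 := y ord0 0; set y1 := y (lift ord0 ord0) 0; set y2 := y (lift _ (lift _ _)) 0.
ring.
Qed.

Lemma pulse_axisE k : pulse_axis k = axis (if k then ord0 else lift ord0 ord0) :> 'M[R]_3.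
Proof. by case: k. Qed.

Lemma Omega_zE : Omega_z = axis (lift ord0 (lift ord0 ord0)) :> 'M[R]_3.
Proof. by []. Qed.

Lemma flow_cons p s w (x : 'cV[R]_3) : flow (p :: s) w *m x =
  rot (pulse_axis p.2.1) p.2.2 *m (rot Omega_z (w * p.1) *m (flow s w *m x)).
Proof. by rewrite /= !mulmxA. Qed.

Lemma dflow_cons p s w (x : 'cV[R]_3) : dflow (p :: s) w *m x =
  rot (pulse_axis p.2.1) p.2.2 *m (rot Omega_z (w * p.1) *m (dflow s w *m x)
    + p.1 *: (Omega_z *m (rot Omega_z (w * p.1) *m (flow s w *m x)))).
Proof. by rewrite /= -mulmxA mulmxDl -!scalemxAl !mulmxA. Qed.

Lemma flow_isometry s w x y : dot (flow s w *m x) (flow s w *m y) = dot x y.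
Proof.
elim: s => [|p s ih]; first by rewrite /= !mul1mx.
rewrite !flow_cons pulse_axisE dot_rot ?axis3 ?tr_axis//.
by rewrite Omega_zE dot_rot ?axis3 ?tr_axis.
Qed.

(** The derivative of a product of rotations is tangent to the sphere along the
    trajectory, so that it does not contribute. *)
Lemma flow_dot s w m g :
  dot (flow s w *m m) (flow s w *m g + dflow s w *m m) = dot m g.
Proof.
elim: s => [|p s ih]; first by rewrite /= !mul1mx mul0mx addr0.
rewrite flow_cons dflow_cons flow_cons -mulmxDr pulse_axisE dot_rot ?axis3 ?tr_axis//.
rewrite addrA dotDr dotZr Omega_zE dot_skew ?tr_axis// mulr0 addr0.
by rewrite -mulmxDr dot_rot ?axis3 ?tr_axis.
Qed.

Lemma flow_cat s1 s2 w : flow (s1 ++ s2) w = flow s1 w *m flow s2 w :> 'M[R]_3 /\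
  dflow (s1 ++ s2) w = flow s1 w *m dflow s2 w + dflow s1 w *m flow s2 w :> 'M[R]_3.
Proof.
have := jflow_cat s1 s2 w; rewrite /jflow jetM /jet => /eq_block_mx[h1 h2 _ _].
by split.
Qed.

End Isometry.

Section Smooth.
Context {R : realType}.

Definition smooth (A A' : R -> 'M[R]_3) := forall i j,
  (forall w, is_derive w (1 : R) (fun x => A x i j) (A' w i j)) /\
  continuous (fun x => A' x i j).

Lemma smoothM A A' B B' : smooth A A' -> smooth B B' ->
  smooth (fun w => A w *m B w) (fun w => A w *m B' w + A' w *m B w).
Proof.
move=> sA sB i j.
have cA i' j' : continuous (fun x => A x i' j') by exact: is_derive_continuous (sA i' j').1.
have cB i' j' : continuous (fun x => B x i' j') by exact: is_derive_continuous (sB i' j').1.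
split.
  move=> w; rewrite (_ : (fun x => _) = (fun x => A x i ord0 * B x ord0 j
     + A x i (lift ord0 ord0) * B x (lift ord0 ord0) j
     + A x i (lift ord0 (lift ord0 ord0)) * B x (lift ord0 (lift ord0 ord0)) j)); last first.
    by apply/funext => x; rewrite mulmx3E.
  have a0 := (sA i ord0).1 w; have b0 := (sB ord0 j).1 w.
  have a1 := (sA i (lift ord0 ord0)).1 w; have b1 := (sB (lift ord0 ord0) j).1 w.
  have a2 := (sA i (lift ord0 (lift ord0 ord0))).1 w.
  have b2 := (sB (lift ord0 (lift ord0 ord0)) j).1 w.
  apply: is_derive_eq; rewrite mxE !mulmx3E /GRing.scale/=; ring.
rewrite (_ : (fun x => _) = (fun x => \sum_k (A x i k * B' x k j + A' x i k * B x k j))).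
  have h (s : seq 'I_3) : continuous (fun x => \sum_(k <- s) (A x i k * B' x k j + A' x i k * B x k j)).
    elim: s => [|k s ih].
      rewrite (_ : (fun x => _) = fun=> 0); first exact: cst_continuous.
      by apply/funext => x; rewrite big_nil.
    rewrite (_ : (fun x => _) = (fun x => (A x i k * B' x k j + A' x i k * B x k j)
      + \sum_(k <- s) (A x i k * B' x k j + A' x i k * B x k j))).
      move=> x; apply: cvgD; last exact: ih.
      apply: cvgD; apply: cvgM; [exact: cA|exact: (sB _ _).2|exact: (sA _ _).2|exact: cB].
    by apply/funext => x; rewrite big_cons.
  exact: h.
by apply/funext => x; rewrite !mxE big_split.
Qed.

Lemma smooth_cst (A : 'M[R]_3) : smooth (fun=> A) (fun=> 0).
Proof.
move=> i j; split; last by rewrite mxE; exact: cst_continuous.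
by move=> w; rewrite mxE; exact: is_derive_cst.
Qed.

Lemma smooth_rotz tau : smooth (fun w => rot Omega_z (w * tau))
  (fun w => tau *: (Omega_z *m rot Omega_z (w * tau))).
Proof.
move=> i j.
have e : (fun w => (tau *: (Omega_z *m rot Omega_z (w * tau))) i j) =
   (fun w => tau * (cos (w * tau) * (Omega_z i j) + sin (w * tau) * (Omega_z *m Omega_z : 'M[R]_3) i j)).
  apply/funext => w; rewrite mxE; congr (_ * _).
  rewrite /rot !mulmxDr mulmx1 -!scalemxAr mulmxA Omega_z3.
  by move: (Omega_z *m Omega_z : 'M[R]_3) (Omega_z : 'M[R]_3) => Y X; rewrite !mxE; ring.
have ca : continuous (fun w : R => w * tau) by move=> w; apply: cvgMl; exact: cvg_id.
have da (w : R) : is_derive w (1 : R) (fun x => x * tau) tau.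
  by apply: is_derive_eq; rewrite /GRing.scale/=; ring.
have ds (w : R) : is_derive w (1 : R) (fun x => sin (x * tau)) (tau * cos (w * tau)).
  have := @is_derive1_comp R sin (fun x => x * tau) w _ _ (is_derive_sin _) (da w).
  by rewrite mulrC.
have dc (w : R) : is_derive w (1 : R) (fun x => cos (x * tau)) (- (tau * sin (w * tau))).
  have := @is_derive1_comp R cos (fun x => x * tau) w _ _ (is_derive_cos _) (da w).
  by rewrite mulNr mulrC.
split; last first.
  rewrite e => w; apply: cvgMr; apply: cvgD; apply: cvgMl.
    exact: (is_derive_continuous dc).
  exact: (is_derive_continuous ds).
move=> w; have := congr1 (fun f => f w) e => /= ->.
rewrite (_ : (fun x => _) = (fun x => (1%:M : 'M[R]_3) i j + sin (x * tau) * (Omega_z i j)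
   + (1 - cos (x * tau)) * (Omega_z *m Omega_z : 'M[R]_3) i j)); last first.
  apply/funext => x; rewrite /rot.
  by move: (Omega_z *m Omega_z : 'M[R]_3) (Omega_z : 'M[R]_3) => Y X; rewrite !mxE.
have := ds w; have := dc w => h1 h2.
by apply: is_derive_eq; rewrite /GRing.scale/=; ring.
Qed.

Lemma smooth_flow s : smooth (flow s) (dflow s).
Proof.
elim: s => [|p s ih]; first exact: smooth_cst.
have := smoothM (smooth_cst (rot (pulse_axis p.2.1) p.2.2)) (smoothM (smooth_rotz p.1) ih).
congr smooth; apply/funext => w; rewrite mul0mx addr0//.
Qed.

End Smooth.

(** * Reachable rotations about the three axes *)

Section ReachPoly.
Context {R : realType} (K : R).

(** A quarter turn about the x axis sends the y axis to the z axis. *)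
Lemma reach_poly (p : {poly R}) i :
  reach K (fun w => jrot (axis i) p.[w] p^`().[w]).
Proof.
case: i => [[|[|[|//]]] ?]; rewrite /axis /=.
- exact: (reach_poly_xy K p true).
- exact: (reach_poly_xy K p false).
have := reach_conj (pi / 2) Omega_x3 (reach_pulse K true) (reach_poly_xy K p false).
by rewrite /= conj_x_y cos_pihalf sin_pihalf scale0r add0r scale1r.
Qed.

Lemma circle_angle (x y : R) : exists t, cos t * x - sin t * y = 0 /\ 0 <= sin t * x + cos t * y.
Proof.
pose r := Num.sqrt (x ^+ 2 + y ^+ 2).
have rr : r ^+ 2 = x ^+ 2 + y ^+ 2 by rewrite sqr_sqrtr// addr_ge0 ?sqr_ge0.
have r0 : 0 <= r by exact: sqrtr_ge0.
have [rz|rn] := eqVneq r 0.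
  move: rr; rewrite rz expr0n/= => h; exists 0; rewrite cos0 sin0.
  by have := sqr_ge0 x; have := sqr_ge0 y; split; nra.
have {}r0 : 0 < r by rewrite lt_neqAle eq_sym rn.
have c1 : -1 <= y / r <= 1.
  rewrite ler_pdivlMr// ler_pdivrMr//; have := sqr_ge0 x; nra.
have ca := acosK c1.
have sa : sin (acos (y / r)) = Num.sqrt (1 - (y / r) ^+ 2) by exact: sin_acos.
have xx : 1 - (y / r) ^+ 2 = (x / r) ^+ 2.
  rewrite !exprMn !exprVn; have r2 : r ^+ 2 != 0 by rewrite expf_neq0.
  by rewrite -[1](mulfV r2) -mulrBl rr addrK.
rewrite xx sqrtr_sqr in sa.
have xr : x = (x / r) * r by rewrite divfK.
have yr : y = (y / r) * r by rewrite divfK.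
have [x0|x0] := leP 0 (x / r).
  exists (acos (y / r)); rewrite ca sa ger0_norm//.
  by split; [rewrite [X in _ * X - _]xr [X in _ - _ * X]yr; ring|rewrite [X in _ * X + _]xr [X in _ + _ * X]yr; nra].
exists (- acos (y / r)); rewrite cosN sinN ca sa (ler0_norm (ltW x0)) opprK.
by split; [rewrite [X in _ * X - _]xr [X in _ - _ * X]yr; ring|rewrite [X in _ * X + _]xr [X in _ + _ * X]yr; nra].
Qed.

(** A rotation about the x axis cancels the second coordinate and makes the third
    nonnegative; a rotation about the y axis then cancels the first. *)
Lemma reach_e3 (c : 'cV[R]_3) : dot c c = 1 ->
  exists2 C : 'M[R]_3, reach K (fun=> jet C 0) & C *m c = e3.
Proof.
move=> c1.
have [s [s1 s2]] := circle_angle (c (lift ord0 ord0) 0) (c (lift ord0 (lift ord0 ord0)) 0).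
set z := sin s * _ + _ in s2.
have [t' [t1' t2']] := circle_angle (c ord0 0) z.
exists (rot Omega_y (- t') *m rot Omega_x s).
  have := reachM (reach_pulse K false (- t')) (reach_pulse K true s).
  apply: eq_reach => w; rewrite /jrot jetM /= !scale0r mulmx0 mul0mx addr0//.
have y0 : (rot Omega_x s *m c) (lift ord0 ord0) 0 = 0.
  by rewrite rot_xE mulmx3E !mxE /=; lra.
have z0 : (rot Omega_x s *m c) (lift ord0 (lift ord0 ord0)) 0 = z.
  by rewrite rot_xE mulmx3E !mxE /= /z; lra.
have x0 : (rot Omega_x s *m c) ord0 0 = c ord0 0.
  by rewrite rot_xE mulmx3E !mxE /=; lra.
set d := rot Omega_y (- t') *m rot Omega_x s *m c.
have dd : dot d d = 1.
  rewrite /d -mulmxA (dot_rot Omega_y3 (tr_axis (lift ord0 ord0))).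
  by rewrite (dot_rot Omega_x3 (tr_axis ord0)).
have d0 : d ord0 0 = 0.
  by rewrite /d -mulmxA rot_yE mulmx3E y0 z0 x0 !mxE /= ?cosN ?sinN; lra.
have d1 : d (lift ord0 ord0) 0 = 0.
  by rewrite /d -mulmxA rot_yE mulmx3E y0 z0 x0 !mxE /= ?cosN ?sinN; lra.
have d2 : 0 <= d (lift ord0 (lift ord0 ord0)) 0.
  by rewrite /d -mulmxA rot_yE mulmx3E y0 z0 x0 !mxE /= ?cosN ?sinN; lra.
have {}dd : d (lift ord0 (lift ord0 ord0)) 0 = 1.
  move: dd; rewrite /dot sum3 d0 d1; nra.
rewrite -/d; clearbody d; apply/matrixP => i j; rewrite ord1 [RHS]mxE.
case: i => [[|[|[|//]]] p] /=.
- by rewrite -[RHS]d0; congr (d _ _); apply/val_inj.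
- by rewrite -[RHS]d1; congr (d _ _); apply/val_inj.
- by rewrite -[RHS]dd; congr (d _ _); apply/val_inj.
Qed.

End ReachPoly.

(** * Descent of the energy *)

Section Perturbation.
Context {R : realType}.

Lemma dot_mulmx_le (L : 'M[R]_3) (x : 'cV[R]_3) (d : R) : 0 <= d ->
  (forall i j, `|L i j| <= d) -> dot (L *m x) (L *m x) <= 9 * d ^+ 2 * dot x x.
Proof.
move=> d0 hL.
have lin i : (L *m x) i 0 ^+ 2 <= 3 * d ^+ 2 * dot x x.
  rewrite mulmx3E /dot sum3.
  have sq j : L i j ^+ 2 <= d ^+ 2.
    by rewrite -(real_normK (num_real (L i j))) lerXn2r ?nnegrE.
  have CS (x0 x1 x2 y0 y1 y2 : R) : (x0 * y0 + x1 * y1 + x2 * y2) ^+ 2 <=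
      (x0 ^+ 2 + x1 ^+ 2 + x2 ^+ 2) * (y0 * y0 + y1 * y1 + y2 * y2).
    have := sqr_ge0 (x0 * y1 - x1 * y0); have := sqr_ge0 (x0 * y2 - x2 * y0).
    by have := sqr_ge0 (x1 * y2 - x2 * y1); nra.
  apply: le_trans (CS _ _ _ _ _ _) _; apply: ler_wpM2r.
    by rewrite -!expr2 !addr_ge0 ?sqr_ge0.
  by have := sq ord0; have := sq (lift ord0 ord0); have := sq (lift ord0 (lift ord0 ord0)); lra.
rewrite [X in X <= _]/dot sum3 -!expr2.
have := lin ord0; have := lin (lift ord0 ord0).
by have := lin (lift ord0 (lift ord0 ord0)); lra.
Qed.

(** Let [n] be the value and [h] the derivative of a curve on the sphere. The rotation
    by an angle of derivative [q] changes [h] into an isometric image of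
    [h + q *: (A *m n)], whose square is at most
    [dot h h + 2 * q * z + q ^+ 2 = dot h h - z ^+ 2 + (q + z) ^+ 2].
    The pair [D], [D'] is an approximation of the jet [B], [B'] of the rotation. *)
Lemma rotation_energy (B D B' D' : 'M[R]_3) (A : 'M[R]_3) (t q d Q z : R) (n h : 'cV[R]_3) :
  A *m A *m A = - A -> A^T = - A -> dot n n = 1 -> dot (A *m n) (A *m n) <= 1 ->
  0 < d <= 1 -> `|q| <= Q -> z = dot (A *m n) h ->
  B = rot A t -> B' = q *: (A *m rot A t) ->
  (forall i j, `|(D - B) i j| <= d) -> (forall i j, `|(D' - B') i j| <= d) ->
  dot (D *m h + D' *m n) (D *m h + D' *m n) <=
  dot h h - z ^+ 2 + (q + z) ^+ 2 + d * ((40 + 4 * Q ^+ 2) * (1 + dot h h)).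
Proof.
move=> A3 AT n1 An /andP[d0 d1] qQ zE -> -> hD hD'.
(* [f] is the exact derivative of the rotated curve, [e] the error on it. *)
set e := (D - rot A t) *m h + (D' - q *: (A *m rot A t)) *m n.
set f := rot A t *m (h + q *: (A *m n)).
have -> : D *m h + D' *m n = f + e.
  rewrite /f /e !mulmxBl mulmxDr -scalemxAr mulmxA mulmx_rotC -!scalemxAl.
  by rewrite addrACA [X in _ = X + _]addrC addrACA; rewrite addrC -!addrA;
    apply/matrixP => i j; rewrite !mxE; ring.
have fE : dot f f = dot h h + 2 * q * z + q ^+ 2 * dot (A *m n) (A *m n).
  rewrite /f dot_rot// dotDl !dotDr !(dotZl, dotZr) [dot h (A *m n)]dotC -zE; ring.
have h0 := dot_ge0 h.
have eE : dot e e <= 18 * d ^+ 2 * (1 + dot h h).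
  apply: le_trans (dot_le_sum _ _) _.
  by have := dot_mulmx_le h (ltW d0) hD; have := dot_mulmx_le n (ltW d0) hD'; rewrite n1; lra.
clearbody e.
have cross : 2 * dot f e <= d * dot f f + dot e e / d.
  have := dot_ge0 (d *: f - e).
  rewrite -scaleN1r dotDl !dotDr !(dotZl, dotZr) [dot e f]dotC => pos.
  rewrite -(ler_pM2l d0) [leRHS]mulrDr [d * (dot e e / d)]mulrC divfK ?gt_eqF//.
  by move: pos; clear; nra.
have ed : dot e e / d <= 18 * d * (1 + dot h h).
  by rewrite ler_pdivrMr//; apply: le_trans eE _; rewrite le_eqVlt; apply/orP; left; apply/eqP; ring.
have dd : d ^+ 2 <= d by rewrite expr2 -[leRHS]mulr1 ler_wpM2l// ltW.
have e2 : dot e e <= 18 * d * (1 + dot h h).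
  by apply: le_trans eE _; apply: ler_wpM2r; [lra|apply: ler_wpM2l; lra].
have q2 : q ^+ 2 <= Q ^+ 2.
  by rewrite -(real_normK (num_real q)) lerXn2r ?nnegrE// (le_trans _ qQ).
have An0 := dot_ge0 (A *m n).
have qA : q ^+ 2 * dot (A *m n) (A *m n) <= q ^+ 2.
  by rewrite -[leRHS]mulr1 ler_wpM2l// sqr_ge0.
have f1 : dot f f <= 2 * dot h h + 2 * Q ^+ 2.
  rewrite /f dot_rot//; apply: le_trans (dot_le_sum _ _) _.
  have -> : dot (q *: (A *m n)) (q *: (A *m n)) = q ^+ 2 * dot (A *m n) (A *m n).
    by rewrite dotZl dotZr mulrA.
  lra.
have df : d * dot f f <= d * (2 * dot h h + 2 * Q ^+ 2) by rewrite ler_wpM2l// ltW.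
rewrite dotDl !dotDr [dot e f]dotC.
have Q0 := sqr_ge0 Q.
have dQ : 0 <= d * (Q ^+ 2 * (1 + dot h h)) by rewrite (mulr_ge0 (ltW d0))// mulr_ge0// addr_ge0.
have dQh : 0 <= d * (Q ^+ 2 * dot h h) by rewrite (mulr_ge0 (ltW d0))// mulr_ge0.
have dh : 0 <= d * dot h h by rewrite mulr_ge0// ltW.
move: cross ed e2 qA df fE dQ dQh dh d0.
move: (dot f e) (dot f f) (dot e e / d) (dot e e) (dot h h) (q ^+ 2 * _) => fe ff ed ee hh qq.
clear; nra.
Qed.

End Perturbation.

Section Descent.
Context {R : realType} (a b : R) (ab : a < b) (M G : R -> 'cV[R]_3).
Hypothesis sM : forall i, sqint a b (fun w => M w i 0).
Hypothesis sG : forall i, sqint a b (fun w => G w i 0).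
Hypothesis wMG : forall i, weak_derivative a b (fun w => M w i 0) (fun w => G w i 0).
Hypothesis M1 : forall w, a < w < b -> dot (M w) (M w) = 1.
Notation mu := (@lebesgue_measure R).
Notation Int f := (\int[mu]_(x in `]a, b[) f x).

Definition carry (s : seq pulse) (w : R) : 'cV[R]_3 := flow s w *m M w.
(** The weak derivative of [carry s], see [weak_carry]. *)
Definition dcarry (s : seq pulse) (w : R) : 'cV[R]_3 := flow s w *m G w + dflow s w *m M w.
Definition energy (s : seq pulse) : R := Int (fun w => dot (dcarry s w) (dcarry s w)).

Lemma carry_unit s w : a < w < b -> dot (carry s w) (carry s w) = 1.
Proof. by move=> wab; rewrite flow_isometry M1. Qed.

Lemma carry_cat s1 s2 w : carry (s1 ++ s2) w = flow s1 w *m carry s2 w.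
Proof. by rewrite /carry (flow_cat _ _ _).1 mulmxA. Qed.

Lemma dcarry_cat s1 s2 w : dcarry (s1 ++ s2) w = flow s1 w *m dcarry s2 w + dflow s1 w *m carry s2 w.
Proof.
have [e1 e2] := flow_cat s1 s2 w.
by rewrite /dcarry /carry e1 e2 mulmxDr mulmxDl !mulmxA addrA.
Qed.

Lemma flow_continuous s i j : continuous (fun w : R => flow s w i j) /\
  continuous (fun w : R => dflow s w i j).
Proof.
by have [h1 h2] := @smooth_flow R s i j; split => //; exact: is_derive_continuous h1.
Qed.

Lemma sqint_mulmx (A : R -> 'M[R]_3) (x : R -> 'cV[R]_3) i :
  (forall i j, continuous (fun w : R => A w i j)) -> (forall i, sqint a b (fun w => x w i 0)) ->
  sqint a b (fun w => (A w *m x w) i 0).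
Proof.
move=> cA sx; apply: (@eq_sqint _ _ _ (fun w => \sum_j A w i j * x w j 0)).
  by move=> w _; rewrite mxE.
by apply: sqint_sum => // j; exact: sqintM_continuous.
Qed.

Lemma sqint_carry s i : sqint a b (fun w => carry s w i 0).
Proof. by apply: sqint_mulmx => // j k; have [] := flow_continuous s j k. Qed.

Lemma sqint_dcarry s i : sqint a b (fun w => dcarry s w i 0).
Proof.
apply: (@eq_sqint _ _ _ (fun w => (flow s w *m G w) i 0 + (dflow s w *m M w) i 0)).
  by move=> w _; rewrite [RHS]mxE.
by apply: sqintD; apply: sqint_mulmx => // j k; have [] := flow_continuous s j k.
Qed.

Lemma weak_carry s i : weak_derivative a b (fun w => carry s w i 0) (fun w => dcarry s w i 0).
Proof.
have -> : (fun w => carry s w i 0) = (fun w => \sum_j flow s w i j * M w j 0).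
  by apply/funext => w; rewrite mxE.
have -> : (fun w => dcarry s w i 0) =
    (fun w => \sum_j (dflow s w i j * M w j 0 + flow s w i j * G w j 0)).
  by apply/funext => w; rewrite !mxE -big_split; apply: eq_bigr => j _; rewrite addrC.
apply: weak_derivative_sum => // j.
- by apply: sqintM_continuous => //; have [] := flow_continuous s i j.
- by apply: sqintD; apply: sqintM_continuous => //; have [] := flow_continuous s i j.
- have [h1 h2] := @smooth_flow R s i j.
  exact: weak_derivative_smoothM.
Qed.

Lemma rint_dot (x y : R -> 'cV[R]_3) : (forall i, sqint a b (fun w => x w i 0)) ->
  (forall i, sqint a b (fun w => y w i 0)) -> rint a b (fun w => dot (x w) (y w)).
Proof. by move=> sx sy; apply: rint_sum => // i; exact: rintM_sqint. Qed.

Lemma carry_bounded s i w : a < w < b -> `|carry s w i 0| <= 1.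
Proof.
move=> wab; rewrite -(@ler_pXn2r _ 2)// ?nnegrE// expr1n (real_normK (num_real _)).
rewrite -(carry_unit s wab) /dot (bigD1 i)//= -expr2 lerDl sumr_ge0// => j _.
by rewrite -expr2 sqr_ge0.
Qed.

(** The components of the cross product of [carry s] and [dcarry s]: the derivatives of
    half the energy density with respect to the derivative of the angle of a rotation
    about [axis i]. *)
Definition torque (s : seq pulse) (i : 'I_3) (w : R) : R := dot (axis i *m carry s w) (dcarry s w).

Lemma sqint_torque s i : sqint a b (torque s i).
Proof.
apply: sqint_sum => // j.
apply: (@sqintM_bounded _ _ _ _ _ 3).
- by have [] := @sqint_mulmx (fun=> axis i) (carry s) j
     (fun i' j' => @cst_continuous _ _ _) (sqint_carry s).
- move=> w wab; rewrite mxE; apply: le_trans (ler_norm_sum _ _ _) _.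
  apply: (@le_trans _ _ (\sum_(k : 'I_3) 1)); last by rewrite sumr_const card_ord.
  apply: ler_sum => k _; rewrite normrM -[leRHS]mulr1; apply: ler_pM => //.
    have := rb_entry j k; rewrite /axis; case: ifP => _; first by apply; exact: rb_Omega_x.
    by case: ifP => _; apply; [exact: rb_Omega_y|exact: rb_Omega_z].
  exact: carry_bounded.
- exact: sqint_dcarry.
Qed.

(** As [carry s] is orthogonal to its derivative [dcarry s], no energy is lost in the
    cross product. *)
Lemma energy_split s : \sum_i Int (fun w => torque s i w ^+ 2) = energy s.
Proof.
have MG0 : Int (fun w => dot (M w) (G w) ^+ 2) = 0.
  by apply: (sphere_orthogonal ab sM sG wMG) => w /M1 <-; apply: eq_bigr => i _; rewrite expr2.
have sMG : sqint a b (fun w => dot (M w) (G w)).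
  apply: sqint_sum => // i; apply: (@sqintM_bounded _ _ _ _ _ 1) => //; first by case: (sM i).
  by move=> w wab; have := carry_bounded [::] i wab; rewrite /carry mul1mx.
have r1 := rint_dot (sqint_dcarry s) (sqint_dcarry s); have [_ r2] := sMG.
rewrite -Int_sum; [|done|by move=> i; case: (sqint_torque s i)].
transitivity (energy s - Int (fun w => dot (M w) (G w) ^+ 2)); last by rewrite MG0 subr0.
rewrite -IntB//; apply: eq_Int => w wab; rewrite lagrange carry_unit// mul1r; congr (_ - _ ^+ 2).
exact: flow_dot.
Qed.

Lemma energy_ge0 s : 0 <= energy s.
Proof. by apply: Int_ge0 => w _; exact: dot_ge0. Qed.

(** One step of the descent: the largest component of the cross product carries
    at least one third of the energy, and is cancelled in [L^2] by a rotation
    whose angle is a polynomial. *)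
Lemma energy_step (s : seq (@pulse R)) (e : R) : all (fun p => 0 < p.1) s -> 0 < e ->
  exists s', all (fun p => 0 < p.1) s' /\ energy s' <= 2 / 3 * energy s + e.
Proof.
move=> ps e0.
have [i hi] : exists i, energy s / 3 <= Int (fun w => torque s i w ^+ 2).
  apply/not_existsP => h.
  have h' i : Int (fun w => torque s i w ^+ 2) < energy s / 3 by rewrite ltNge; apply/negP; exact: h.
  have aux (x y z E : R) : x < E / 3 -> y < E / 3 -> z < E / 3 -> x + y + z <> E by lra.
  by have := energy_split s; rewrite sum3; apply: aux; exact: h'.
have sZ := sqint_torque s i.
have e2 : 0 < e / 2 by exact: divr_gt0.
have [p0 hp0] := poly_dense ab (sqintN sZ) e2.
have [p [p' _]] := poly_primitive p0 0.
have [Q Q0 hQ] := continuous_itv_bounded (ltW ab) (@continuous_horner R p^`()).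
(* [d * C] is the integral of the error term of [rotation_energy]. *)
pose C := (40 + 4 * Q ^+ 2) * (b - a + energy s).
have C0 : 0 <= C.
  have Q40 : 0 <= 40 + 4 * Q ^+ 2 by rewrite addr_ge0// mulr_ge0// sqr_ge0.
  by rewrite /C (mulr_ge0 Q40)// addr_ge0 ?energy_ge0// subr_ge0 ltW.
pose d := Num.min 1 (e / (2 * (C + 1))).
have d0 : 0 < d by rewrite lt_min ltr01/= divr_gt0// mulr_gt0//; lra.
have d1 : d <= 1 by rewrite ge_min lexx.
have dC : d * C <= e / 2.
  have : d <= e / (2 * (C + 1)) by rewrite ge_min lexx orbT.
  rewrite ler_pdivlMr ?mulr_gt0//; last by lra.
  by move: d0 C0; clear; nra.
have [s2 [ps2 c2]] := @reach_poly _ (`|a| + `|b|) p i d d0.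
exists (s2 ++ s); split; first by rewrite all_cat ps2.
have pw w : a < w < b -> dot (dcarry (s2 ++ s) w) (dcarry (s2 ++ s) w) <=
    dot (dcarry s w) (dcarry s w) - torque s i w ^+ 2 + (p^`().[w] + torque s i w) ^+ 2
    + d * ((40 + 4 * Q ^+ 2) * (1 + dot (dcarry s w) (dcarry s w))).
  move=> wab.
  have wK : `|w| <= `|a| + `|b|.
    case/andP: wab => aw wb; have := ler_norm b; have := ler_norm (- a).
    rewrite normrN; have := normr_ge0 a; have := normr_ge0 b.
    by rewrite ler_norml; lra.
  have := c2 w wK; rewrite /jflow /jrot jetN jetD => cw.
  rewrite dcarry_cat; apply: (@rotation_energy R (rot (axis i) p.[w]) _
      (p^`().[w] *: (axis i *m rot (axis i) p.[w])) _ (axis i) p.[w] p^`().[w]) => //.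
  - exact: axis3.
  - exact: tr_axis.
  - exact: carry_unit.
  - by rewrite -(carry_unit s wab); exact: dot_axis_le.
  - by rewrite d0.
  - by case/andP: wab => *; apply: hQ; rewrite !ltW.
  - by move=> j k; have [] := rb_jet_inv j k cw.
  - by move=> j k; have [] := rb_jet_inv j k cw.
have rE := rint_dot (sqint_dcarry s) (sqint_dcarry s).
have rE' := rint_dot (sqint_dcarry (s2 ++ s)) (sqint_dcarry (s2 ++ s)).
have [_ rZ] := sZ.
have [_ rpZ] := sqintD (sqint_poly ab p^`()) sZ.
have r1 : rint a b (fun w => 1 + dot (dcarry s w) (dcarry s w)) by apply: rintD => //; exact: (rint_cst ab).
have r2 := rintZ (40 + 4 * Q ^+ 2) r1; have r3 := rintZ d r2.
have r4 := rintB rE rZ; have r5 := rintD r4 rpZ; have r6 := rintD r5 r3.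
apply: le_trans (le_Int rE' r6 pw) _.
rewrite (IntD r5 r3) (IntD r4 rpZ) (IntB rE rZ) (IntZ _ r2) (IntZ _ r1) IntD//; last exact: (rint_cst ab).
rewrite (_ : \int[mu]_(_ in `]a, b[) 1 = b - a); last by rewrite (Int_cst ab) mul1r.
rewrite -/(energy s) -/C.
have iZ : Int (fun w => (p^`().[w] + torque s i w) ^+ 2) < e / 2.
  apply: le_lt_trans hp0; rewrite le_eqVlt; apply/orP; left; apply/eqP.
  by apply: eq_Int => w _; rewrite p'; ring.
have aux (E z q x : R) : E / 3 <= z -> q < e / 2 -> x <= e / 2 ->
   E - z + q + x <= 2 / 3 * E + e by lra.
exact: aux.
Qed.

(** The energy is multiplied by at most [2 / 3] at each step; the errors [e / 6] add
    up to at most [3 * (e / 6)]. *)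
Lemma energy_small (e : R) : 0 < e ->
  exists s, all (fun p => 0 < p.1) s /\ energy s <= e.
Proof.
move=> e0.
have e6 : 0 < e / 6 by exact: divr_gt0.
have iter n : exists s, all (fun p => 0 < p.1) s /\
    energy s <= (2 / 3) ^+ n * energy [::] + 3 * (e / 6).
  elim: n => [|n [s [ps hs]]].
    by exists [::]; split => //; rewrite expr0 mul1r; lra.
  have [s' [ps' hs']] := energy_step ps e6.
  exists s'; split => //; apply: le_trans hs' _.
  rewrite exprS -(mulrA (2 / 3) (_ ^+ n)).
  by move: hs e6; move: ((2 / 3) ^+ n * _) (energy s) => x y; lra.
have e1 : 0 < e / (2 * (energy [::] + 1)).
  by rewrite divr_gt0// mulr_gt0//; have := energy_ge0 [::]; lra.
have q1 : `|2 / 3 : R| < 1 by rewrite gtr0_norm; lra.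
have /cvgrPdist_lt/(_ _ e1)[n _ hn] := cvg_expr q1.
have [s [ps hs]] := iter n; exists s; split => //; apply: le_trans hs _.
have := hn n (leqnn n); rewrite /= sub0r normrN ger0_norm ?exprn_ge0//.
have E0 := energy_ge0 [::].
rewrite ltr_pdivlMr ?mulr_gt0//; last lra.
have x0 : 0 <= (2 / 3 : R) ^+ n by rewrite exprn_ge0//; lra.
by move: ((2 / 3) ^+ n) x0 => x; move: (energy [::]) E0 => E; nra.
Qed.

(** A curve on the sphere with small energy stays close to one of its own points:
    some value is close to the mean, by averaging in the Poincare inequality. *)
Lemma carry_nearly_constant s (e : R) : 0 < e -> exists c, dot c c = 1 /\
  Int (fun w => dot (carry s w - c) (carry s w - c)) <= 16 * (b - a) ^+ 2 * energy s + e.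
Proof.
move=> e0.
pose m : 'cV[R]_3 := \col_i (Int (fun w => carry s w i 0) / (b - a)).
have sub c : forall i, sqint a b (fun w => (carry s w - c) i 0).
  move=> i; apply: eq_sqint (sqintB (sqint_carry s i) (sqint_cst ab (c i 0))).
  by move=> w _; rewrite !mxE.
have rsub c := rint_dot (sub c) (sub c).
have l0 : 0 < b - a by rewrite subr_gt0.
set P := Int (fun w => dot (carry s w - m) (carry s w - m)).
have P_le : P <= 4 * (b - a) ^+ 2 * energy s.
  rewrite /P (Int_sum ab); last by move=> i; exact: rintM_sqint.
  rewrite /energy (Int_sum ab); last by move=> i; apply: rintM_sqint; exact: sqint_dcarry.
  rewrite mulr_sumr; apply: ler_sum => i _.
  have := poincare ab (sqint_carry s i) (sqint_dcarry s i) (weak_carry s i).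
  rewrite (_ : Int (fun x => dcarry s x i 0 ^+ 2) = Int (fun x => dcarry s x i 0 * dcarry s x i 0));
    last by apply: eq_Int => w _; rewrite expr2.
  apply: le_trans; rewrite le_eqVlt; apply/orP; left; apply/eqP; apply: eq_Int => w _.
  by rewrite !mxE expr2.
have [w0 [w0ab hw0]] : exists w0, a < w0 < b /\
    dot (carry s w0 - m) (carry s w0 - m) <= (P + e / 2) / (b - a).
  apply/not_existsP => h.
  (* Otherwise the integral of the left-hand side, which is [P], would be at least
     [P + e / 2]. *)
  suff : P + e / 2 <= P by apply/negP; rewrite -ltNge ltrDl divr_gt0.
  have -> : P + e / 2 = Int (cst ((P + e / 2) / (b - a))).
    by rewrite (Int_cst ab) divfK// gt_eqF.
  apply: le_Int; [exact: (rint_cst ab)|exact: rsub|].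
  by move=> w wab /=; rewrite leNgt; apply/negP => /ltW hw; apply: (h w).
exists (carry s w0); split; first exact: carry_unit.
rewrite ler_pdivlMr// in hw0.
have r2 := rintZ 2 (rsub m).
apply: (@le_trans _ _ (Int (fun w => 2 * dot (carry s w - m) (carry s w - m)
    + 2 * dot (carry s w0 - m) (carry s w0 - m)))).
  apply: le_Int; [exact: rsub|by apply: rintD => //; exact: (rint_cst ab)|].
  move=> w _; have -> : carry s w - carry s w0 = (carry s w - m) + - 1 *: (carry s w0 - m).
    by rewrite scaleN1r opprB addrA subrK.
  apply: le_trans (dot_le_sum _ _) _; rewrite dotZl dotZr; lra.
rewrite IntD//; last exact: (rint_cst ab).
set x := dot _ _ in hw0 *.
rewrite (IntZ _ (rsub m)) (_ : \int[mu]_(_ in `]a, b[) (2 * x) = 2 * x * (b - a)); last exact: (Int_cst ab).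
rewrite -/P; move: hw0 P_le; clear; move: (energy s) x P (b - a) => E x y l.
lra.
Qed.

(** After the energy has been made small, the curve is close to a constant, and a
    reachable constant rotation brings it close to [e3]. The approximations of this
    rotation have a small derivative, so that they at most double the energy, up to
    a small error. *)
Lemma steer (e : R) : 0 < e -> exists s, all (fun p => 0 < p.1) s /\
  Int (fun w => dot (carry s w - e3) (carry s w - e3) + dot (dcarry s w) (dcarry s w)) <= e.
Proof.
move=> e0; have l0 : 0 < b - a by rewrite subr_gt0.
pose l := b - a.
have k0 : 0 < 8 * (16 * l ^+ 2 + 1) by rewrite mulr_gt0// ltr_wpDl// mulr_ge0// sqr_ge0.
have [s [ps]] := energy_small (divr_gt0 e0 k0).
rewrite ler_pdivlMr// => hE.
have e8 : 0 < e / 8 by exact: divr_gt0.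
have [c [c1 hc]] := carry_nearly_constant s e8.
have [C hC Cc] := reach_e3 (`|a| + `|b|) c1.
pose d := Num.min 1 (e / (72 * l)).
have d0 : 0 < d by rewrite lt_min ltr01/= divr_gt0// mulr_gt0.
have d1 : d <= 1 by rewrite ge_min lexx.
have dl : d * (72 * l) <= e by rewrite -ler_pdivlMr ?mulr_gt0// ge_min lexx orbT.
have [s2 [ps2 c2]] := hC d d0.
exists (s2 ++ s); split; first by rewrite all_cat ps2.
have sub t c' : forall i, sqint a b (fun w => (carry t w - c') i 0).
  move=> i; apply: eq_sqint (sqintB (sqint_carry t i) (sqint_cst ab (c' i 0))).
  by move=> w _; rewrite !mxE.
have rsub t c' := rint_dot (sub t c') (sub t c').
have rE t := rint_dot (sqint_dcarry t) (sqint_dcarry t).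
have r0 := rintD (rsub (s2 ++ s) e3) (rE (s2 ++ s)).
have r1 := rintZ 2 (rsub s c); have r2 := rintZ 2 (rE s); have r3 := rintD r1 r2.
have r4 := rint_cst ab (36 * d ^+ 2); have r5 := rintD r3 r4.
apply: le_trans (le_Int r0 r5 _) _.
  move=> w wab.
  have wK : `|w| <= `|a| + `|b|.
    case/andP: wab => aw wb; have := ler_norm b; have := ler_norm (- a).
    rewrite normrN; have := normr_ge0 a; have := normr_ge0 b.
    by rewrite ler_norml; lra.
  have := c2 w wK; rewrite /jflow jetN jetD subr0 => cw.
  have cF i j : `|(flow s2 w - C) i j| <= d by have [] := rb_jet_inv i j cw.
  have cF' i j : `|dflow s2 w i j| <= d by have [] := rb_jet_inv i j cw.
  have -> : carry (s2 ++ s) w - e3 = flow s2 w *m (carry s w - c) + (flow s2 w - C) *m c.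
    by rewrite carry_cat -Cc mulmxBr mulmxBl addrA subrK.
  rewrite dcarry_cat /=.
  have := dot_le_sum (flow s2 w *m (carry s w - c)) ((flow s2 w - C) *m c).
  have := dot_le_sum (flow s2 w *m dcarry s w) (dflow s2 w *m carry s w).
  have := dot_mulmx_le c (ltW d0) cF; have := dot_mulmx_le (carry s w) (ltW d0) cF'.
  rewrite c1 carry_unit// mulr1.
  have -> := flow_isometry s2 w (carry s w - c) (carry s w - c).
  have -> := flow_isometry s2 w (dcarry s w) (dcarry s w).
  by lra.
rewrite (IntD r3 r4) (IntD r1 r2) (IntZ _ (rsub s c)) (IntZ _ (rE s)) -/(energy s) (Int_cst ab) -/l.
have dd : d ^+ 2 * l <= d * l by rewrite ler_pM2r// expr2 -[leRHS]mulr1 ler_wpM2l// ltW.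
have y72 : d ^+ 2 * l * 72 <= e.
  by apply: le_trans dl; rewrite mulrCA mulrC ler_pM2l.
have aux (E I l2 y e' : R) : E * (8 * (16 * l2 + 1)) <= e' -> I <= 16 * l2 * E + e' / 8 ->
  y * 72 <= e' -> 2 * I + 2 * E + 36 * y <= e' by lra.
rewrite -[36 * d ^+ 2 * l]mulrA.
exact: aux hE hc y72.
Qed.

End Descent.

(** * Weak convergence to the north pole *)

Section StrongWeak.
Context {R : realType} {k : nat} (a b : R) (ab : a < b).

Lemma H1_pair_sub (f g f' g' : R -> 'cV[R]_k) : H1_pair a b f f' -> H1_pair a b g g' ->
  H1_pair a b (fun x => -1 *: f x + g x) (fun x => -1 *: f' x + g' x).
Proof.
move=> hf hg i; have [/L2P sf /L2P sf' wf] := hf i; have [/L2P sg /L2P sg' wg] := hg i.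
have eN (h : R -> 'cV[R]_k) (h' : R -> 'cV[R]_k) :
    (fun x => (-1 *: h x + h' x) i 0) = (fun x => -1 * h x i 0 + h' x i 0).
  by apply/funext => x; rewrite !mxE.
rewrite !eN; split; try by apply/L2P; apply: sqintD => //; exact: sqintZ.
have h1 (x : R) : is_derive x (1 : R) (fun=> -1 : R) 0 by exact: is_derive_cst.
have h2 : continuous (fun _ : R => 0 : R) by exact: cst_continuous.
have wN := weak_derivative_smoothM ab h1 h2 sf sf' wf.
have e0 : (fun x => 0 * f x i 0 + -1 * f' x i 0) = (fun x => -1 * f' x i 0).
  by apply/funext => x; rewrite mul0r add0r.
rewrite e0 in wN.
by apply: weak_derivativeD => //; exact: sqintZ.
Qed.

(** A continuous linear form is Lipschitz for the [H^1] norm. *)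
Lemma H1_strong_weak (f f' : nat -> R -> 'cV[R]_k) (l l' : R -> 'cV[R]_k) :
  (forall n, H1_pair a b (f n) (f' n)) -> H1_pair a b l l' ->
  (forall n, H1_norm a b (fun x => -1 *: l x + f n x) (fun x => -1 *: l' x + f' n x)
     <= harmonic n) ->
  H1_weak_cvg a b f l.
Proof.
move=> hf hl hn; split; first by move=> n; exists (f' n).
  by exists l'.
move=> L [lin [C hC]].
have dist n : `|L l - L (f n)| <= `|C| * harmonic n.
  have := lin (-1) l (f n) (ex_intro _ _ hl) (ex_intro _ _ (hf n)).
  rewrite mulN1r addrC distrC => <-.
  apply: le_trans (hC _ _ (H1_pair_sub hl (hf n))) _.
  have N0 : 0 <= H1_norm a b (fun x => -1 *: l x + f n x) (fun x => -1 *: l' x + f' n x).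
    exact: sqrtr_ge0.
  by apply: le_trans (ler_wpM2r N0 (ler_norm C)) _; rewrite ler_wpM2l.
apply/cvgrPdist_le => e e0.
have h0 : (fun n => `|C| * harmonic n : R) n @[n --> \oo] --> 0.
  by rewrite -[X in _ --> X](mulr0 `|C|); apply: cvgMr; exact: cvg_harmonic.
move/cvgrPdist_le: h0 => /(_ e e0); apply: filterS => n.
rewrite sub0r normrN ger0_norm; last by rewrite mulr_ge0// invr_ge0.
exact: le_trans (dist n).
Qed.

End StrongWeak.

Theorem theorem6 (R : realType) (w_low w_up : R) (M0 : R -> 'cV[R]_3) :
  w_low < w_up ->
  H1_sphere w_low w_up M0 ->
  exists (t : nat -> R) (u v : nat -> dirac_sum R),
    [/\ forall n, 0 <= t n,
        forall n, D (u n),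
        forall n, D (v n) &
        H1_weak_cvg w_low w_up
          (fun n => U_right (t n) (u n) (v n) M0) (fun=> e3)].
Proof.
move=> ab [[G MG] M1].
have sM i : sqint w_low w_up (fun w => M0 w i 0) by have [/L2P] := MG i.
have sG i : sqint w_low w_up (fun w => G w i 0) by have [_ /L2P] := MG i.
have wMG i : weak_derivative w_low w_up (fun w => M0 w i 0) (fun w => G w i 0).
  by have [] := MG i.
have dM w : w_low < w < w_up -> dot (M0 w) (M0 w) = 1.
  by move=> /M1 /= M1w; rewrite -eucl_normE M1w expr1n.
have /choice[q hq] (n : nat) : exists q : seq (@pulse R) * (R * (dirac_sum R * dirac_sum R)),
    let: (s, (t, (u, v))) := q in
    [/\ 0 <= t, D u, D v, U_right t u v M0 = carry M0 s &
    \int[@lebesgue_measure R]_(w in `]w_low, w_up[)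
      (dot (carry M0 s w - e3) (carry M0 s w - e3) + dot (dcarry M0 G s w) (dcarry M0 G s w))
      <= harmonic n ^+ 2].
  (* [H1_norm] is a square root: its square must be at most [harmonic n ^+ 2]. *)
  have h0 : 0 < (harmonic n : R) ^+ 2 by rewrite exprn_gt0// invr_gt0.
  have [s [ps hs]] := steer ab sM sG wMG dM h0.
  have [t [u [v [t0 Du Dv _ ut]]]] := flow_reachable ps.
  by exists (s, (t, (u, v))); split.
exists (fun n => (q n).2.1), (fun n => (q n).2.2.1), (fun n => (q n).2.2.2).
split; try by move=> n; have := hq n; case: (q n) => [s [t [u v]]] [].
apply: (@H1_strong_weak _ _ _ _ ab _ (fun n => dcarry M0 G (q n).1) _ (fun=> 0)).
- move=> n i; have := hq n; case: (q n) => [s [t [u v]]] [_ _ _ -> _] /=.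
  split; [apply/L2P; exact: sqint_carry|apply/L2P; exact: sqint_dcarry|].
  exact: weak_carry.
- move=> i; split; [apply/L2P; exact: (sqint_cst ab)|apply/L2P|].
    by apply: eq_sqint (sqint_cst ab 0) => w _; rewrite mxE.
  have -> : (fun=> (0 : 'cV[R]_3) i 0) = (fun=> 0) :> (R -> R) by apply/funext => w; rewrite mxE.
  exact: weak_derivative_cst.
- move=> n; have := hq n; case: (q n) => [s [t [u v]]] [_ _ _ -> hs] /=.
  have h0 : 0 <= (harmonic n : R) by rewrite invr_ge0.
  rewrite -[leRHS](ger0_norm h0) -sqrtr_sqr; apply: ler_wsqrtr; apply: le_trans hs.
  rewrite le_eqVlt; apply/orP; left; apply/eqP; apply: eq_Int => w _.
  by rewrite !eucl_normE scaler0 add0r scaleN1r [- e3 + _]addrC.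
Qed.
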